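(* Let $\zeta$, $\tau_\pm$, $G_0$ and the coefficients $a_{s,0},a_{s,1}$ ($s=0,1,2,\dots$) be as defined in the context. Let $$A_{0,0}(\tau,\zeta)=\frac{\tau-2\zeta}{\tau^2-2\zeta\tau+2\zeta},\qquad A_{0,1}(\tau,\zeta)=\frac{1}{\tau^2-2\zeta\tau+2\zeta},$$ and for $s=0,1,2,\dots$, $n=0,1$, let $$A_{s+1,n}(\tau,\zeta)=\frac{(\tau-2\zeta)^{1-b}\tau^{b-c+1}}{\tau^2-2\zeta\tau+2\zeta}\,\frac{d}{d\tau}\left(\frac{(\tau-2\zeta)^b}{\tau^{b-c}}A_{s,n}(\tau,\zeta)\right).$$ Then the coefficients $a_{s,1}$ have the integral representation $$a_{s,1}=\frac{1}{2\pi i}\oint_{\mathcal C}A_{s,1}(\tau,\zeta)\,G_0(\tau)\,d\tau,$$ but for $a_{s,0}$ we have $$a_{s,0}=\frac{1}{2\pi i}\int_{\mathcal C}G_0(\tau)\left(A_{s,0}(\tau,\zeta)+(c-1)A_{s-1,1}(\tau,\zeta)\right)d\tau,$$ where for $s=0$ the term with $A_{-1,1}$ is absent. Here $\mathcal C$ is a simple closed contour (for instance a circle $|\tau|=r$ with suitable $r$) which encircles the points $\tau_\pm$ once in the positive sense, with all singularities of $G_0$ in its exterior.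
   Context: Let $a,b,c$ be fixed parameters. Parameters. For $z$ near $1$ write $z=\cos\theta$, $\theta=\sigma+\sin\sigma$, $\zeta=1-\cos\sigma$, with $\theta,\sigma\to0$ as $z\to1$. Put $t_\pm=\frac{1+e^{\pm i\theta}}{2}$ and $\tau_\pm=1-e^{\pm i\sigma}$; $\tau_\pm$ are the zeros of $\tau^2-2\zeta\tau+2\zeta$. Change of variables. The variable $t=t(\tau)$ is defined by $$\ln\left(\frac{\frac{1+z}{2}-t}{1-t}\right)-\ln t=\ln\left(\frac{\tau-2\zeta}{\tau}\right)+\tau-\zeta,$$ with $\tau=\tau_\pm$ corresponding to $t=t_\pm$ (these are the saddle points of the left-hand side as a function of $t$ and of the right-hand side as a function of $\tau$). The function $G_0$ is $$G_0(\tau)=\left(\frac{\tau-2\zeta}{\frac{1+z}{2}-t}\right)^{b}\left(\frac{1-t}{\tau}\right)^{b-c}t^{\,c-a-1}\frac{dt}{d\tau},$$ which is analytic near the saddle points $\tau_\pm$. Coefficients. For $s=0,1,2,\dots$ the functions $G_s,H_s$ and the coefficients $a_{s,0},a_{s,1}$ are defined recursively by $$a_{s,1}=\frac{G_s(\tau_+)-G_s(\tau_-)}{\tau_+-\tau_-},\qquad a_{s,0}=G_s(\tau_+)-\tau_+a_{s,1},$$ $$G_s(\tau)=a_{s,0}+a_{s,1}\tau+\frac{\tau^2-2\zeta\tau+2\zeta}{\tau(\tau-2\zeta)}H_s(\tau),$$ $$G_{s+1}(\tau)=-\frac{(\tau-2\zeta)^b}{\tau^{b-c}}\frac{d}{d\tau}\left(\frac{\tau^{b-c}}{(\tau-2\zeta)^b}H_s(\tau)\right).$$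 The functions $A_{s,n}(\tau,\zeta)$ are rational in $\tau$ (the multivalued powers cancel).
   Formalization: In the formula for a_{s,0} the term (c-1)A_{s-1,1} carries a minus sign instead of the printed plus; the printed sign fails, e.g. for s=1, c≠1, a≠c/2 and z close to 1, where a_{0,1}≠0. *)

(* Defs.v *)
(* Complex numbers are Coquelicot's [C], over the real numbers of Stdlib. *)
From Stdlib Require Import Reals ClassicalEpsilon.
From Coquelicot Require Import Coquelicot.
Open Scope C_scope.

Definition Cexp (w : C) : C :=
  ((exp (Re w) * cos (Im w))%R, (exp (Re w) * sin (Im w))%R).
Definition Ccos (w : C) : C := (Cexp (Ci * w) + Cexp (- (Ci * w))) / 2.
Definition Csin (w : C) : C := (Cexp (Ci * w) - Cexp (- (Ci * w))) / (2 * Ci).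

(* Multivalued logarithm and powers: the second argument is one of the values. *)
Definition is_Clog (w l : C) : Prop := Cexp l = w.
Definition is_Cpower (w p v : C) : Prop :=
  exists l : C, is_Clog w l /\ v = Cexp (p * l).

(* A determination of the logarithm that is holomorphic near [w0]; it exists
   exactly when [w0 <> 0], and is unspecified for [w0 = 0]. *)
Definition is_local_log (w0 : C) (L : C -> C) : Prop :=
  locally w0 (fun w : C => is_Clog w (L w) /\ ex_derive L w).
Definition local_log (w0 : C) : C -> C :=
  epsilon (inhabits (fun w : C => w)) (is_local_log w0).
(* The determination of [w ^ p], for [w] near [w0], given by [local_log w0];
   powers with the same base point [w0] obey the exponent laws. *)
Definition power_near (w0 p w : C) : C := Cexp (p * local_log w0 w).

Definition holomorphic_on (D : C -> Prop) (f : C -> C) : Prop :=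
  forall w : C, D w -> ex_derive f w.

Definition path_connected (D : C -> Prop) : Prop :=
  forall w1 w2 : C, D w1 -> D w2 ->
  exists p : R -> C,
    p 0%R = w1 /\ p 1%R = w2 /\
    continuous_on (fun x : R => (0 <= x <= 1)%R) p /\
    (forall x : R, (0 <= x <= 1)%R -> D (p x)).

Definition region (D : C -> Prop) : Prop := open D /\ path_connected D.

(* Contours are parametrized by [0, 1]; values of [gamma] outside [0, 1] are
   irrelevant. *)
Definition piecewise_C1 (gamma : R -> C) : Prop :=
  exists (n : nat) (p : nat -> R),
    p 0%nat = 0%R /\ p n = 1%R /\
    forall i : nat, (i < n)%nat ->
      (p i < p (S i))%R /\
      exists dgamma : R -> C,
        continuous_on (fun x : R => (p i <= x <= p (S i))%R) dgamma /\
        (forall x : R, (p i < x < p (S i))%R ->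
           is_derive (K := R_AbsRing) (V := C_R_NormedModule)
             gamma x (dgamma x)).

Definition simple_closed_contour (gamma : R -> C) : Prop :=
  continuous_on (fun x : R => (0 <= x <= 1)%R) gamma /\
  piecewise_C1 gamma /\
  gamma 0%R = gamma 1%R /\
  (forall x y : R, (0 <= x < 1)%R -> (0 <= y < 1)%R ->
     gamma x = gamma y -> x = y).

Definition on_contour (gamma : R -> C) (w : C) : Prop :=
  exists x : R, (0 <= x <= 1)%R /\ gamma x = w.

Definition velocity (gamma : R -> C) (x : R) : C :=
  (Derive (fun y : R => Re (gamma y)) x, Derive (fun y : R => Im (gamma y)) x).

Definition contour_integral (gamma : R -> C) (f : C -> C) : C :=
  RInt (V := C_R_CompleteNormedModule)
    (fun x : R => f (gamma x) * velocity gamma x) 0 1.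

Definition winding_number (gamma : R -> C) (w : C) : C :=
  contour_integral gamma (fun u : C => 1 / (u - w)) / (2 * PI * Ci).

Definition encircles_once (gamma : R -> C) (w : C) : Prop :=
  ~ on_contour gamma w /\ winding_number gamma w = 1.

(* The unbounded component of the complement of the contour: the points that can
   be joined to infinity without meeting the contour. *)
Definition exterior (gamma : R -> C) (w : C) : Prop :=
  exists p : R -> C,
    p 0%R = w /\
    continuous_on (fun x : R => (0 <= x)%R) p /\
    (forall x : R, (0 <= x)%R -> ~ on_contour gamma (p x)) /\
    is_lim (fun x : R => Cmod (p x)) p_infty p_infty.

(* Everything is parametrized by sigma; z = cos theta with
   theta = sigma + sin sigma. *)
Definition theta (sigma : C) : C := sigma + Csin sigma.
Definition zvar (sigma : C) : C := Ccos (theta sigma).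
Definition zeta (sigma : C) : C := 1 - Ccos sigma.
Definition tau_p (sigma : C) : C := 1 - Cexp (Ci * sigma).
Definition tau_m (sigma : C) : C := 1 - Cexp (- (Ci * sigma)).
Definition t_p (sigma : C) : C := (1 + Cexp (Ci * theta sigma)) / 2.
Definition t_m (sigma : C) : C := (1 + Cexp (- (Ci * theta sigma))) / 2.

Definition quad (sigma tau : C) : C :=
  tau * tau - 2 * zeta sigma * tau + 2 * zeta sigma.

(* The points where the formulas in tau contain ln 0 or 0 / 0, possibly as
   removable singularities. *)
Definition exceptional (sigma tau : C) : Prop :=
  tau = 0 \/ tau = 2 * zeta sigma.

(* [t] is an analytic function t(tau) on the domain [U] defined by the implicit
   equation (for some values of the logarithms) with tau_p, tau_m corresponding
   to t_p, t_m. *)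
Definition change_of_variables (sigma : C) (U : C -> Prop) (t : C -> C)
    : Prop :=
  region U /\ U (tau_p sigma) /\ U (tau_m sigma) /\
  holomorphic_on U t /\
  t (tau_p sigma) = t_p sigma /\ t (tau_m sigma) = t_m sigma /\
  forall tau : C, U tau -> ~ exceptional sigma tau ->
    exists l1 l2 l3 : C,
      is_Clog (((1 + zvar sigma) / 2 - t tau) / (1 - t tau)) l1 /\
      is_Clog (t tau) l2 /\
      is_Clog ((tau - 2 * zeta sigma) / tau) l3 /\
      l1 - l2 = l3 + tau - zeta sigma.

(* [G0] is, on [U], an analytic determination of the multivalued expression, and
   is continued analytically to the domain [D]. *)
Definition is_G0 (a b c sigma : C) (U D : C -> Prop) (t G0 : C -> C) : Prop :=
  region D /\ (forall tau : C, U tau -> D tau) /\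
  holomorphic_on D G0 /\
  forall tau : C, U tau -> ~ exceptional sigma tau ->
    exists v1 v2 v3 : C,
      is_Cpower
        ((tau - 2 * zeta sigma) / ((1 + zvar sigma) / 2 - t tau)) b v1 /\
      is_Cpower ((1 - t tau) / tau) (b - c) v2 /\
      is_Cpower (t tau) (c - a - 1) v3 /\
      G0 tau = v1 * v2 * v3 * C_derive t tau.

(* The coefficients a_{s,1} and a_{s,0} attached to g = G_s. *)
Definition coef1 (sigma : C) (g : C -> C) : C :=
  (g (tau_p sigma) - g (tau_m sigma)) / (tau_p sigma - tau_m sigma).
Definition coef0 (sigma : C) (g : C -> C) : C :=
  g (tau_p sigma) - tau_p sigma * coef1 sigma g.

(* The analytic functions G_s, H_s on [D] determined recursively by G_0. *)
Definition GH_recursion (b c sigma : C) (D : C -> Prop)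
    (G H : nat -> C -> C) : Prop :=
  forall s : nat,
    holomorphic_on D (G s) /\ holomorphic_on D (H s) /\
    (forall tau : C, D tau -> ~ exceptional sigma tau ->
       G s tau = coef0 sigma (G s) + coef1 sigma (G s) * tau
                 + quad sigma tau / (tau * (tau - 2 * zeta sigma)) * H s tau) /\
    (forall tau : C, D tau -> ~ exceptional sigma tau ->
       let P := power_near tau in
       let Q := power_near (tau - 2 * zeta sigma) in
       G (S s) tau =
         - (Q b (tau - 2 * zeta sigma) / P (b - c) tau)
         * C_derive
             (fun u : C => P (b - c) u / Q b (u - 2 * zeta sigma) * H s u) tau).

(* One step A_{s,n} -> A_{s+1,n}. The result is rational in tau; only its value
   at the exceptional points is not given by this formula. *)
Definition A_step (b c sigma : C) (f : C -> C) (tau : C) : C :=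
  let P := power_near tau in
  let Q := power_near (tau - 2 * zeta sigma) in
  Q (1 - b) (tau - 2 * zeta sigma) * P (b - c + 1) tau / quad sigma tau
  * C_derive (fun u : C => Q b (u - 2 * zeta sigma) / P (b - c) u * f u) tau.

(* [A_zero] is A_{s,0} and [A_one] is A_{s,1}. *)
Fixpoint A_zero (b c sigma : C) (s : nat) : C -> C :=
  match s with
  | O => fun tau : C => (tau - 2 * zeta sigma) / quad sigma tau
  | S s' => A_step b c sigma (A_zero b c sigma s')
  end.

Fixpoint A_one (b c sigma : C) (s : nat) : C -> C :=
  match s with
  | O => fun tau : C => 1 / quad sigma tau
  | S s' => A_step b c sigma (A_one b c sigma s')
  end.

(* Main.v *)
Require Import Defs.
From Stdlib Require Import Reals Lra Lia ClassicalEpsilon.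
From Coquelicot Require Import Coquelicot.
Open Scope C_scope.

(** Put [q = quad sigma], so that [q = (tau - tau_p) (tau - tau_m)], write [I] for
    integration along the contour divided by [2 pi i], and let
    [K_s = (G_s - a_{s,0} - a_{s,1} tau) / q].

    Index [0] of the rational functions is a residue computation.  The recursion says
    [H_s = tau (tau - 2 zeta) K_s], so [K_s] has no singularity at [tau_p], [tau_m] and
    Cauchy's theorem gives [I K_s = I ((tau - 2 zeta) K_s) = 0].  As [I (1 / q) = 0] and
    [I (tau / q) = 1], this amounts to [I (A_{0,n} G_s) = a_{s,n}] ([A_one_residue],
    [A_zero_residue]).

    The index is then moved from [G] to [A] by parts.  Let [A'] be the function that the
    recursion for the [A_{s,n}] makes of a rational function [A].  Both recursions are
    built on the same powers, in such a way that the derivative of [A H_s] is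
    [A' (G_s - a_{s,0} - a_{s,1} tau) - A G_{s+1}]; hence
    [I (A G_{s+1}) = I (A' G_s) - a_{s,0} I A' - a_{s,1} I (tau A')] ([step_transfer]).
    All poles of [A'] lie at [tau_p] and [tau_m], which the contour encircles equally
    often, so [I A'] and [I (tau A')] can be read off at infinity, where each step gains
    one order of vanishing: [A_{s,1} = O(tau^{-s-2})] and [A_{s,0} = O(tau^{-s-1})]
    ([decays], [is_step_decays], [decays_integral]).  The one integral that survives is
    [I (tau A_{1,0}) = c - 1], because [A_{1,0} = (c - 1) tau^{-2} + ...]; it produces the
    term [- (c - 1) A_{s-1,1}].

    The points [0] and [2 zeta] need care, since they may lie on the contour.  The
    derivative of [A H_s] is found there by continuity ([Cderiv_removable]), and the
    values of [A_{s,n}] at these points are harmless because a simple contour visits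
    each of them at most once ([contour_integral_ext_two_points]).

    Cauchy's theorem is needed for an arbitrary domain [D] whose complement lies in the
    exterior of the contour ([cauchy_theorem]).  Call a point outside if it is off the
    contour and the contour does not wind about it; the complement of [D] consists of
    such points.  In a fine grid of squares, those squares that contain a point which is
    not outside lie in [D].  By Cauchy's formula for rectangles, [2 pi i f(z)], for [z] on
    the contour, is the sum over these squares of the integrals of [f(w) / (w - z)] along
    their boundaries.  An edge between two such squares cancels, and every other edge
    consists of outside points [w], for which [f(w) / (w - z)] integrates to zero along
    the contour in [z]. *)

(** * Bisection of rectangles *)

Lemma nested_intervals (X A : nat -> R) :
  (forall n, (0 <= A n)%R) ->
  (forall n, (X n <= X (S n))%R) ->
  (forall n, (X (S n) + A (S n) <= X n + A n)%R) ->
  exists u : R, forall n, (X n <= u <= X n + A n)%R.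
Proof.
  intros HA Hl Hr.
  assert (Hl' : forall n k, (X n <= X (k + n)%nat)%R).
  { intros n k; induction k as [|k IH]; simpl; [lra|].
    specialize (Hl (k + n)%nat); lra. }
  assert (Hr' : forall n k, (X (k + n)%nat + A (k + n)%nat <= X n + A n)%R).
  { intros n k; induction k as [|k IH]; simpl; [lra|].
    specialize (Hr (k + n)%nat); lra. }
  assert (Hmn : forall m n, (X m <= X n + A n)%R).
  { intros m n. destruct (Nat.le_ge_cases m n) as [H|H].
    - replace n with ((n - m) + m)%nat by lia.
      specialize (Hl' m (n - m)%nat); specialize (HA (n - m + m)%nat); lra.
    - replace m with ((m - n) + n)%nat by lia.
      specialize (Hr' n (m - n)%nat); specialize (HA (m - n + n)%nat); lra. }
  destruct (completeness (fun r => exists n, r = X n)) as [u [Hub Hlub]].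
  - exists (X 0%nat + A 0%nat)%R. intros r [n ->]. apply Hmn.
  - exists (X 0%nat). exists 0%nat; reflexivity.
  - exists u. intros n; split.
    + apply Hub. exists n; reflexivity.
    + apply Hlub. intros r [m ->]. apply Hmn.
Qed.

Lemma halving_small (a eta : R) :
  (0 < eta)%R -> exists n0 : nat, forall n, (n0 <= n)%nat -> (a / 2 ^ n < eta)%R.
Proof.
  intros He.
  destruct (INR_unbounded (a / eta)) as [n0 Hn0].
  exists n0. intros n Hn.
  assert (H2 : (INR n < 2 ^ n)%R).
  { clear. induction n as [|n IH]; [simpl; lra|].
    rewrite S_INR. simpl. assert (1 <= 2 ^ n)%R by (apply pow_R1_Rle; lra). lra. }
  apply le_INR in Hn.
  assert (0 < 2 ^ n)%R by (apply pow_lt; lra).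
  apply Rmult_lt_reg_r with (2 ^ n)%R; [assumption|].
  unfold Rdiv. rewrite Rmult_assoc, Rinv_l, Rmult_1_r by lra.
  assert (a / eta < 2 ^ n)%R by lra.
  apply Rmult_lt_compat_r with (r := eta) in H0; [|assumption].
  unfold Rdiv in H0. rewrite Rmult_assoc, Rinv_l, Rmult_1_r in H0 by lra. lra.
Qed.

(** If [P] fails for a rectangle, it fails for one of its quarters, and so on: the
    nested rectangles shrink to a point near which [P] holds.  This replaces every
    compactness argument below.  The rectangle of the statement is
    [x, x + a] x [y, y + b]. *)
Theorem bisection_principle (P : R -> R -> R -> R -> Prop) (x a y b : R) :
  (0 <= a)%R -> (0 <= b)%R ->
  (forall x a y b, (0 <= a)%R -> (0 <= b)%R ->
     P x (a / 2)%R y (b / 2)%R -> P (x + a / 2)%R (a / 2)%R y (b / 2)%R ->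
     P x (a / 2)%R (y + b / 2)%R (b / 2)%R ->
     P (x + a / 2)%R (a / 2)%R (y + b / 2)%R (b / 2)%R -> P x a y b) ->
  (forall u v, (x <= u <= x + a)%R -> (y <= v <= y + b)%R ->
     exists eta, (0 < eta)%R /\ forall x' a' y' b',
       (x' <= u <= x' + a')%R -> (y' <= v <= y' + b')%R ->
       (a' < eta)%R -> (b' < eta)%R -> P x' a' y' b') ->
  P x a y b.
Proof.
  intros Ha Hb Hglue Hloc.
  apply NNPP. intros HnP.
  pose (an n := (a / 2 ^ n)%R). pose (bn n := (b / 2 ^ n)%R).
  assert (Han : forall n, (0 <= an n)%R /\ an (S n) = (an n / 2)%R).
  { intros n. unfold an. assert (0 < 2 ^ n)%R by (apply pow_lt; lra).
    split; [apply Rmult_le_pos; [lra|left; apply Rinv_0_lt_compat; lra]|].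
    simpl. field. lra. }
  assert (Hbn : forall n, (0 <= bn n)%R /\ bn (S n) = (bn n / 2)%R).
  { intros n. unfold bn. assert (0 < 2 ^ n)%R by (apply pow_lt; lra).
    split; [apply Rmult_le_pos; [lra|left; apply Rinv_0_lt_compat; lra]|].
    simpl. field. lra. }
  pose (dec := fun Q : Prop => excluded_middle_informative Q).
  pose (step n (s : R * R) := let (X, Y) := s in
    let h := (an n / 2)%R in let k := (bn n / 2)%R in
    if dec (~ P X h Y k) then (X, Y)
    else if dec (~ P (X + h)%R h Y k) then ((X + h)%R, Y)
    else if dec (~ P X h (Y + k)%R k) then (X, (Y + k)%R)
    else ((X + h)%R, (Y + k)%R)).
  pose (sq := fix sq n := match n with O => (x, y) | S n => step n (sq n) end).
  assert (Hbad : forall n, ~ P (fst (sq n)) (an n) (snd (sq n)) (bn n)).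
  { induction n as [|n IH].
    - simpl. unfold an, bn; simpl. rewrite !Rdiv_1_r. exact HnP.
    - simpl. destruct (sq n) as [X Y]; simpl in IH |- *.
      destruct (Han n) as [A1 ->]. destruct (Hbn n) as [B1 ->].
      unfold step.
      destruct (dec (~ P X (an n / 2)%R Y (bn n / 2)%R)) as [H1|H1]; [exact H1|].
      destruct (dec (~ P (X + an n / 2)%R (an n / 2)%R Y (bn n / 2)%R)) as [H2|H2];
        [exact H2|].
      destruct (dec (~ P X (an n / 2)%R (Y + bn n / 2)%R (bn n / 2)%R)) as [H3|H3];
        [exact H3|].
      simpl. intros H4. apply IH. apply Hglue; first [assumption|apply NNPP; assumption]. }
  assert (Hstep : forall n,
    (fst (sq n) <= fst (sq (S n)) <= fst (sq n) + an n / 2)%R /\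
    (snd (sq n) <= snd (sq (S n)) <= snd (sq n) + bn n / 2)%R).
  { intros n. simpl. destruct (sq n) as [X Y]. unfold step.
    destruct (Han n) as [A1 _]. destruct (Hbn n) as [B1 _].
    destruct dec; [simpl; lra|]. destruct dec; [simpl; lra|].
    destruct dec; simpl; lra. }
  destruct (nested_intervals (fun n => fst (sq n)) an) as [u Hu];
    [intros n; apply Han|intros n; apply Hstep|
     intros n; destruct (Han n) as [A1 ->]; destruct (Hstep n); lra|].
  destruct (nested_intervals (fun n => snd (sq n)) bn) as [v Hv];
    [intros n; apply Hbn|intros n; apply Hstep|
     intros n; destruct (Hbn n) as [A1 ->]; destruct (Hstep n); lra|].
  destruct (Hloc u v) as [eta [He Hl]].
  - specialize (Hu 0%nat). unfold an in Hu; simpl in Hu. lra.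
  - specialize (Hv 0%nat). unfold bn in Hv; simpl in Hv. lra.
  - destruct (halving_small a eta He) as [n1 Hn1].
    destruct (halving_small b eta He) as [n2 Hn2].
    apply (Hbad (n1 + n2)%nat).
    apply Hl; [apply Hu|apply Hv|apply Hn1; lia|apply Hn2; lia].
Qed.

Corollary bisection_principle_1d (P : R -> R -> Prop) (x a : R) :
  (0 <= a)%R ->
  (forall x a, (0 <= a)%R -> P x (a / 2)%R -> P (x + a / 2)%R (a / 2)%R -> P x a) ->
  (forall u, (x <= u <= x + a)%R ->
     exists eta, (0 < eta)%R /\ forall x' a',
       (x' <= u <= x' + a')%R -> (a' < eta)%R -> P x' a') ->
  P x a.
Proof.
  intros Ha Hglue Hloc.
  apply (bisection_principle (fun x a _ _ => P x a) x a 0 0);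
    [assumption|lra|intros; apply Hglue; assumption|].
  intros u v Hu _. destruct (Hloc u Hu) as [eta [He Hl]].
  exists eta; split; auto.
Qed.

(** * Complex calculus *)

Local Notation Cderiv := (@is_derive C_AbsRing C_NormedModule).
Local Notation RCderiv := (@is_derive R_AbsRing C_R_NormedModule).
Local Notation Ccontinuous := (@continuous C_UniformSpace C_UniformSpace).
Local Notation RCcontinuous := (@continuous R_UniformSpace C_UniformSpace).
Local Notation is_RCInt := (@is_RInt C_R_NormedModule).

Lemma Cderiv_eps (f : C -> C) (w l : C) :
  Cderiv f w l <->
  forall eps, (0 < eps)%R -> exists del, (0 < del)%R /\ forall z,
    (Cmod (z - w) < del)%R ->
    (Cmod (f z - f w - (z - w) * l) <= eps * Cmod (z - w))%R.
Proof.
  split.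
  - intros [_ H] eps He.
    destruct (H w (fun P HP => HP) (mkposreal eps He)) as [del Hd].
    exists del; split; [apply cond_pos|]. intros z Hz. exact (Hd z Hz).
  - intros H. split; [apply is_linear_scal_l|].
    intros x Hx.
    assert (E : w = x) by exact (@is_filter_lim_locally_unique C_AbsRing (AbsRing_NormedModule C_AbsRing) w x Hx).
    subst x.
    intros [eps He].
    destruct (H eps He) as [del [Hd H']].
    exists (mkposreal del Hd). intros z Hz. exact (H' z Hz).
Qed.

Lemma RCscal (x : R) (z : C) : @scal R_AbsRing C_R_NormedModule x z = RtoC x * z.
Proof.
  destruct z. unfold scal, Cmult, RtoC; simpl. unfold prod_scal, scal, mult; simpl.
  unfold mult; simpl. f_equal; ring.
Qed.

Lemma RCderiv_eps (g : R -> C) (x : R) (l : C) :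
  RCderiv g x l <->
  forall eps, (0 < eps)%R -> exists del, (0 < del)%R /\ forall y,
    (Rabs (y - x) < del)%R ->
    (Cmod (g y - g x - RtoC (y - x) * l) <= eps * Rabs (y - x))%R.
Proof.
  split.
  - intros [_ H] eps He.
    destruct (H x (fun P HP => HP) (mkposreal eps He)) as [del Hd].
    exists del; split; [apply cond_pos|]. intros y Hy. rewrite <- RCscal, Cmod_norm. exact (Hd y Hy).
  - intros H. split; [apply is_linear_scal_l|].
    intros x' Hx.
    assert (E' : x = x') by exact (@is_filter_lim_locally_unique R_AbsRing (AbsRing_NormedModule R_AbsRing) x x' Hx).
    subst x'.
    intros [eps He].
    destruct (H eps He) as [del [Hd H']].
    exists (mkposreal del Hd). intros y Hy. specialize (H' y Hy). rewrite <- RCscal, Cmod_norm in H'. exact H'.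
Qed.

Lemma Cball_of_Cmod (w z : C) (e : R) :
  (Cmod (z - w) < e)%R -> @ball C_UniformSpace w e z.
Proof. exact (C_NormedModule_mixin_compat1 w z e). Qed.

Lemma Cmod_of_Cball (w z : C) (e : R) :
  (0 < e)%R -> @ball C_UniformSpace w (e / 2)%R z -> (Cmod (z - w) < e)%R.
Proof.
  intros He H.
  assert (He' : (0 < e / 2)%R) by lra.
  pose proof (C_NormedModule_mixin_compat2 w z (mkposreal _ He') H) as H1.
  simpl in H1. change (minus z w) with (z - w) in H1.
  assert (sqrt 2 <= 2)%R.
  { rewrite <- (sqrt_square 2) at 2 by lra. apply sqrt_le_1_alt; lra. }
  apply Rlt_le_trans with (1 := H1). nra.
Qed.

Lemma Clocally_eps (w : C) (P : C -> Prop) :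
  @locally C_UniformSpace w P <->
  exists del, (0 < del)%R /\ forall z, (Cmod (z - w) < del)%R -> P z.
Proof.
  split.
  - intros [del Hd]. exists del; split; [apply cond_pos|].
    intros z Hz. apply Hd. apply Cball_of_Cmod; assumption.
  - intros [del [Hd H]].
    assert (Hd' : (0 < del / 2)%R) by lra.
    exists (mkposreal _ Hd'). intros z Hz. apply H. apply Cmod_of_Cball; assumption.
Qed.

Lemma Ccontinuous_eps (f : C -> C) (w : C) :
  Ccontinuous f w <->
  forall eps, (0 < eps)%R -> exists del, (0 < del)%R /\ forall z,
    (Cmod (z - w) < del)%R -> (Cmod (f z - f w) < eps)%R.
Proof.
  split.
  - intros H eps He.
    apply (Clocally_eps w). apply (H (fun z => (Cmod (z - f w) < eps)%R)).
    apply Clocally_eps. exists eps; split; auto.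
  - intros H P HP. apply Clocally_eps in HP. destruct HP as [e [He HP]].
    destruct (H e He) as [d [Hd H']].
    apply Clocally_eps. exists d; split; auto.
Qed.

Lemma RCcontinuous_eps (g : R -> C) (x : R) :
  RCcontinuous g x <->
  forall eps, (0 < eps)%R -> exists del, (0 < del)%R /\ forall y,
    (Rabs (y - x) < del)%R -> (Cmod (g y - g x) < eps)%R.
Proof.
  split.
  - intros H eps He.
    assert (H1 : locally x (fun y => (Cmod (g y - g x) < eps)%R)).
    { apply (H (fun z => (Cmod (z - g x) < eps)%R)).
      apply Clocally_eps. exists eps; split; auto. }
    destruct H1 as [d Hd]. exists d; split; [apply cond_pos|]. exact Hd.
  - intros H P HP. apply Clocally_eps in HP. destruct HP as [e [He HP]].
    destruct (H e He) as [d [Hd H']].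
    exists (mkposreal d Hd). intros y Hy. apply HP, H', Hy.
Qed.

Lemma Cderiv_ext_loc (f g : C -> C) (w l : C) (del : R) :
  (0 < del)%R -> (forall z, (Cmod (z - w) < del)%R -> f z = g z) ->
  Cderiv f w l -> Cderiv g w l.
Proof.
  intros Hd H. apply is_derive_ext_loc. exists (mkposreal del Hd). exact H.
Qed.

Lemma Cderiv_plus (f g : C -> C) (w l m : C) :
  Cderiv f w l -> Cderiv g w m -> Cderiv (fun z => f z + g z) w (l + m).
Proof. exact (is_derive_plus f g w l m). Qed.

Lemma Cderiv_minus (f g : C -> C) (w l m : C) :
  Cderiv f w l -> Cderiv g w m -> Cderiv (fun z => f z - g z) w (l - m).
Proof. exact (is_derive_minus f g w l m). Qed.

(** The complex numbers carry two normed module structures over themselves, which differ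
    in their balls; derivatives do not see the difference. *)
Lemma Cderiv_absring (f : C -> C) (w l : C) :
  @is_derive C_AbsRing (AbsRing_NormedModule C_AbsRing) f w l <-> Cderiv f w l.
Proof.
  split; intros [_ H]; (split; [apply is_linear_scal_l|exact H]).
Qed.

Lemma Cderiv_const (c w : C) : Cderiv (fun _ => c) w (RtoC 0).
Proof. exact (is_derive_const c w). Qed.

Lemma Cderiv_id (w : C) : Cderiv (fun z => z) w (RtoC 1).
Proof. apply Cderiv_absring. exact (is_derive_id w). Qed.

Lemma Cderiv_mult (f g : C -> C) (w l m : C) :
  Cderiv f w l -> Cderiv g w m ->
  Cderiv (fun z => f z * g z) w (l * g w + f w * m).
Proof.
  intros Hf Hg. apply Cderiv_absring in Hf. apply Cderiv_absring in Hg.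
  apply Cderiv_absring. exact (is_derive_mult f g w l m Hf Hg Cmult_comm).
Qed.

Lemma Cderiv_scal (k : C) (f : C -> C) (w l : C) :
  Cderiv f w l -> Cderiv (fun z => k * f z) w (k * l).
Proof.
  intros Hf. assert (H := Cderiv_mult (fun _ => k) f w _ _ (Cderiv_const k w) Hf).
  cbv beta in H. replace (0 * f w + k * l) with (k * l) in H by ring. exact H.
Qed.

Lemma Cderiv_comp (f g : C -> C) (w l m : C) :
  Cderiv f (g w) l -> Cderiv g w m -> Cderiv (fun z => f (g z)) w (m * l).
Proof.
  intros Hf Hg. apply Cderiv_absring in Hg. exact (is_derive_comp f g w l m Hf Hg).
Qed.

Lemma Cderiv_continuous (f : C -> C) (w l : C) : Cderiv f w l -> Ccontinuous f w.
Proof.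
  intros H. apply Ccontinuous_eps. intros eps He.
  destruct (proj1 (Cderiv_eps f w l) H 1%R Rlt_0_1) as [d [Hd Hd']].
  set (M := (1 + Cmod l)%R).
  assert (HM : (0 < M)%R) by (unfold M; pose proof (Cmod_ge_0 l); lra).
  exists (Rmin d (eps / M)). split.
  - apply Rmin_pos; [assumption|]. apply Rdiv_lt_0_compat; assumption.
  - intros z Hz.
    destruct (Rmin_Rgt_l _ _ _ Hz) as [H1 H2].
    specialize (Hd' z H1).
    replace (f z - f w) with ((f z - f w - (z - w) * l) + (z - w) * l) by ring.
    apply Rle_lt_trans with (1 := Cmod_triangle _ _).
    rewrite Cmod_mult.
    apply Rle_lt_trans with (M * Cmod (z - w))%R; [unfold M; lra|].
    apply Rmult_lt_compat_l with (r := M) in H2; [|assumption].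
    replace (M * (eps / M))%R with eps in H2 by (field; lra). assumption.
Qed.

Lemma ex_Cderiv_continuous (f : C -> C) (w : C) :
  @ex_derive C_AbsRing C_NormedModule f w -> Ccontinuous f w.
Proof. intros [l Hl]. exact (Cderiv_continuous f w l Hl). Qed.

Lemma Cderiv_inv (w : C) : w <> 0 -> Cderiv (fun z => / z) w (- / (w * w)).
Proof.
  intros Hw. apply Cderiv_eps. intros eps He.
  pose proof (proj1 (Cmod_gt_0 w) Hw) as Hm.
  set (m := Cmod w) in *.
  exists (Rmin (m / 2) (eps * m * m * m / 2))%R. split.
  - apply Rmin_pos; [lra|]. repeat apply Rmult_lt_0_compat; try assumption. lra.
  - intros z Hz.
    destruct (Rmin_Rgt_l _ _ _ Hz) as [H1 H2].
    assert (H3 : (m / 2 <= Cmod z)%R).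
    { assert (Ht := Cmod_triangle (- (z - w)) z). rewrite Cmod_opp in Ht.
      replace (- (z - w) + z) with w in Ht by ring. fold m in Ht. lra. }
    assert (Hz0 : z <> 0).
    { intros ->. rewrite Cmod_0 in H3. lra. }
    replace (/ z - / w - (z - w) * - / (w * w)) with ((z - w) * (z - w) / (z * w * w))
      by (field; split; assumption).
    rewrite Cmod_div by (repeat apply Cmult_neq_0; assumption).
    rewrite !Cmod_mult. fold m.
    set (q := Cmod (z - w)) in *. assert (Hq : (0 <= q)%R) by apply Cmod_ge_0.
    apply Rmult_le_reg_r with (Cmod z * m * m)%R.
    { repeat apply Rmult_lt_0_compat; try assumption. lra. }
    replace (q * q / (Cmod z * m * m) * (Cmod z * m * m))%R with (q * q)%R
      by (field; repeat split; lra).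
    assert (H5 : (0 <= eps * m * m)%R) by (repeat apply Rmult_le_pos; lra).
    assert (q <= eps * (Cmod z * m * m))%R; [|nra].
    replace (eps * (Cmod z * m * m))%R with (eps * m * m * Cmod z)%R by ring.
    apply Rle_trans with (eps * m * m * (m / 2))%R; [lra|].
    apply Rmult_le_compat_l; assumption.
Qed.

Lemma Ccontinuous_plus (f g : C -> C) (w : C) :
  Ccontinuous f w -> Ccontinuous g w -> Ccontinuous (fun z => f z + g z) w.
Proof. exact (@continuous_plus C_UniformSpace C_AbsRing C_NormedModule f g w). Qed.

Lemma Ccontinuous_const (c w : C) : Ccontinuous (fun _ => c) w.
Proof. apply continuous_const. Qed.

Lemma Ccontinuous_id (w : C) : Ccontinuous (fun z => z) w.
Proof. apply continuous_id. Qed.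

Lemma continuous_Cmult {T : UniformSpace} (f g : T -> C) x :
  continuous f x -> continuous g x -> continuous (fun z => f z * g z) x.
Proof.
  intros Hf Hg P HP.
  refine (@continuous_mult T C_AbsRing f g x _ _ P (proj1 (locally_C _ P) HP));
    intros Q HQ; [apply Hf|apply Hg]; apply locally_C; exact HQ.
Qed.

Lemma RCcontinuous_mult (f g : R -> C) x :
  RCcontinuous f x -> RCcontinuous g x -> RCcontinuous (fun z => f z * g z) x.
Proof. apply continuous_Cmult. Qed.

Lemma Ccontinuous_mult (f g : C -> C) x :
  Ccontinuous f x -> Ccontinuous g x -> Ccontinuous (fun z => f z * g z) x.
Proof. apply continuous_Cmult. Qed.

Lemma Ccontinuous_opp (f : C -> C) (w : C) :
  Ccontinuous f w -> Ccontinuous (fun z => - f z) w.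
Proof. exact (@continuous_opp C_UniformSpace C_AbsRing C_NormedModule f w). Qed.

Lemma Ccontinuous_minus (f g : C -> C) (w : C) :
  Ccontinuous f w -> Ccontinuous g w -> Ccontinuous (fun z => f z - g z) w.
Proof. intros; apply Ccontinuous_plus; [|apply Ccontinuous_opp]; assumption. Qed.

Lemma Ccontinuous_comp (f g : C -> C) (w : C) :
  Ccontinuous g w -> Ccontinuous f (g w) -> Ccontinuous (fun z => f (g z)) w.
Proof. apply continuous_comp. Qed.

Lemma RCcontinuous_comp (g : R -> C) f x :
  RCcontinuous g x -> Ccontinuous f (g x) -> RCcontinuous (fun z => f (g z)) x.
Proof. apply continuous_comp. Qed.

Lemma Ccontinuous_inv (f : C -> C) (w : C) :
  Ccontinuous f w -> f w <> 0 -> Ccontinuous (fun z => / f z) w.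
Proof.
  intros Hf H0. apply (Ccontinuous_comp Cinv f); [assumption|].
  exact (Cderiv_continuous _ _ _ (Cderiv_inv (f w) H0)).
Qed.

Lemma Ccontinuous_div (f g : C -> C) (w : C) :
  Ccontinuous f w -> Ccontinuous g w -> g w <> 0 -> Ccontinuous (fun z => f z / g z) w.
Proof. intros. apply Ccontinuous_mult; [|apply Ccontinuous_inv]; assumption. Qed.

(** A complex derivative is a real differential, so composition with a path is an
    instance of the chain rule for differentials. *)
Lemma Cderiv_filterdiff (F : C -> C) (w l : C) : Cderiv F w l ->
  @filterdiff R_AbsRing C_R_NormedModule C_R_NormedModule F (locally w) (fun y => y * l).
Proof.
  intros HF. split.
  - split.
    + intros x y. exact (Cmult_plus_distr_r x y l).
    + intros k x. rewrite !RCscal. symmetry. apply Cmult_assoc.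
    + exists (Cmod l + 1)%R. split; [assert (A := Cmod_ge_0 l); lra|].
      intros x. rewrite <- !Cmod_norm, Cmod_mult. assert (A := Cmod_ge_0 x). nra.
  - intros x Hx.
    assert (E : w = x) by exact (@is_filter_lim_locally_unique R_AbsRing C_R_NormedModule w x Hx).
    subst x. intros eps.
    destruct (proj1 (Cderiv_eps F w l) HF eps (cond_pos eps)) as [d [Hd H]].
    apply Clocally_eps. exists d. split; [assumption|]. intros z Hz.
    rewrite <- !Cmod_norm. exact (H z Hz).
Qed.

Lemma RCderiv_comp (F : C -> C) (g : R -> C) (x : R) (l d : C) :
  Cderiv F (g x) l -> RCderiv g x d -> RCderiv (fun y => F (g y)) x (l * d).
Proof.
  intros HF Hg.
  refine (filterdiff_ext_lin _ _ _ (filterdiff_comp' g F x _ _ Hg (Cderiv_filterdiff F _ l HF)) _).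
  intros y. rewrite !RCscal. rewrite <- Cmult_assoc, (Cmult_comm d l). reflexivity.
Qed.

(** Composition with [clamp a b] extends a function from [a, b] to the line, which
    disposes of one-sided limits at the endpoints. *)
Definition clamp (a b x : R) : R := Rmax a (Rmin x b).

Lemma clamp_in a b x : (a <= b)%R -> (a <= clamp a b x <= b)%R.
Proof. intros H. unfold clamp, Rmax, Rmin. repeat destruct Rle_dec; lra. Qed.

Lemma clamp_id a b x : (a <= x <= b)%R -> clamp a b x = x.
Proof. intros H. unfold clamp, Rmax, Rmin. repeat destruct Rle_dec; lra. Qed.

Lemma clamp_lipschitz a b x y : (Rabs (clamp a b y - clamp a b x) <= Rabs (y - x))%R.
Proof.
  unfold clamp, Rmax, Rmin, Rabs.
  repeat destruct Rle_dec; repeat destruct Rcase_abs; lra.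
Qed.

Lemma continuous_on_clamp (g : R -> C) a b x : (a <= b)%R ->
  continuous_on (fun x => (a <= x <= b)%R) g ->
  RCcontinuous (fun y => g (clamp a b y)) x.
Proof.
  intros Hab H.
  apply RCcontinuous_eps. intros eps He.
  assert (H1 := H (clamp a b x) (clamp_in a b x Hab)
                 (fun z => (Cmod (z - g (clamp a b x)) < eps)%R)).
  destruct H1 as [d Hd].
  - apply Clocally_eps. exists eps; auto.
  - exists d; split; [apply cond_pos|].
    intros y Hy. apply Hd.
    + apply Rle_lt_trans with (1 := clamp_lipschitz a b x y). exact Hy.
    + apply clamp_in; assumption.
Qed.

Lemma RCderiv_continuous (g : R -> C) x l : RCderiv g x l -> RCcontinuous g x.
Proof.
  intros H.
  apply (@ex_derive_continuous R_AbsRing C_R_NormedModule g x).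
  exists l. exact H.
Qed.

Lemma RCderiv_Re (g : R -> C) x l : RCderiv g x l -> is_derive (fun y => Re (g y)) x (Re l).
Proof.
  intros H. 
  exact (filterdiff_comp' g (@fst R R) x (fun y => scal y l) fst H
    (filterdiff_linear _ is_linear_fst)).
Qed.

Lemma RCderiv_Im (g : R -> C) x l : RCderiv g x l -> is_derive (fun y => Im (g y)) x (Im l).
Proof.
  intros H. 
  exact (filterdiff_comp' g (@snd R R) x (fun y => scal y l) snd H
    (filterdiff_linear _ is_linear_snd)).
Qed.

Lemma velocity_unique (g : R -> C) x l : RCderiv g x l -> velocity g x = l.
Proof.
  intros H. unfold velocity.
  rewrite (surjective_pairing l). f_equal; apply is_derive_unique.
  - exact (RCderiv_Re g x l H).
  - exact (RCderiv_Im g x l H).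
Qed.

Lemma RCcontinuous_Re (g : R -> C) x : RCcontinuous g x -> continuity_pt (fun y => Re (g y)) x.
Proof.
  intros H. apply continuity_pt_filterlim.
  apply (continuous_comp g (@fst R R)); [exact H|]. apply continuous_fst.
Qed.

Lemma RCcontinuous_Im (g : R -> C) x : RCcontinuous g x -> continuity_pt (fun y => Im (g y)) x.
Proof.
  intros H. apply continuity_pt_filterlim.
  apply (continuous_comp g (@snd R R)); [exact H|]. apply continuous_snd.
Qed.

Lemma im_le_Cmod z : (Rabs (Im z) <= Cmod z)%R.
Proof. apply Rle_trans with (2 := Rmax_Cmod z). apply Rmax_r. Qed.

Lemma Cmod_le_abs_sum z : (Cmod z <= Rabs (Re z) + Rabs (Im z))%R.
Proof.
  destruct z as [x y]. simpl.
  replace (x, y) with (RtoC x + Ci * RtoC y)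
    by (unfold RtoC, Ci, Cplus, Cmult; simpl; f_equal; ring).
  apply Rle_trans with (1 := Cmod_triangle _ _).
  rewrite Cmod_mult, Cmod_Ci, !Cmod_R. lra.
Qed.

(** Applying the mean value theorem to both coordinates costs the factor [2]. *)
Lemma mean_value_ineq (g dg : R -> C) (a b M : R) :
  (a <= b)%R ->
  (forall x, (a <= x <= b)%R -> RCcontinuous g x) ->
  (forall x, (a < x < b)%R -> RCderiv g x (dg x) /\ (Cmod (dg x) <= M)%R) ->
  (Cmod (g b - g a) <= 2 * M * (b - a))%R.
Proof.
  intros Hab Hc Hd.
  destruct (Rle_lt_or_eq_dec a b Hab) as [Hlt|<-].
  2:{ replace (g a - g a) with (RtoC 0) by ring. rewrite Cmod_0. right; ring. }
  assert (HM : (0 <= M)%R).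
  { destruct (Hd ((a + b) / 2)%R) as [_ H]; [lra|].
    apply Rle_trans with (2 := H). apply Cmod_ge_0. }
  assert (Haux : forall (p : C -> R),
     (forall x l, RCderiv g x l -> is_derive (fun y => p (g y)) x (p l)) ->
     (forall x, RCcontinuous g x -> continuity_pt (fun y => p (g y)) x) ->
     (forall z, (Rabs (p z) <= Cmod z)%R) ->
     (Rabs (p (g b) - p (g a)) <= M * (b - a))%R).
  { intros p Hp1 Hp2 Hp3.
    (* the intermediate point may be an endpoint, where [dg] means nothing *)
    destruct (MVT_gen (fun y => p (g y)) a b
      (fun x => if excluded_middle_informative (a < x < b)%R then p (dg x) else 0%R))
      as [c [Hc1 Hc2]].
    - rewrite Rmin_left, Rmax_right by lra. intros x Hx.
      destruct excluded_middle_informative; [|tauto]. apply Hp1, Hd, Hx.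
    - rewrite Rmin_left, Rmax_right by lra. intros x Hx. apply Hp2, Hc, Hx.
    - rewrite Hc2, Rabs_mult, (Rabs_pos_eq (b - a)) by lra.
      apply Rmult_le_compat_r; [lra|].
      destruct excluded_middle_informative as [Hx|Hx].
      + apply Rle_trans with (1 := Hp3 _). apply Hd, Hx.
      + rewrite Rabs_R0; assumption. }
  assert (H1 := Haux Re (RCderiv_Re g) (RCcontinuous_Re g) re_le_Cmod).
  assert (H2 := Haux Im (RCderiv_Im g) (RCcontinuous_Im g) im_le_Cmod).
  apply Rle_trans with (1 := Cmod_le_abs_sum _). 
  change (Rabs (Re (g b) - Re (g a)) + Rabs (Im (g b) - Im (g a)) <= 2 * M * (b - a))%R.
  lra.
Qed.

(** * Contour integrals *)

Local Notation RCInt := (@RInt C_R_CompleteNormedModule).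
Local Notation ex_RCInt := (@ex_RInt C_R_NormedModule).

Lemma continuous_on_subset (g : R -> C) a b c d :
  (a <= c)%R -> (d <= b)%R ->
  continuous_on (fun x => (a <= x <= b)%R) g -> continuous_on (fun x => (c <= x <= d)%R) g.
Proof.
  intros H1 H2 H x Hx P HP.
  destruct (H x ltac:(lra) P HP) as [e He]. exists e. intros y Hy Hy'.
  apply He; [exact Hy|lra].
Qed.

Lemma ex_RCInt_continuous (g : R -> C) a b :
  (forall x, RCcontinuous g x) -> ex_RCInt g a b.
Proof.
  intros H. apply (@ex_RInt_continuous C_R_CompleteNormedModule g a b).
  intros x _. exact (H x).
Qed.

Lemma is_RCInt_unique (g : R -> C) a b l : is_RCInt g a b l -> RCInt g a b = l.
Proof. apply (@is_RInt_unique C_R_CompleteNormedModule). Qed.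

Lemma RCInt_correct (g : R -> C) a b : ex_RCInt g a b -> is_RCInt g a b (RCInt g a b).
Proof. apply (@RInt_correct C_R_CompleteNormedModule). Qed.

Lemma is_RCInt_plus (f g : R -> C) a b (l m : C) :
  is_RCInt f a b l -> is_RCInt g a b m -> is_RCInt (fun x => f x + g x) a b (l + m).
Proof. exact (@is_RInt_plus C_R_NormedModule f g a b l m). Qed.

Lemma is_RCInt_Chasles (f : R -> C) a b c (l m : C) :
  is_RCInt f a b l -> is_RCInt f b c m -> is_RCInt f a c (l + m).
Proof. exact (@is_RInt_Chasles C_R_NormedModule f a b c l m). Qed.

Lemma is_RCInt_ext (f g : R -> C) a b (l : C) : (a <= b)%R ->
  (forall x, (a < x < b)%R -> f x = g x) -> is_RCInt f a b l -> is_RCInt g a b l.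
Proof.
  intros Hab H. apply is_RInt_ext. rewrite Rmin_left, Rmax_right by lra. exact H.
Qed.

Lemma is_RCInt_scal (k : C) (f : R -> C) a b (l : C) :
  is_RCInt f a b l -> is_RCInt (fun x => k * f x) a b (k * l).
Proof.
  intros H.
  pose proof (is_RInt_fct_extend_fst (U := R_NormedModule) (V := R_NormedModule) f a b l H) as H1.
  pose proof (is_RInt_fct_extend_snd (U := R_NormedModule) (V := R_NormedModule) f a b l H) as H2.
  apply (is_RInt_fct_extend_pair (U := R_NormedModule) (V := R_NormedModule)).
  - exact (is_RInt_minus _ _ _ _ _ _ (is_RInt_scal _ a b (fst k) _ H1)
                                     (is_RInt_scal _ a b (snd k) _ H2)).
  - exact (is_RInt_plus _ _ _ _ _ _ (is_RInt_scal _ a b (fst k) _ H2)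
                                     (is_RInt_scal _ a b (snd k) _ H1)).
Qed.

Lemma is_RCInt_bound (f : R -> C) a b (l : C) M : (a <= b)%R ->
  (forall x, (a <= x <= b)%R -> (Cmod (f x) <= M)%R) ->
  is_RCInt f a b l -> (Cmod l <= (b - a) * M)%R.
Proof.
  intros Hab HM H. rewrite Cmod_norm.
  refine (norm_RInt_le_const f a b l M Hab _ H).
  intros x Hx. rewrite <- Cmod_norm. apply HM, Hx.
Qed.

(** On a piece of a piecewise smooth contour the derivative is known only inside the
    parameter interval.  There [F] and the indefinite integral of [f] have the same
    derivative, and both are continuous up to the endpoints. *)
Lemma RC_FTC (F f : R -> C) a b : (a <= b)%R ->
  continuous_on (fun x => (a <= x <= b)%R) F ->
  continuous_on (fun x => (a <= x <= b)%R) f ->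
  (forall x, (a < x < b)%R -> RCderiv F x (f x)) ->
  is_RCInt f a b (F b - F a).
Proof.
  intros Hab HF Hf Hd.
  set (f1 := fun x => f (clamp a b x)).
  assert (Hf1 : forall x, RCcontinuous f1 x).
  { intros x. apply continuous_on_clamp; assumption. }
  assert (Hex : forall x, is_RCInt f1 a x (RCInt f1 a x)).
  { intros x. apply RCInt_correct, ex_RCInt_continuous, Hf1. }
  assert (HI : forall x, RCderiv (fun x => RCInt f1 a x) x (f1 x)).
  { intros x. apply (@is_derive_RInt C_R_NormedModule f1 (fun x => RCInt f1 a x) a x).
    - apply filter_forall. exact Hex.
    - apply Hf1. }
  set (D := fun x => F (clamp a b x) - RCInt f1 a x).
  assert (Hmv : (Cmod (D b - D a) <= 2 * 0 * (b - a))%R).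
  { apply mean_value_ineq with (dg := fun _ => RtoC 0); [assumption| |].
    - intros x _. apply (@continuous_minus R_UniformSpace R_AbsRing C_R_NormedModule
        (fun x => F (clamp a b x)) (fun x => RCInt f1 a x)).
      + apply continuous_on_clamp; assumption.
      + exact (RCderiv_continuous _ _ _ (HI x)).
    - intros x Hx. split; [|rewrite Cmod_0; lra].
      replace (RtoC 0) with (f x - f1 x)
        by (unfold f1; rewrite clamp_id by lra; ring).
      apply (@is_derive_minus R_AbsRing C_R_NormedModule); [|apply HI].
      apply is_derive_ext_loc with (f := F); [|apply Hd, Hx].
      assert (He : (0 < Rmin (x - a) (b - x))%R) by (apply Rmin_pos; lra).
      exists (mkposreal _ He). intros y Hy.
      destruct (Rmin_Rgt_l _ _ _ Hy) as [Hy1 Hy2].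
      unfold minus, plus, opp in Hy1, Hy2; simpl in Hy1, Hy2.
      apply Rabs_lt_between in Hy1. apply Rabs_lt_between in Hy2.
      rewrite clamp_id by (unfold minus, plus, opp in *; simpl in *; lra). reflexivity. }
  assert (HD : D b = D a).
  { assert (Hz : D b - D a = 0).
    { apply Cmod_eq_0. apply Rle_antisym; [|apply Cmod_ge_0]. lra. }
    replace (D b) with (D b - D a + D a) by ring. rewrite Hz. ring. }
  unfold D in HD. rewrite !clamp_id in HD by lra.
  assert (H0 : RCInt f1 a a = RtoC 0).
  { apply (@RInt_point C_R_CompleteNormedModule). }
  rewrite H0 in HD.
  assert (Hsolve : forall u v I : C, u - I = v - 0 -> u - v = I).
  { intros u v I E. replace I with (u - (u - I)) by ring. rewrite E. ring. }
  rewrite (Hsolve _ _ _ HD).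
  apply is_RCInt_ext with (f := f1); [assumption| |apply Hex].
  intros x Hx. unfold f1. rewrite clamp_id by lra. reflexivity.
Qed.

Lemma path_locally_bounded (g : R -> C) (phi : C -> R) a b : (a <= b)%R ->
  continuous_on (fun x => (a <= x <= b)%R) g ->
  (forall s, (a <= s <= b)%R -> exists d M, (0 < d)%R /\
     forall z, (Cmod (z - g s) < d)%R -> (phi z <= M)%R) ->
  exists M, (0 < M)%R /\ forall s, (a <= s <= b)%R -> (phi (g s) <= M)%R.
Proof.
  intros Hab Hg H.
  destruct (bisection_principle_1d (fun x h => exists M, (0 < M)%R /\ forall s,
      (a <= s <= b)%R -> (x <= s <= x + h)%R -> (phi (g s) <= M)%R) a (b - a)) as [M [HM0 HM]].
  - lra.
  - intros x h Hh [B1 [HB1 H1]] [B2 [HB2 H2]].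
    exists (Rmax B1 B2). split; [apply Rlt_le_trans with (2 := Rmax_l _ _); assumption|].
    intros y Hy Hy'. destruct (Rle_dec y (x + h / 2)%R).
    + apply Rle_trans with (2 := Rmax_l _ _). apply H1; lra.
    + apply Rle_trans with (2 := Rmax_r _ _). apply H2; lra.
  - intros u Hu.
    destruct (H u) as [d [M [Hd HM]]]; [lra|].
    assert (Hcu := continuous_on_clamp g a b u Hab Hg).
    destruct (proj1 (RCcontinuous_eps _ _) Hcu d Hd) as [e [He0 He1]].
    exists e; split; [assumption|]. intros x h Hx Hh.
    exists (Rmax M 1). split; [apply Rlt_le_trans with (2 := Rmax_r _ _); lra|].
    intros s Hs Hs'. apply Rle_trans with (2 := Rmax_l _ _). apply HM.
    specialize (He1 s). rewrite !clamp_id in He1 by lra. apply He1. apply Rabs_def1; lra.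
  - exists M. split; [assumption|]. intros s Hs. apply HM; lra.
Qed.

Lemma Cmod_locally_bounded (w : C) : exists d M, (0 < d)%R /\
  forall z, (Cmod (z - w) < d)%R -> (Cmod z <= M)%R.
Proof.
  exists 1%R, (Cmod w + 1)%R. split; [lra|]. intros z Hz.
  assert (H := Cmod_triangle (z - w) w). replace (z - w + w) with z in H by ring. lra.
Qed.

Definition closed_contour (gamma : R -> C) : Prop :=
  continuous_on (fun x : R => (0 <= x <= 1)%R) gamma /\ piecewise_C1 gamma /\
  gamma 0%R = gamma 1%R.

Definition contour_continuous (gamma : R -> C) (f : C -> C) : Prop :=
  forall w, on_contour gamma w -> Ccontinuous f w.

Lemma piecewise_C1_ind (gamma : R -> C) (Q : R -> R -> Prop) :
  piecewise_C1 gamma ->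
  (forall a b dgamma, (0 <= a)%R -> (a < b)%R -> (b <= 1)%R ->
     continuous_on (fun x => (a <= x <= b)%R) dgamma ->
     (forall x, (a < x < b)%R -> RCderiv gamma x (dgamma x)) -> Q a b) ->
  (forall a b c, (0 <= a)%R -> (a < b)%R -> (b < c)%R -> (c <= 1)%R ->
     Q a b -> Q b c -> Q a c) ->
  Q 0%R 1%R.
Proof.
  intros [n [p [Hp0 [Hpn Hp]]]] Hpiece Hglue.
  assert (Hmono : forall k i, (i + k <= n)%nat -> (p i <= p (i + k)%nat)%R).
  { intros k; induction k as [|k IH]; intros i Hi.
    - rewrite Nat.add_0_r; lra.
    - apply Rle_trans with (p (i + k)%nat); [apply IH; lia|].
      rewrite Nat.add_succ_r. left. apply Hp; lia. }
  assert (Hlo : forall i, (i <= n)%nat -> (0 <= p i)%R).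
  { intros i Hi. rewrite <- Hp0. apply (Hmono i 0%nat); lia. }
  assert (Hhi : forall i, (i <= n)%nat -> (p i <= 1)%R).
  { intros i Hi. rewrite <- Hpn. replace n with (i + (n - i))%nat by lia.
    apply Hmono; lia. }
  assert (HQ : forall i, (S i <= n)%nat -> (0 < p (S i))%R /\ Q 0%R (p (S i))).
  { induction i as [|i IH]; intros Hi.
    - destruct (Hp 0%nat) as [H1 [dg [H2 H3]]]; [lia|].
      rewrite Hp0 in *. split; [assumption|].
      apply (Hpiece 0%R (p 1%nat) dg); auto with real. 
    - destruct IH as [IH1 IH2]; [lia|].
      destruct (Hp (S i)) as [H1 [dg [H2 H3]]]; [lia|].
      split; [lra|].
      assert (HS := Hhi (S (S i)) Hi).
      apply Hglue with (p (S i)); auto with real.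
      apply (Hpiece _ _ dg); auto with real. }
  destruct n as [|n]; [rewrite Hp0 in Hpn; lra|].
  rewrite <- Hpn. apply HQ. lia.
Qed.

Section Contour.
Variable gamma : R -> C.
Hypothesis Hgamma : closed_contour gamma.

Let integrand (f : C -> C) (x : R) : C := f (gamma x) * velocity gamma x.

(** [velocity] is meaningless at the corners of the contour; on each piece the integrand
    is replaced by a function that is continuous up to the endpoints. *)
Lemma contour_piece (f : C -> C) a b dgamma :
  (0 <= a)%R -> (a < b)%R -> (b <= 1)%R ->
  continuous_on (fun x => (a <= x <= b)%R) dgamma ->
  contour_continuous gamma f ->
  continuous_on (fun x => (a <= x <= b)%R) (fun x => f (gamma x) * dgamma x).
Proof.
  intros Ha Hab Hb Hdg Hf x Hx P HP.
  destruct Hgamma as [Hc _].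
  assert (H1 : RCcontinuous (fun y => f (gamma (clamp a b y)) * dgamma (clamp a b y)) x).
  { apply RCcontinuous_mult; [|apply continuous_on_clamp; [lra|assumption]].
    apply (RCcontinuous_comp (fun y => gamma (clamp a b y)) f).
    - apply continuous_on_clamp; [lra|].
      apply continuous_on_subset with (a := 0%R) (b := 1%R); assumption.
    - apply Hf. exists (clamp a b x). split; [|reflexivity].
      assert (H := clamp_in a b x); lra. }
  specialize (H1 P). cbv beta in H1. rewrite clamp_id in H1 by lra.
  destruct (H1 HP) as [e He].
  exists e. intros y Hy Hy'. specialize (He y Hy). rewrite clamp_id in He; assumption.
Qed.

(** The constant is the length of the contour, up to the bounds on the speed.  Existence
    and bound are proved together because additivity of the integral needs existence. *)
Lemma contour_bound_ex :
  exists L, (0 <= L)%R /\ forall f, contour_continuous gamma f ->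
    ex_RCInt (integrand f) 0 1 /\
    forall M, (forall w, on_contour gamma w -> (Cmod (f w) <= M)%R) ->
      (Cmod (RCInt (integrand f) 0 1) <= L * M)%R.
Proof.
  destruct Hgamma as [Hc [Hp _]].
  apply (piecewise_C1_ind gamma (fun a b => exists L, (0 <= L)%R /\
    forall f, contour_continuous gamma f ->
    ex_RCInt (integrand f) a b /\
    forall M, (forall w, on_contour gamma w -> (Cmod (f w) <= M)%R) ->
      (Cmod (RCInt (integrand f) a b) <= L * M)%R) Hp).
  - intros a b dg Ha Hab Hb Hdg Hd.
    assert (HB : exists B, (0 <= B)%R /\
              forall x, (a <= x <= b)%R -> (Cmod (dg x) <= B)%R).
    { destruct (path_locally_bounded dg Cmod a b) as [B [HB0 HB]]; [lra|assumption| |].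
      - intros s _. apply Cmod_locally_bounded.
      - exists B. split; [lra|exact HB]. }
    destruct HB as [B [HB0 HB]].
    exists ((b - a) * B)%R. split; [apply Rmult_le_pos; lra|].
    intros f Hf.
    set (h := fun x => f (gamma (clamp a b x)) * dg (clamp a b x)).
    assert (Hh : forall x, RCcontinuous h x).
    { intros x. apply (continuous_on_clamp (fun x => f (gamma x) * dg x)); [lra|].
      apply contour_piece; assumption. }
    assert (Hext : forall x, (a < x < b)%R -> h x = integrand f x).
    { intros x Hx. unfold h, integrand. rewrite clamp_id by lra.
      rewrite (velocity_unique gamma x (dg x)); [reflexivity|apply Hd, Hx]. }
    destruct (ex_RCInt_continuous h a b Hh) as [l Hl].
    assert (Hl' : is_RCInt (integrand f) a b l).
    { apply is_RCInt_ext with (f := h); [lra|assumption|assumption]. }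
    split; [exists l; assumption|].
    intros M HM. rewrite (is_RCInt_unique _ _ _ _ Hl').
    rewrite Rmult_assoc.
    apply is_RCInt_bound with (f := h); [lra| |assumption].
    intros x Hx. unfold h. rewrite clamp_id by lra. rewrite Cmod_mult, Rmult_comm.
    apply Rmult_le_compat; try apply Cmod_ge_0; [apply HB, Hx|].
    apply HM. exists x. split; [lra|reflexivity].
  - intros a b c Ha Hab Hbc Hc1 [L1 [HL1 H1]] [L2 [HL2 H2]].
    exists (L1 + L2)%R. split; [lra|]. intros f Hf.
    destruct (H1 f Hf) as [E1 B1]. destruct (H2 f Hf) as [E2 B2].
    split; [apply (@ex_RInt_Chasles C_R_NormedModule) with b; assumption|].
    intros M HM.
    rewrite <- (@RInt_Chasles C_R_CompleteNormedModule (integrand f) a b c E1 E2).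
    apply Rle_trans with (1 := Cmod_triangle _ _).
    specialize (B1 M HM). specialize (B2 M HM). lra.
Qed.

Lemma contour_integrable f : contour_continuous gamma f ->
  is_RCInt (integrand f) 0 1 (contour_integral gamma f).
Proof.
  intros Hf. destruct contour_bound_ex as [L [_ H]].
  apply RCInt_correct. apply H, Hf.
Qed.

Lemma contour_integral_bound :
  exists L, (0 <= L)%R /\ forall f M, contour_continuous gamma f ->
    (forall w, on_contour gamma w -> (Cmod (f w) <= M)%R) ->
    (Cmod (contour_integral gamma f) <= L * M)%R.
Proof.
  destruct contour_bound_ex as [L [HL H]]. exists L; split; [assumption|].
  intros f M Hf. apply H, Hf.
Qed.

Lemma contour_integral_unique f l : is_RCInt (integrand f) 0 1 l -> contour_integral gamma f = l.
Proof. apply is_RCInt_unique. Qed.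

Lemma contour_integral_ext f g :
  (forall w, on_contour gamma w -> f w = g w) ->
  contour_integral gamma f = contour_integral gamma g.
Proof.
  intros H. apply (@RInt_ext C_R_CompleteNormedModule).
  rewrite Rmin_left, Rmax_right by lra. intros x Hx. rewrite H; [reflexivity|].
  exists x; split; [lra|reflexivity].
Qed.

Lemma contour_integral_plus f g :
  contour_continuous gamma f -> contour_continuous gamma g ->
  contour_integral gamma (fun w => f w + g w) = contour_integral gamma f + contour_integral gamma g.
Proof.
  intros Hf Hg. apply contour_integral_unique.
  apply is_RCInt_ext with (2 := fun x _ =>
    eq_sym (Cmult_plus_distr_r (f (gamma x)) (g (gamma x)) (velocity gamma x))); [lra|].
  apply is_RCInt_plus; apply contour_integrable; assumption.
Qed.

Lemma contour_integral_scal k f :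
  contour_continuous gamma f ->
  contour_integral gamma (fun w => k * f w) = k * contour_integral gamma f.
Proof.
  intros Hf. apply contour_integral_unique.
  apply is_RCInt_ext with (2 := fun x _ =>
    Cmult_assoc k (f (gamma x)) (velocity gamma x)); [lra|].
  apply is_RCInt_scal, contour_integrable, Hf.
Qed.

Lemma contour_continuous_scal k f :
  contour_continuous gamma f -> contour_continuous gamma (fun w => k * f w).
Proof. intros Hf w Hw. apply Ccontinuous_mult; [apply Ccontinuous_const|apply Hf, Hw]. Qed.

Lemma contour_continuous_plus f g :
  contour_continuous gamma f -> contour_continuous gamma g ->
  contour_continuous gamma (fun w => f w + g w).
Proof. intros Hf Hg w Hw. apply Ccontinuous_plus; auto. Qed.

Lemma contour_integral_minus f g :
  contour_continuous gamma f -> contour_continuous gamma g ->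
  contour_integral gamma (fun w => f w - g w) = contour_integral gamma f - contour_integral gamma g.
Proof.
  intros Hf Hg.
  rewrite (contour_integral_ext _ (fun w => f w + (- (1)) * g w)) by (intros; ring).
  rewrite contour_integral_plus, contour_integral_scal; auto using contour_continuous_scal.
  ring.
Qed.

Theorem contour_integral_derivative (F f : C -> C) :
  contour_continuous gamma f ->
  (forall w, on_contour gamma w -> Cderiv F w (f w)) ->
  contour_integral gamma f = 0.
Proof.
  intros Hf HF. destruct Hgamma as [Hc [Hp Hcl]].
  assert (Hmain : is_RCInt (integrand f) 0 1 (F (gamma 1%R) - F (gamma 0%R))).
  { apply (piecewise_C1_ind gamma (fun a b =>
      is_RCInt (integrand f) a b (F (gamma b) - F (gamma a))) Hp).
    - intros a b dg Ha Hab Hb Hdg Hd.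
      apply is_RCInt_ext with (f := fun x => f (gamma x) * dg x); [lra| |].
      + intros x Hx. unfold integrand. rewrite (velocity_unique gamma x (dg x)); auto.
      + apply (RC_FTC (fun x => F (gamma x))); [lra| | |].
        * intros x Hx P HP.
          assert (H1 : RCcontinuous (fun y => F (gamma (clamp 0 1 y))) x).
          { apply (RCcontinuous_comp (fun y => gamma (clamp 0 1 y)) F).
            - apply continuous_on_clamp; [lra|assumption].
            - apply (Cderiv_continuous F _ (f (gamma (clamp 0 1 x)))), HF.
              exists (clamp 0 1 x). split; [|reflexivity]. apply clamp_in; lra. }
          specialize (H1 P). cbv beta in H1. rewrite clamp_id in H1 by lra.
          destruct (H1 HP) as [e He].
          exists e. intros y Hy Hy'. specialize (He y Hy).
          rewrite clamp_id in He by lra. assumption.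
        * apply contour_piece; assumption.
        * intros x Hx. apply RCderiv_comp; [|apply Hd, Hx].
          apply HF. exists x; split; [lra|reflexivity].
    - intros a b c _ _ _ _ H1 H2.
      replace (F (gamma c) - F (gamma a)) with
        ((F (gamma b) - F (gamma a)) + (F (gamma c) - F (gamma b))) by ring.
      apply is_RCInt_Chasles with b; assumption. }
  rewrite Hcl in Hmain. rewrite (contour_integral_unique _ _ Hmain). ring.
Qed.

End Contour.

(** * Goursat's lemma *)

Local Notation Cdiff := (@ex_derive C_AbsRing C_NormedModule).

(** The integral of [f] along the segment from [o + a d] to [o + b d].  Horizontal and
    vertical sides are the cases [d = 1] and [d = Ci], with the parameter [s] equal to the
    moving coordinate, so that splitting a side needs no change of variable. *)
Definition line_integral (o d : C) (f : C -> C) (a b : R) : C :=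
  RCInt (fun s : R => f (o + RtoC s * d) * d) a b.

Definition rectangle_integral (f : C -> C) (x0 x1 y0 y1 : R) : C :=
  line_integral (0%R, y0) 1 f x0 x1 + line_integral (x1, 0%R) Ci f y0 y1
  - line_integral (0%R, y1) 1 f x0 x1 - line_integral (x0, 0%R) Ci f y0 y1.

Definition in_rectangle (x0 x1 y0 y1 : R) (w : C) : Prop :=
  (x0 <= Re w <= x1)%R /\ (y0 <= Im w <= y1)%R.

Lemma hline_point (y s : R) : (0%R, y) + RtoC s * 1 = (s, y).
Proof. unfold Cplus, Cmult, RtoC; simpl. f_equal; ring. Qed.

Lemma vline_point (x s : R) : (x, 0%R) + RtoC s * Ci = (x, s).
Proof. unfold Cplus, Cmult, RtoC; simpl. f_equal; ring. Qed.

Lemma line_RCderiv (o d : C) (s : R) : RCderiv (fun s : R => o + RtoC s * d) s d.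
Proof.
  apply RCderiv_eps. intros eps He. exists 1%R; split; [lra|]. intros y _.
  replace (o + RtoC y * d - (o + RtoC s * d) - RtoC (y - s) * d) with (RtoC 0)
    by (rewrite RtoC_minus; ring).
  rewrite Cmod_0. apply Rmult_le_pos; [lra|apply Rabs_pos].
Qed.

Section Line.
Variables (o d : C).

Let on_line (a b : R) (P : C -> Prop) : Prop :=
  forall s, (a <= s <= b)%R -> P (o + RtoC s * d).

Lemma line_integrable f a b : (a <= b)%R -> on_line a b (Ccontinuous f) ->
  is_RCInt (fun s : R => f (o + RtoC s * d) * d) a b (line_integral o d f a b).
Proof.
  intros Hab Hf. apply RCInt_correct.
  apply (@ex_RInt_continuous C_R_CompleteNormedModule).
  rewrite Rmin_left, Rmax_right by lra. intros s Hs.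
  apply RCcontinuous_mult; [|apply continuous_const].
  apply (RCcontinuous_comp (fun s : R => o + RtoC s * d) f); [|apply Hf, Hs].
  exact (RCderiv_continuous _ _ _ (line_RCderiv o d s)).
Qed.

Lemma line_integral_Chasles f a b c : (a <= b)%R -> (b <= c)%R ->
  on_line a c (Ccontinuous f) ->
  line_integral o d f a c = line_integral o d f a b + line_integral o d f b c.
Proof.
  intros Hab Hbc Hf. apply is_RCInt_unique. apply is_RCInt_Chasles with b;
  apply line_integrable; try assumption; intros s Hs; apply Hf; lra.
Qed.

Lemma line_integral_bound f a b M : (a <= b)%R -> (Cmod d <= 1)%R ->
  on_line a b (Ccontinuous f) -> on_line a b (fun w => Cmod (f w) <= M)%R ->
  (Cmod (line_integral o d f a b) <= (b - a) * M)%R.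
Proof.
  intros Hab Hd Hf HM.
  refine (is_RCInt_bound _ a b _ M Hab _ (line_integrable f a b Hab Hf)).
  intros s Hs. cbv beta. rewrite Cmod_mult.
  apply Rle_trans with (Cmod (f (o + RtoC s * d)%C) * 1)%R.
  - apply Rmult_le_compat_l; [apply Cmod_ge_0|assumption].
  - rewrite Rmult_1_r. apply HM, Hs.
Qed.

Lemma line_integral_plus f g a b : (a <= b)%R ->
  on_line a b (Ccontinuous f) -> on_line a b (Ccontinuous g) ->
  line_integral o d (fun w => f w + g w) a b = line_integral o d f a b + line_integral o d g a b.
Proof.
  intros Hab Hf Hg. apply is_RCInt_unique.
  apply is_RCInt_ext with (2 := fun x _ =>
    eq_sym (Cmult_plus_distr_r (f (o + RtoC x * d)) (g (o + RtoC x * d)) d)); [lra|].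
  apply is_RCInt_plus; apply line_integrable; assumption.
Qed.

Lemma line_integral_scal k f a b : (a <= b)%R ->
  on_line a b (Ccontinuous f) ->
  line_integral o d (fun w => k * f w) a b = k * line_integral o d f a b.
Proof.
  intros Hab Hf. apply is_RCInt_unique.
  apply is_RCInt_ext with (2 := fun x _ => Cmult_assoc k (f (o + RtoC x * d)) d); [lra|].
  apply is_RCInt_scal. apply line_integrable; assumption.
Qed.

Lemma line_integral_ext f g a b : (a <= b)%R ->
  on_line a b (fun w => f w = g w) -> line_integral o d f a b = line_integral o d g a b.
Proof.
  intros Hab H. apply (@RInt_ext C_R_CompleteNormedModule).
  rewrite Rmin_left, Rmax_right by lra. intros s Hs. rewrite H; [reflexivity|lra].
Qed.

Lemma line_integral_derivative (F f : C -> C) a b : (a <= b)%R ->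
  on_line a b (Ccontinuous f) -> on_line a b (fun w => Cderiv F w (f w)) ->
  line_integral o d f a b = F (o + RtoC b * d) - F (o + RtoC a * d).
Proof.
  intros Hab Hf HF. apply is_RCInt_unique.
  apply (@is_RInt_derive C_R_CompleteNormedModule (fun s => F (o + RtoC s * d)));
  rewrite Rmin_left, Rmax_right by lra; intros s Hs.
  - apply (RCderiv_comp F (fun s : R => o + RtoC s * d)); [apply HF, Hs|apply line_RCderiv].
  - apply RCcontinuous_mult; [|apply continuous_const].
    apply (RCcontinuous_comp (fun s : R => o + RtoC s * d) f); [|apply Hf, Hs].
    exact (RCderiv_continuous _ _ _ (line_RCderiv o d s)).
Qed.
End Line.

(** Integrands such as [f w / (w - z)] are continuous on the sides of a rectangle only. *)
Definition boundary_continuous (f : C -> C) (x0 x1 y0 y1 : R) : Prop :=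
  forall w, in_rectangle x0 x1 y0 y1 w ->
    Re w = x0 \/ Re w = x1 \/ Im w = y0 \/ Im w = y1 -> Ccontinuous f w.

(* [H] holds at every point of a side *)
Local Ltac side H := intros s Hs; rewrite ?hline_point, ?vline_point;
  apply H; unfold in_rectangle; simpl; try lra; auto.

Section Rectangle.
Variables (x0 x1 y0 y1 : R).
Hypotheses (Hx : (x0 <= x1)%R) (Hy : (y0 <= y1)%R).

Lemma rectangle_integral_plus f g :
  boundary_continuous f x0 x1 y0 y1 -> boundary_continuous g x0 x1 y0 y1 ->
  rectangle_integral (fun w => f w + g w) x0 x1 y0 y1 =
  rectangle_integral f x0 x1 y0 y1 + rectangle_integral g x0 x1 y0 y1.
Proof.
  intros Hf Hg. unfold rectangle_integral.
  rewrite !(line_integral_plus _ _ f g); [ring|..]; try assumption;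
    lazymatch goal with |- context [f] => side Hf | _ => side Hg end.
Qed.

Lemma rectangle_integral_scal k f :
  boundary_continuous f x0 x1 y0 y1 ->
  rectangle_integral (fun w => k * f w) x0 x1 y0 y1 = k * rectangle_integral f x0 x1 y0 y1.
Proof.
  intros Hf. unfold rectangle_integral.
  rewrite !line_integral_scal; try assumption; first [side Hf|ring].
Qed.

Lemma rectangle_integral_ext f g :
  (forall w, in_rectangle x0 x1 y0 y1 w ->
    Re w = x0 \/ Re w = x1 \/ Im w = y0 \/ Im w = y1 -> f w = g w) ->
  rectangle_integral f x0 x1 y0 y1 = rectangle_integral g x0 x1 y0 y1.
Proof.
  intros H. unfold rectangle_integral.
  rewrite !(line_integral_ext _ _ f g); try assumption; first [side H|reflexivity].
Qed.

Lemma rectangle_integral_bound f M :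
  boundary_continuous f x0 x1 y0 y1 ->
  (forall w, in_rectangle x0 x1 y0 y1 w ->
    Re w = x0 \/ Re w = x1 \/ Im w = y0 \/ Im w = y1 -> (Cmod (f w) <= M)%R) ->
  (Cmod (rectangle_integral f x0 x1 y0 y1) <= 2 * ((x1 - x0) + (y1 - y0)) * M)%R.
Proof.
  intros Hf HM. unfold rectangle_integral.
  assert (D1 : (Cmod 1 <= 1)%R) by (rewrite Cmod_1; lra).
  assert (Di : (Cmod Ci <= 1)%R) by (rewrite Cmod_Ci; lra).
  assert (B1 : (Cmod (line_integral (0%R, y0) 1 f x0 x1) <= (x1 - x0) * M)%R)
    by (apply line_integral_bound; try assumption; first [side Hf|side HM]).
  assert (B2 : (Cmod (line_integral (0%R, y1) 1 f x0 x1) <= (x1 - x0) * M)%R)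
    by (apply line_integral_bound; try assumption; first [side Hf|side HM]).
  assert (B3 : (Cmod (line_integral (x0, 0%R) Ci f y0 y1) <= (y1 - y0) * M)%R)
    by (apply line_integral_bound; try assumption; first [side Hf|side HM]).
  assert (B4 : (Cmod (line_integral (x1, 0%R) Ci f y0 y1) <= (y1 - y0) * M)%R)
    by (apply line_integral_bound; try assumption; first [side Hf|side HM]).
  eapply Rle_trans; [apply Cmod_triangle|]. rewrite Cmod_opp.
  eapply Rle_trans; [apply Rplus_le_compat_r, Cmod_triangle|]. rewrite Cmod_opp.
  eapply Rle_trans; [apply Rplus_le_compat_r, Rplus_le_compat_r, Cmod_triangle|].
  lra.
Qed.

Lemma rectangle_integral_derivative (F f : C -> C) :
  boundary_continuous f x0 x1 y0 y1 ->
  (forall w, in_rectangle x0 x1 y0 y1 w -> Cderiv F w (f w)) ->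
  rectangle_integral f x0 x1 y0 y1 = 0.
Proof.
  intros Hf HF. unfold rectangle_integral.
  rewrite !(line_integral_derivative _ _ F f); try assumption; try first [side Hf|side HF].
  rewrite !hline_point, !vline_point. ring.
Qed.
End Rectangle.

Lemma rectangle_split_x f x0 x1 x2 y0 y1 :
  (x0 <= x1)%R -> (x1 <= x2)%R -> (y0 <= y1)%R ->
  boundary_continuous f x0 x2 y0 y1 ->
  rectangle_integral f x0 x2 y0 y1 =
  rectangle_integral f x0 x1 y0 y1 + rectangle_integral f x1 x2 y0 y1.
Proof.
  intros H1 H2 Hy Hf. unfold rectangle_integral.
  rewrite (line_integral_Chasles (0%R, y0) 1 f x0 x1 x2); try assumption; [|side Hf].
  rewrite (line_integral_Chasles (0%R, y1) 1 f x0 x1 x2); try assumption; [|side Hf].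
  ring.
Qed.

Lemma rectangle_split_y f x0 x1 y0 y1 y2 :
  (x0 <= x1)%R -> (y0 <= y1)%R -> (y1 <= y2)%R ->
  boundary_continuous f x0 x1 y0 y2 ->
  rectangle_integral f x0 x1 y0 y2 =
  rectangle_integral f x0 x1 y0 y1 + rectangle_integral f x0 x1 y1 y2.
Proof.
  intros H1 H2 Hy Hf. unfold rectangle_integral.
  rewrite (line_integral_Chasles (x0, 0%R) Ci f y0 y1 y2); try assumption; [|side Hf].
  rewrite (line_integral_Chasles (x1, 0%R) Ci f y0 y1 y2); try assumption; [|side Hf].
  ring.
Qed.

(** Near a point, [f] differs from an affine function by [e] times the distance, and the
    integral of an affine function over a closed path is zero; so the integral over a
    small rectangle is of the order of [e] times the square of its size.  The bound
    persists when four quarters are put together. *)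
Theorem goursat (f : C -> C) x0 x1 y0 y1 : (x0 <= x1)%R -> (y0 <= y1)%R ->
  (forall w, in_rectangle x0 x1 y0 y1 w -> Cdiff f w) ->
  rectangle_integral f x0 x1 y0 y1 = 0.
Proof.
  intros Hx Hy Hf.
  assert (Hc : forall w, in_rectangle x0 x1 y0 y1 w -> Ccontinuous f w)
    by (intros w Hw; apply ex_Cderiv_continuous, Hf, Hw).
  apply Cmod_eq_0. apply Rle_antisym; [|apply Cmod_ge_0].
  apply le_epsilon. intros eps Heps. rewrite Rplus_0_l.
  set (K := (2 * (1 + (x1 - x0) + (y1 - y0)) * (1 + (x1 - x0) + (y1 - y0)))%R).
  assert (HK : (0 < K)%R) by (unfold K; nra).
  set (e := (eps / K)%R). assert (He : (0 < e)%R) by (apply Rdiv_lt_0_compat; assumption).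
  pose (P := fun x a y b : R => (0 <= a)%R -> (0 <= b)%R ->
     (x0 <= x)%R -> (x + a <= x1)%R -> (y0 <= y)%R -> (y + b <= y1)%R ->
     (Cmod (rectangle_integral f x (x + a) y (y + b)) <= e * (2 * (a + b) * (a + b)))%R).
  assert (HP : P x0 (x1 - x0)%R y0 (y1 - y0)%R).
  { apply bisection_principle; [lra|lra| |].
    - intros x a y b Ha Hb P1 P2 P3 P4 _ _ I1 I2 I3 I4.
      assert (Q1 := P1 ltac:(lra) ltac:(lra) ltac:(lra) ltac:(lra) ltac:(lra) ltac:(lra)).
      assert (Q2 := P2 ltac:(lra) ltac:(lra) ltac:(lra) ltac:(lra) ltac:(lra) ltac:(lra)).
      assert (Q3 := P3 ltac:(lra) ltac:(lra) ltac:(lra) ltac:(lra) ltac:(lra) ltac:(lra)).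
      assert (Q4 := P4 ltac:(lra) ltac:(lra) ltac:(lra) ltac:(lra) ltac:(lra) ltac:(lra)).
      clear P1 P2 P3 P4.
      replace (x + a / 2 + a / 2)%R with (x + a)%R in * by lra.
      replace (y + b / 2 + b / 2)%R with (y + b)%R in * by lra.
      assert (Hcr : forall x' x'' y' y'', (x <= x')%R -> (x'' <= x + a)%R ->
                (y <= y')%R -> (y'' <= y + b)%R -> boundary_continuous f x' x'' y' y'').
      { intros x' x'' y' y'' ? ? ? ? w [Hw1 Hw2] _. apply Hc; split; lra. }
      rewrite (rectangle_split_x f x (x + a / 2) (x + a)) by (try lra; apply Hcr; lra).
      rewrite (rectangle_split_y f x (x + a / 2) y (y + b / 2) (y + b)) by (try lra; apply Hcr; lra).
      rewrite (rectangle_split_y f (x + a / 2) (x + a) y (y + b / 2) (y + b)) by (try lra; apply Hcr; lra).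
      eapply Rle_trans; [apply Cmod_triangle|].
      eapply Rle_trans; [apply Rplus_le_compat; apply Cmod_triangle|].
      nra.
    - intros u v Hu Hv.
      assert (Hin : in_rectangle x0 x1 y0 y1 (u, v)) by (split; simpl; lra).
      destruct (Hf _ Hin) as [l Hl].
      destruct (proj1 (Cderiv_eps f (u, v) l) Hl e He) as [del [Hd Hdel]].
      exists (del / 2)%R. split; [lra|].
      intros x a y b Hxu Hyv Ha' Hb' Ha Hb I1 I2 I3 I4.
      set (p := (u, v)) in *.
      pose (A := fun w : C => (f p - p * l) * 1 + l / 2 * (1 * w + w * 1)).
      assert (HA : forall w, Cderiv (fun w => (f p - p * l) * w + l / 2 * (w * w)) w (A w)).
      { intros w. apply Cderiv_plus; apply Cderiv_scal; [apply Cderiv_id|].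
        apply (Cderiv_mult (fun w => w) (fun w => w)); apply Cderiv_id. }
      assert (HAc : forall w, Ccontinuous A w).
      { intros w. apply (Cderiv_continuous A w (0 + l / 2 * (1 * 1 + 1 * 1))).
        apply Cderiv_plus; [apply Cderiv_const|apply Cderiv_scal].
        apply Cderiv_plus; [apply Cderiv_scal, Cderiv_id|].
        apply (Cderiv_ext_loc (fun z => 1 * z) _ _ _ 1 Rlt_0_1); [intros; ring|].
        replace (1 * 1) with (1 * RtoC 1) by ring. apply Cderiv_scal, Cderiv_id. }
      rewrite (rectangle_integral_ext x (x + a) y (y + b) ltac:(lra) ltac:(lra) f
        (fun w => (f w + (- (1)) * A w) + A w)) by (intros; ring).
      rewrite rectangle_integral_plus; try lra.
      2:{ intros w [Hw1 Hw2] _. apply Ccontinuous_plus; [apply Hc; split; lra|].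
          apply Ccontinuous_mult; [apply Ccontinuous_const|apply HAc]. }
      2:{ intros w _ _. apply HAc. }
      rewrite (rectangle_integral_derivative x (x + a) y (y + b) ltac:(lra) ltac:(lra) _ A)
        with (2 := fun w _ => HA w) by (intros w _ _; apply HAc).
      rewrite Cplus_0_r.
      replace (e * (2 * (a + b) * (a + b)))%R with
        (2 * ((x + a - x) + (y + b - y)) * (e * (a + b)))%R by ring.
      apply rectangle_integral_bound; try lra.
      + intros w [Hw1 Hw2] _. apply Ccontinuous_plus; [apply Hc; split; lra|].
        apply Ccontinuous_mult; [apply Ccontinuous_const|apply HAc].
      + intros w [Hw1 Hw2] _.
        assert (Hwp : (Cmod (w - p) <= a + b)%R).
        { apply Rle_trans with (1 := Cmod_le_abs_sum _).
          destruct w as [w1 w2]; simpl in Hw1, Hw2 |- *.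
          apply Rplus_le_compat; apply Rabs_le; lra. }
        replace (f w + - (1) * A w) with (f w - f p - (w - p) * l) by (unfold A; field).
        apply Rle_trans with (e * Cmod (w - p))%R; [apply Hdel, (Rle_lt_trans _ _ _ Hwp); lra|].
        apply Rmult_le_compat_l; lra. }
  unfold P in HP. replace (x0 + (x1 - x0))%R with x1 in HP by ring.
  replace (y0 + (y1 - y0))%R with y1 in HP by ring.
  eapply Rle_trans; [apply HP; lra|].
  replace eps with (e * K)%R by (unfold e; field; lra).
  apply Rmult_le_compat_l; [lra|]. unfold K. nra.
Qed.

(** * Cauchy's formula on rectangles *)

(** Cutting along the sides of the small square leaves four rectangles that avoid the
    point and contribute nothing. *)
Lemma excise_point (f : C -> C) x0 x1 y0 y1 p q r :
  (0 < r)%R -> (x0 <= p - r)%R -> (p + r <= x1)%R -> (y0 <= q - r)%R -> (q + r <= y1)%R ->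
  (forall w, in_rectangle x0 x1 y0 y1 w -> w <> (p, q) -> Cdiff f w) ->
  rectangle_integral f x0 x1 y0 y1 = rectangle_integral f (p - r) (p + r) (q - r) (q + r).
Proof.
  intros Hr X0 X1 Y0 Y1 Hf.
  assert (Hpt : forall w : C, w <> (p, q) <-> (Re w <> p \/ Im w <> q)).
  { intros [a b]; simpl. split.
    - intros H. destruct (Req_dec a p) as [->|]; [|tauto].
      right. intros ->. apply H; reflexivity.
    - intros [H|H] E; inversion E; contradiction. }
  assert (Hd : forall w, in_rectangle x0 x1 y0 y1 w -> (Re w <> p \/ Im w <> q) -> Cdiff f w)
    by (intros w H1 H2; apply Hf; [assumption|apply Hpt; assumption]).
  assert (Hc : forall x x' y y', (x0 <= x)%R -> (x' <= x1)%R -> (y0 <= y)%R -> (y' <= y1)%R ->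
     (x <> p)%R -> (x' <> p)%R -> (y <> q)%R -> (y' <> q)%R ->
     boundary_continuous f x x' y y').
  { intros x x' y y' ? ? ? ? ? ? ? ? w [Hw1 Hw2] Hb. apply ex_Cderiv_continuous, Hd.
    - split; lra.
    - destruct Hb as [E|[E|[E|E]]]; rewrite E; auto. }
  rewrite (rectangle_split_x f x0 (p - r) x1) by (try lra; apply Hc; lra).
  rewrite (rectangle_split_x f (p - r) (p + r) x1) by (try lra; apply Hc; lra).
  rewrite (rectangle_split_y f (p - r) (p + r) y0 (q - r) y1) by (try lra; apply Hc; lra).
  rewrite (rectangle_split_y f (p - r) (p + r) (q - r) (q + r) y1) by (try lra; apply Hc; lra).
  rewrite (goursat f x0 (p - r)), (goursat f (p + r) x1), (goursat f (p - r) (p + r) y0),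
    (goursat f (p - r) (p + r) (q + r)); try lra; try ring;
    intros w [Hw1 Hw2]; (apply Hd; [split; lra|]);
    first [left; intros E; lra|right; intros E; lra].
Qed.

(** Along each side of a square of half side [r] about its centre, [dw / (w - z)] is, up
    to sign, this function with [k = 1] or [k = -1].  Its real part is odd and the
    imaginary part integrates to [2 atan 1]: each side sees a quarter turn. *)
Lemma cauchy_kernel_side (k p r : R) : (0 < r)%R ->
  is_RCInt (fun s => ((k * ((s - p) / ((s - p) * (s - p) + r * r)))%R,
                      (r / ((s - p) * (s - p) + r * r))%R)) (p - r) (p + r)
    (0%R, (PI / 2)%R).
Proof.
  intros Hr.
  assert (Hpos : forall s, (0 < (s - p) * (s - p) + r * r)%R) by (intros s; assert (H1 := Rle_0_sqr (s - p)); assert (H2 := Rmult_lt_0_compat r r Hr Hr);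
        unfold Rsqr in H1; lra).
  assert (Hder : forall (F f : R -> R) l, (forall s, is_derive F s (f s)) ->
    (forall s, continuous f s) -> (F (p + r) - F (p - r))%R = l ->
    is_RInt f (p - r) (p + r) l).
  { intros F f l H1 H2 <-. apply (is_RInt_derive F f); intros; auto. }
  apply (is_RInt_fct_extend_pair (U := R_NormedModule) (V := R_NormedModule)); simpl.
  - apply (Hder (fun s => k / 2 * ln ((s - p) * (s - p) + r * r))%R).
    + intros s. specialize (Hpos s). auto_derive; [lra|]. field. lra.
    + intros s. specialize (Hpos s). apply (@ex_derive_continuous R_AbsRing R_NormedModule). auto_derive. lra.
    + replace ((p + r - p) * (p + r - p) + r * r)%R
        with ((p - r - p) * (p - r - p) + r * r)%R by ring. ring.
  - apply (Hder (fun s => atan ((s - p) / r))).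
    + intros s. specialize (Hpos s). auto_derive; [trivial|]. field. repeat split; nra.
    + intros s. specialize (Hpos s). apply (@ex_derive_continuous R_AbsRing R_NormedModule). auto_derive. lra.
    + replace ((p + r - p) / r)%R with 1%R by (field; lra).
      replace ((p - r - p) / r)%R with (-1)%R by (field; lra).
      change (-1)%R with (IZR (Z.opp 1)). rewrite opp_IZR, atan_opp, atan_1. field.
Qed.

Lemma square_winding p q r : (0 < r)%R ->
  rectangle_integral (fun w => / (w - (p, q))) (p - r) (p + r) (q - r) (q + r) = 2 * PI * Ci.
Proof.
  intros Hr.
  assert (Hval : forall o d m k (c : C), c * c = 1 ->
    (forall s, (m - r <= s <= m + r)%R ->
       / (o + RtoC s * d - (p, q)) * d =
       c * ((k * ((s - m) / ((s - m) * (s - m) + r * r)))%R,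
            (r / ((s - m) * (s - m) + r * r))%R)) ->
    line_integral o d (fun w => / (w - (p, q))) (m - r) (m + r) = c * (0%R, (PI / 2)%R)).
  { intros o d m k c Hc H. apply is_RCInt_unique.
    apply is_RCInt_ext with (f := fun s => c * ((k * ((s - m) / ((s - m) * (s - m) + r * r)))%R,
            (r / ((s - m) * (s - m) + r * r))%R)); [lra| |].
    - intros s Hs. symmetry. apply H. lra.
    - apply is_RCInt_scal, cauchy_kernel_side, Hr. }
  assert (Hnz : forall u v, (0 < (u - v) * (u - v) + r * r)%R).
  { intros u v. assert (H1 := Rle_0_sqr (u - v)). assert (H2 := Rmult_lt_0_compat r r Hr Hr).
    unfold Rsqr in H1; lra. }
  unfold rectangle_integral.
  rewrite (Hval (0%R, (q - r)%R) 1 p 1%R 1); [|ring|].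
  2:{ intros s _. rewrite hline_point. unfold Cinv, Cmult, Cminus, Cplus, Copp, RtoC; simpl.
      f_equal; field; assert (A1 := Hnz s p); assert (A2 := Hnz s q); lra. }
  rewrite (Hval ((p + r)%R, 0%R) Ci q 1%R 1); [|ring|].
  2:{ intros s _. rewrite vline_point. unfold Cinv, Cmult, Cminus, Cplus, Copp, RtoC, Ci; simpl.
      f_equal; field; assert (A1 := Hnz s p); assert (A2 := Hnz s q); lra. }
  rewrite (Hval (0%R, (q + r)%R) 1 p (-1)%R (- (1))); [|ring|].
  2:{ intros s _. rewrite hline_point. unfold Cinv, Cmult, Cminus, Cplus, Copp, RtoC; simpl.
      f_equal; field; assert (A1 := Hnz s p); assert (A2 := Hnz s q); lra. }
  rewrite (Hval ((p - r)%R, 0%R) Ci q (-1)%R (- (1))); [|ring|].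
  2:{ intros s _. rewrite vline_point. unfold Cinv, Cmult, Cminus, Cplus, Copp, RtoC, Ci; simpl.
      f_equal; field; assert (A1 := Hnz s p); assert (A2 := Hnz s q); lra. }
  unfold Cmult, Cminus, Cplus, Copp, RtoC, Ci; simpl. f_equal; field.
Qed.

Lemma Cdiff_kernel (f : C -> C) (z w : C) : Cdiff f w -> w <> z -> Cdiff (fun w => f w / (w - z)) w.
Proof.
  intros [l Hl] Hw.
  assert (Hne : w - z <> 0).
  { intros E. apply Hw. replace w with (w - z + z) by ring. rewrite E. ring. }
  exists (l * / (w - z) + f w * ((1 - 0) * - / ((w - z) * (w - z)))).
  apply (Cderiv_mult f (fun w => / (w - z))); [exact Hl|].
  apply (Cderiv_comp Cinv (fun w => w - z)).
  - apply Cderiv_inv, Hne.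
  - apply Cderiv_minus; [apply Cderiv_id|apply Cderiv_const].
Qed.

Lemma Cdiff_const (c w : C) : Cdiff (fun _ => c) w.
Proof. exists (RtoC 0). apply Cderiv_const. Qed.

(** Shrink the rectangle to a square of half side [r] about [z].  There
    [f w / (w - z)] is [f z / (w - z)] plus a bounded function, whose integral is of the
    order of the perimeter. *)
Theorem cauchy_formula_rectangle (f : C -> C) x0 x1 y0 y1 (z : C) :
  (x0 < Re z < x1)%R -> (y0 < Im z < y1)%R ->
  (forall w, in_rectangle x0 x1 y0 y1 w -> Cdiff f w) ->
  rectangle_integral (fun w => f w / (w - z)) x0 x1 y0 y1 = 2 * PI * Ci * f z.
Proof.
  destruct z as [p q]. simpl. intros Hp Hq Hf. set (z := (p, q)).
  set (I := rectangle_integral (fun w => f w / (w - z)) x0 x1 y0 y1).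
  destruct (Hf z) as [l Hl]; [split; simpl; lra|].
  destruct (proj1 (Cderiv_eps f z l) Hl 1%R Rlt_0_1) as [del [Hd Hdel]].
  set (M := (Cmod l + 1)%R). assert (HM : (0 < M)%R) by (unfold M; pose proof (Cmod_ge_0 l); lra).
  assert (Hmain : forall r, (0 < r)%R -> (r < del / 2)%R -> (x0 <= p - r)%R -> (p + r <= x1)%R ->
     (y0 <= q - r)%R -> (q + r <= y1)%R -> (Cmod (I - 2 * PI * Ci * f z) <= 8 * M * r)%R).
  { intros r Hr Hrd X0 X1 Y0 Y1.
    unfold I. rewrite (excise_point _ x0 x1 y0 y1 p q r); try assumption.
    2:{ intros w Hw Hwz. apply Cdiff_kernel; auto. }
    rewrite <- (square_winding p q r Hr). fold z.
    assert (Hbz : forall w, in_rectangle (p - r) (p + r) (q - r) (q + r) w ->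
       Re w = (p - r)%R \/ Re w = (p + r)%R \/ Im w = (q - r)%R \/ Im w = (q + r)%R -> w <> z).
    { intros w _ Hb ->. simpl in Hb. lra. }
    assert (C1 : boundary_continuous (fun w => (f w - f z) / (w - z)) (p - r) (p + r) (q - r) (q + r)).
    { intros w Hw Hb. apply ex_Cderiv_continuous. apply (Cdiff_kernel (fun w => f w - f z)); [|exact (Hbz w Hw Hb)].
      destruct Hw as [Hw1 Hw2]. destruct (Hf w) as [m Hm]; [split; lra|].
      exists (m - 0). apply Cderiv_minus; [exact Hm|apply Cderiv_const]. }
    assert (C2 : boundary_continuous (fun w => / (w - z)) (p - r) (p + r) (q - r) (q + r)).
    { intros w Hw Hb. apply Ccontinuous_inv.
      - apply Ccontinuous_minus; [apply Ccontinuous_id|apply Ccontinuous_const].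
      - intros E. apply (Hbz w Hw Hb). replace w with (w - z + z) by ring. rewrite E; ring. }
    rewrite (rectangle_integral_ext (p - r) (p + r) (q - r) (q + r) ltac:(lra) ltac:(lra) _
      (fun w => (f w - f z) / (w - z) + f z * / (w - z))) by (intros; unfold Cdiv; ring).
    rewrite rectangle_integral_plus; try lra; try assumption.
    2:{ intros w Hw Hb. apply Ccontinuous_mult; [apply Ccontinuous_const|apply C2; assumption]. }
    rewrite rectangle_integral_scal; try lra; try assumption.
    replace (_ + _ - _) with (rectangle_integral (fun w => (f w - f z) / (w - z))
      (p - r) (p + r) (q - r) (q + r)) by ring.
    replace (8 * M * r)%R with (2 * ((p + r - (p - r)) + (q + r - (q - r))) * M)%R by ring.
    apply rectangle_integral_bound; try lra; try assumption.
    intros w Hw Hb. assert (Hwz := Hbz w Hw Hb).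
    assert (Hne : w - z <> 0).
    { intros E. apply Hwz. replace w with (w - z + z) by ring. rewrite E. ring. }
    assert (Hsm : (Cmod (w - z) < del)%R).
    { destruct w as [w1 w2]. destruct Hw as [Hw1 Hw2]. simpl in Hw1, Hw2.
      apply Rle_lt_trans with (1 := Cmod_le_abs_sum _). simpl.
      assert (Rabs (w1 + - p) <= r)%R by (apply Rabs_le; lra).
      assert (Rabs (w2 + - q) <= r)%R by (apply Rabs_le; lra). lra. }
    specialize (Hdel w Hsm).
    replace ((f w - f z) / (w - z)) with ((f w - f z - (w - z) * l) / (w - z) + l)
      by (field; assumption).
    apply Rle_trans with (1 := Cmod_triangle _ _).
    rewrite Cmod_div by assumption. unfold M. rewrite Rplus_comm. apply Rplus_le_compat_l.
    apply Cmod_gt_0 in Hne.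
    apply Rmult_le_reg_r with (Cmod (w - z)); [assumption|].
    unfold Rdiv. rewrite Rmult_assoc, Rinv_l by lra. rewrite Rmult_1_r. exact Hdel. }
  assert (H0 : I - 2 * PI * Ci * f z = 0).
  { apply Cmod_eq_0. apply Rle_antisym; [|apply Cmod_ge_0].
    apply le_epsilon. intros eps Heps. rewrite Rplus_0_l.
    assert (Hre : (0 < eps / (8 * M))%R) by (apply Rdiv_lt_0_compat; lra).
    set (r0 := Rmin (Rmin (del / 2) (eps / (8 * M))) (Rmin (Rmin (p - x0) (x1 - p)) (Rmin (q - y0) (y1 - q)))).
    assert (Hr0 : (0 < r0)%R) by (unfold r0; repeat apply Rmin_pos; lra).
    set (r := (r0 / 2)%R). assert (B0 : (r < r0)%R) by (unfold r; lra).
    destruct (Rmin_Rgt_l _ _ _ B0) as [B1 B2].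
    destruct (Rmin_Rgt_l _ _ _ B1) as [B3 R2]. destruct (Rmin_Rgt_l _ _ _ B2) as [B4 B5].
    destruct (Rmin_Rgt_l _ _ _ B4) as [B6 B7]. destruct (Rmin_Rgt_l _ _ _ B5) as [B8 B9].
    assert (Hr : (0 < r)%R) by (unfold r; lra). apply Rgt_lt, Rlt_le in R2.
    apply Rle_trans with (8 * M * r)%R; [apply Hmain; lra|].
    apply Rmult_le_compat_l with (r := (8 * M)%R) in R2; [|lra].
    replace (8 * M * (eps / (8 * M)))%R with eps in R2 by (field; lra). exact R2. }
  replace I with (I - 2 * PI * Ci * f z + 2 * PI * Ci * f z) by ring. rewrite H0. ring.
Qed.

(** * The winding integral *)
Lemma Cminus_neq_0 (z w : C) : z <> w -> z - w <> 0.
Proof. intros H E. apply H. replace z with (z - w + w) by ring. rewrite E. ring. Qed.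

Lemma Cmod_minus_diag (w : C) : Cmod (w - w) = 0%R.
Proof. rewrite <- Cmod_0. f_equal. ring. Qed.

Local Ltac field_off_poles :=
  field; repeat split; try assumption; apply Cminus_neq_0; assumption.

Lemma two_pi_i_neq_0 : 2 * PI * Ci <> 0.
Proof.
  repeat apply Cmult_neq_0; intros E; try (apply RtoC_inj in E; assert (A := PI_RGT_0); lra).
  inversion E; lra.
Qed.

Lemma Cmod_minus_sym (z w : C) : Cmod (z - w) = Cmod (w - z).
Proof. rewrite <- Cmod_opp. f_equal. ring. Qed.

Lemma Cmod_minus_lower (z w : C) : (Cmod z - Cmod w <= Cmod (z - w))%R.
Proof.
  assert (H := Cmod_triangle (z - w) w). replace (z - w + w) with z in H by ring. lra.
Qed.

(** Passing through the midpoint of [w] and [w'] halves the constant [K]. *)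
Lemma quadratic_constant (g : C -> C) (w0 : C) (d K : R) :
  (forall w w', (Cmod (w - w0) < d)%R -> (Cmod (w' - w0) < d)%R ->
     (Cmod (g w - g w') <= K * (Cmod (w - w') * Cmod (w - w')))%R) ->
  forall w, (Cmod (w - w0) < d)%R -> g w = g w0.
Proof.
  intros H w Hw.
  assert (Hn : forall n w w', (Cmod (w - w0) < d)%R -> (Cmod (w' - w0) < d)%R ->
     (Cmod (g w - g w') <= K / 2 ^ n * (Cmod (w - w') * Cmod (w - w')))%R).
  { induction n as [|n IH]; intros u v Hu Hv.
    - simpl. rewrite Rdiv_1_r. apply H; assumption.
    - set (m := (u + v) / 2).
      assert (H2 : RtoC 2 <> 0) by (intros E; apply RtoC_inj in E; lra).
      assert (Hhalf : Cmod (/ 2) = (/ 2)%R).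
      { rewrite Cmod_inv by assumption. rewrite Cmod_R, Rabs_pos_eq; lra. }
      assert (E1 : Cmod (u - m) = (Cmod (u - v) / 2)%R).
      { replace (u - m) with ((u - v) * / 2) by (unfold m; field; assumption).
        rewrite Cmod_mult, Hhalf. reflexivity. }
      assert (E2 : Cmod (m - v) = (Cmod (u - v) / 2)%R).
      { replace (m - v) with ((u - v) * / 2) by (unfold m; field; assumption).
        rewrite Cmod_mult, Hhalf. reflexivity. }
      assert (Hm : (Cmod (m - w0) < d)%R).
      { replace (m - w0) with (((u - w0) + (v - w0)) * / 2) by (unfold m; field; assumption).
        rewrite Cmod_mult, Hhalf. assert (H1 := Cmod_triangle (u - w0) (v - w0)). lra. }
      assert (I1 := IH u m Hu Hm). assert (I2 := IH m v Hm Hv).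
      rewrite E1 in I1. rewrite E2 in I2.
      replace (g u - g v) with ((g u - g m) + (g m - g v)) by ring.
      apply Rle_trans with (1 := Cmod_triangle _ _).
      apply Rle_trans with (1 := Rplus_le_compat _ _ _ _ I1 I2).
      right. simpl. field. apply pow_nonzero; lra. }
  assert (H0 : g w - g w0 = 0).
  { apply Cmod_eq_0. apply Rle_antisym; [|apply Cmod_ge_0].
    apply le_epsilon. intros eps Heps. rewrite Rplus_0_l.
    destruct (halving_small (K * (Cmod (w - w0) * Cmod (w - w0))) eps Heps) as [n Hn'].
    apply Rle_trans with (K / 2 ^ n * (Cmod (w - w0) * Cmod (w - w0)))%R.
    - apply Hn; [assumption|]. rewrite Cmod_minus_diag.
      apply Rle_lt_trans with (2 := Hw). apply Cmod_ge_0.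
    - left. specialize (Hn' n (Nat.le_refl n)).
      unfold Rdiv in *. replace (K * / 2 ^ n * (Cmod (w - w0) * Cmod (w - w0)))%R
        with (K * (Cmod (w - w0) * Cmod (w - w0)) * / 2 ^ n)%R by ring. exact Hn'. }
  replace (g w) with (g w - g w0 + g w0) by ring. rewrite H0. ring.
Qed.

Section Winding.
Variable gamma : R -> C.
Hypothesis Hgamma : closed_contour gamma.

Lemma contour_locally_bounded (phi : C -> R) :
  (forall w, on_contour gamma w -> exists d M, (0 < d)%R /\
     forall z, (Cmod (z - w) < d)%R -> (phi z <= M)%R) ->
  exists M, (0 < M)%R /\ forall w, on_contour gamma w -> (phi w <= M)%R.
Proof.
  intros H. destruct Hgamma as [Hc _].
  destruct (path_locally_bounded gamma phi 0 1 Rle_0_1 Hc) as [M [HM0 HM]].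
  - intros s Hs. apply H. exists s; auto.
  - exists M. split; [assumption|]. intros w [s [Hs <-]]. apply HM; lra.
Qed.

Lemma contour_bounded :
  exists B, (0 < B)%R /\ forall w, on_contour gamma w -> (Cmod w <= B)%R.
Proof.
  apply contour_locally_bounded. intros w _. apply Cmod_locally_bounded.
Qed.

Lemma inverse_distance_locally_bounded (w0 w : C) : w <> w0 -> exists d M, (0 < d)%R /\
  forall z, (Cmod (z - w) < d)%R -> (/ Cmod (z - w0) <= M)%R.
Proof.
  intros Hne. apply Cminus_neq_0, Cmod_gt_0 in Hne.
  exists (Cmod (w - w0) / 2)%R, (/ (Cmod (w - w0) / 2))%R. split; [lra|].
  intros z Hz. apply Rinv_le_contravar; [lra|].
  assert (H := Cmod_minus_lower (w - w0) (w - z)).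
  replace (w - w0 - (w - z)) with (z - w0) in H by ring.
  rewrite Cmod_minus_sym in Hz. lra.
Qed.

Lemma contour_distance w0 : ~ on_contour gamma w0 ->
  exists d, (0 < d)%R /\ forall z, on_contour gamma z -> (d <= Cmod (z - w0))%R.
Proof.
  intros H0.
  destruct (contour_locally_bounded (fun z => / Cmod (z - w0))%R) as [M [HM0 HM]].
  - intros w Hw. apply inverse_distance_locally_bounded. intros ->; contradiction.
  - exists (/ M)%R. split; [apply Rinv_0_lt_compat; assumption|].
    intros z Hz. specialize (HM z Hz).
    assert (Hne : z - w0 <> 0) by (apply Cminus_neq_0; intros ->; contradiction).
    apply Cmod_gt_0 in Hne.
    rewrite <- (Rinv_inv (Cmod (z - w0))). apply Rinv_le_contravar; [|assumption].
    apply Rinv_0_lt_compat; assumption.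
Qed.

Lemma kernel_Cderiv (w0 z : C) : z <> w0 ->
  Cderiv (fun z => / (z - w0)) z (- / ((z - w0) * (z - w0))).
Proof.
  intros H. apply Cminus_neq_0 in H.
  replace (- / ((z - w0) * (z - w0))) with ((1 - 0) * - / ((z - w0) * (z - w0))) by ring.
  apply (Cderiv_comp Cinv (fun z => z - w0)); [apply Cderiv_inv, H|].
  apply Cderiv_minus; [apply Cderiv_id|apply Cderiv_const].
Qed.

Lemma kernel_continuous w0 : ~ on_contour gamma w0 ->
  contour_continuous gamma (fun z => / (z - w0)).
Proof.
  intros H0 z Hz. eapply Cderiv_continuous, kernel_Cderiv. intros ->; contradiction.
Qed.

(* [2 pi i] times the winding number *)
Let n (w : C) : C := contour_integral gamma (fun z => / (z - w)).

(** The first order variation of [n] at [w'] is the integral of [1 / (z - w')^2], which is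
    a derivative and integrates to zero; what remains is quadratic in [w - w']. *)
Lemma winding_locally_constant w0 : ~ on_contour gamma w0 ->
  exists d, (0 < d)%R /\ forall w, (Cmod (w - w0) < d)%R ->
    ~ on_contour gamma w /\ n w = n w0.
Proof.
  intros H0. destruct (contour_distance w0 H0) as [d [Hd Hdist]].
  destruct (contour_integral_bound gamma Hgamma) as [L [HL HLb]].
  assert (Hfar : forall w, (Cmod (w - w0) < d / 2)%R -> forall z, on_contour gamma z ->
            (d / 2 <= Cmod (z - w))%R).
  { intros w Hw z Hz. specialize (Hdist z Hz).
    assert (H := Cmod_minus_lower (z - w0) (w - w0)).
    replace (z - w0 - (w - w0)) with (z - w) in H by ring. lra. }
  assert (Hoff : forall w, (Cmod (w - w0) < d / 2)%R -> ~ on_contour gamma w).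
  { intros w Hw Hon. assert (H := Hfar w Hw w Hon).
    rewrite Cmod_minus_diag in H. lra. }
  exists (d / 2)%R. split; [lra|]. intros w Hw. split; [apply Hoff, Hw|].
  set (q := (/ (d / 2))%R). assert (Hq : (0 < q)%R) by (apply Rinv_0_lt_compat; lra).
  apply (quadratic_constant n w0 (d / 2) (L * (q * q * q))); [|assumption].
  clear w Hw. intros w w' Hw Hw'.
  assert (C1 := kernel_continuous w (Hoff w Hw)).
  assert (C2 := kernel_continuous w' (Hoff w' Hw')).
  assert (C3 : contour_continuous gamma (fun z => (w - w') * (/ (z - w') * / (z - w')))).
  { apply contour_continuous_scal. intros z Hz. apply Ccontinuous_mult; apply C2, Hz. }
  assert (Hzero : contour_integral gamma (fun z => (w - w') * (/ (z - w') * / (z - w'))) = 0).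
  { apply (contour_integral_derivative gamma Hgamma (fun z => (- (w - w')) * / (z - w'))); [assumption|].
    intros z Hz.
    assert (Hne : z <> w') by (intros ->; exact (Hoff w' Hw' Hz)).
    replace ((w - w') * (/ (z - w') * / (z - w'))) with
      (0 * / (z - w') + - (w - w') * - / ((z - w') * (z - w')))
      by (field; apply Cminus_neq_0, Hne).
    apply (Cderiv_mult (fun _ => - (w - w')) (fun z => / (z - w'))); [apply Cderiv_const|apply kernel_Cderiv, Hne]. }
  assert (E : n w - n w' = contour_integral gamma
     (fun z => (/ (z - w) + - (1) * / (z - w')) + - (1) * ((w - w') * (/ (z - w') * / (z - w'))))).
  { rewrite !contour_integral_plus; try assumption;
      auto using contour_continuous_plus, contour_continuous_scal.
    rewrite (contour_integral_scal gamma Hgamma (- (1)) _ C3), Hzero.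
    rewrite (contour_integral_scal gamma Hgamma (- (1)) _ C2).
    unfold n. ring. }
  rewrite E.
  replace (L * (q * q * q) * (Cmod (w - w') * Cmod (w - w')))%R
    with (L * (Cmod (w - w') * Cmod (w - w') * (q * q * q)))%R by ring.
  apply HLb.
  { apply contour_continuous_plus; [apply contour_continuous_plus; [exact C1|]|];
      apply contour_continuous_scal; assumption. }
  intros z Hz.
  assert (N1 : z - w <> 0) by (apply Cminus_neq_0; intros ->; exact (Hoff w Hw Hz)).
  assert (N2 : z - w' <> 0) by (apply Cminus_neq_0; intros ->; exact (Hoff w' Hw' Hz)).
  replace (/ (z - w) + - (1) * / (z - w') + - (1) * ((w - w') * (/ (z - w') * / (z - w'))))
    with ((w - w') * (w - w') * (/ (z - w) * / (z - w') * / (z - w')))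
    by (field; split; assumption).
  rewrite !Cmod_mult, !Cmod_inv by assumption.
  assert (K1 : (/ Cmod (z - w) <= q)%R) by (apply Rinv_le_contravar; [lra|apply Hfar; assumption]).
  assert (K2 : (/ Cmod (z - w') <= q)%R) by (apply Rinv_le_contravar; [lra|apply Hfar; assumption]).
  assert (P1 : (0 <= / Cmod (z - w))%R) by (left; apply Rinv_0_lt_compat, Cmod_gt_0, N1).
  assert (P2 : (0 <= / Cmod (z - w'))%R) by (left; apply Rinv_0_lt_compat, Cmod_gt_0, N2).
  apply Rmult_le_compat_l; [apply Rmult_le_pos; apply Cmod_ge_0|].
  repeat apply Rmult_le_compat; try assumption. apply Rmult_le_pos; assumption.
Qed.

Lemma winding_constant_on_path (p : R -> C) :
  continuous_on (fun x => (0 <= x)%R) p ->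
  (forall x, (0 <= x)%R -> ~ on_contour gamma (p x)) ->
  forall s, (0 <= s)%R -> n (p s) = n (p 0%R).
Proof.
  intros Hp Hoff s Hs.
  assert (H : (0 <= 0)%R -> (0 + s <= s)%R -> (0 <= s)%R -> n (p 0%R) = n (p (0 + s)%R)).
  { apply (bisection_principle_1d (fun x a => (0 <= x)%R -> (x + a <= s)%R -> (0 <= a)%R ->
      n (p x) = n (p (x + a)%R))); [assumption| |].
    - intros x a Ha H1 H2 Hx Hxa _.
      replace (x + a)%R with (x + a / 2 + a / 2)%R by field.
      rewrite H1 by lra. apply H2; lra.
    - intros u Hu. destruct (winding_locally_constant (p u)) as [d [Hd Hw]]; [apply Hoff; lra|].
      destruct (Hp u ltac:(lra) (fun z => (Cmod (z - p u) < d)%R)) as [e He].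
      { apply Clocally_eps. exists d; auto. }
      exists e. split; [apply cond_pos|]. intros x a Hxu Ha Hx Hxa Ha0.
      assert (Hloc : forall y, (0 <= y)%R -> (u - e < y < u + e)%R -> n (p y) = n (p u)).
      { intros y Hy0 Hy. apply Hw. apply He; [|assumption].
        change (Rabs (y - u) < e)%R. apply Rabs_def1; lra. }
      rewrite (Hloc x), (Hloc (x + a)%R) by lra. reflexivity. }
  rewrite Rplus_0_l in H. symmetry. apply H; lra.
Qed.

Lemma winding_decays eps : (0 < eps)%R -> exists B, (0 < B)%R /\ forall w, (B < Cmod w)%R ->
  ~ on_contour gamma w /\ (Cmod (n w) <= eps)%R.
Proof.
  intros He. destruct contour_bounded as [B [HB HBb]].
  destruct (contour_integral_bound gamma Hgamma) as [L [HL HLb]].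
  assert (Hle : (0 <= L / eps)%R).
  { apply Rmult_le_pos; [assumption|]. left. apply Rinv_0_lt_compat, He. }
  exists (B + 1 + L / eps)%R. split; [lra|]. intros w Hw.
  assert (Hoff : ~ on_contour gamma w) by (intros Hon; specialize (HBb w Hon); lra).
  split; [assumption|].
  apply Rle_trans with (L * / (1 + L / eps))%R.
  - apply HLb; [apply kernel_continuous, Hoff|].
    intros z Hz. rewrite Cmod_inv by (apply Cminus_neq_0; intros ->; contradiction).
    apply Rinv_le_contravar; [lra|].
    specialize (HBb z Hz). assert (H := Cmod_minus_lower w z). rewrite Cmod_minus_sym in H. lra.
  - apply Rmult_le_reg_r with (1 + L / eps)%R; [lra|].
    rewrite Rmult_assoc, Rinv_l, Rmult_1_r by lra.
    replace (eps * (1 + L / eps))%R with (eps + L)%R by (field; lra). lra.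
Qed.

Lemma winding_exterior w : exterior gamma w -> n w = 0.
Proof.
  intros [p [Hp0 [Hp [Hoff Hlim]]]].
  apply Cmod_eq_0. apply Rle_antisym; [|apply Cmod_ge_0].
  apply le_epsilon. intros eps He. rewrite Rplus_0_l.
  destruct (winding_decays eps He) as [B [_ HB]].
  destruct (proj2 (is_lim_spec _ _ _) Hlim B) as [M HM].
  set (s := (Rmax 0 M + 1)%R).
  assert (Hs1 := Rmax_l 0 M). assert (Hs2 := Rmax_r 0 M).
  rewrite <- Hp0, <- (winding_constant_on_path p Hp Hoff s) by (unfold s; lra).
  apply HB, HM. unfold s; lra.
Qed.

(** Along the ray from [w] away from the origin [n] is constant and tends to zero. *)
Lemma far_off_contour : exists B, (0 < B)%R /\ forall w, (B < Cmod w)%R ->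
  ~ on_contour gamma w /\ n w = 0.
Proof.
  destruct contour_bounded as [B [HB HBb]]. exists B. split; [assumption|].
  intros w Hw.
  assert (Hmod : forall s, (0 <= s)%R -> Cmod (w * RtoC (1 + s)) = (Cmod w * (1 + s))%R).
  { intros s Hs. rewrite Cmod_mult, Cmod_R, Rabs_pos_eq by lra. reflexivity. }
  assert (Hoff : forall s, (0 <= s)%R -> ~ on_contour gamma (w * RtoC (1 + s))).
  { intros s Hs Hon. specialize (HBb _ Hon). rewrite Hmod in HBb by assumption. nra. }
  assert (Hc : continuous_on (fun x => (0 <= x)%R) (fun s : R => w * RtoC (1 + s))).
  { intros s _.
    assert (Hd : RCderiv (fun s => w * RtoC (1 + s)) s w).
    { apply (@is_derive_ext R_AbsRing C_R_NormedModule (fun s => w + RtoC s * w));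
        [|apply line_RCderiv].
      intros t. change (w + RtoC t * w = w * RtoC (1 + t)). rewrite RtoC_plus. ring. }
    intros P HP. destruct (RCderiv_continuous _ s w Hd P HP) as [e He].
    exists e. intros y Hy _. exact (He y Hy). }
  replace w with (w * RtoC (1 + 0)) by (rewrite Rplus_0_r; ring).
  split; [apply Hoff; lra|].
  apply Cmod_eq_0. apply Rle_antisym; [|apply Cmod_ge_0].
  apply le_epsilon. intros eps He. rewrite Rplus_0_l.
  destruct (winding_decays eps He) as [B' [HB0 HB']].
  assert (Hs : (0 <= B' / Cmod w)%R).
  { apply Rmult_le_pos; [lra|]. left. apply Rinv_0_lt_compat. lra. }
  rewrite <- (winding_constant_on_path _ Hc Hoff (B' / Cmod w) Hs).
  apply HB'. rewrite Hmod by assumption.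
  replace (Cmod w * (1 + B' / Cmod w))%R with (Cmod w + B')%R by (field; lra). lra.
Qed.
End Winding.

(** * Cauchy integrals over segments off the contour *)
Fixpoint csum (u : nat -> C) (n : nat) : C :=
  match n with O => 0 | S n => csum u n + u n end.

Lemma csum_ext u v n : (forall i, (i < n)%nat -> u i = v i) -> csum u n = csum v n.
Proof.
  induction n as [|n IH]; intros H; simpl; [reflexivity|].
  rewrite H by lia. rewrite IH; [reflexivity|]. intros; apply H; lia.
Qed.

Lemma csum_0 (u : nat -> C) n : (forall i, (i < n)%nat -> u i = 0) -> csum u n = 0.
Proof.
  intros H. rewrite (csum_ext u (fun _ => RtoC 0)) by exact H.
  clear H. induction n as [|n IH]; simpl; [reflexivity|]. rewrite IH. ring.
Qed.

Lemma csum_plus u v n : csum (fun i => u i + v i) n = csum u n + csum v n.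
Proof. induction n as [|n IH]; simpl; [ring|]. rewrite IH. ring. Qed.

Lemma csum_swap (u : nat -> nat -> C) m n :
  csum (fun i => csum (u i) n) m = csum (fun j => csum (fun i => u i j) m) n.
Proof.
  induction m as [|m IH]; simpl.
  - symmetry. apply csum_0. reflexivity.
  - rewrite IH, <- csum_plus. reflexivity.
Qed.

Lemma csum_single (u : nat -> C) n k : (k < n)%nat ->
  (forall i, (i < n)%nat -> i <> k -> u i = 0) -> csum u n = u k.
Proof.
  induction n as [|n IH]; intros Hk H; [lia|]. simpl.
  destruct (Nat.eq_dec k n) as [->|Hne].
  - rewrite csum_0; [ring|]. intros i Hi. apply H; lia.
  - rewrite IH; [rewrite (H n) by lia; ring|lia|]. intros; apply H; lia.
Qed.

Lemma grid_cell (delta x0 r : R) n : (x0 <= r < x0 + INR n * delta)%R ->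
  exists i, (i < n)%nat /\ (x0 + INR i * delta <= r < x0 + INR (S i) * delta)%R.
Proof.
  induction n as [|n IH]; intros H; [simpl in H; lra|].
  destruct (Rlt_dec r (x0 + INR n * delta)) as [Hlt|Hge].
  - destruct IH as [i [Hi Hi']]; [lra|]. exists i. split; [lia|assumption].
  - exists n. split; [lia|lra].
Qed.

Section Cauchy.
Variables (gamma : R -> C) (f : C -> C).
Hypothesis Hgamma : closed_contour gamma.

Definition null (Phi : C -> C) : Prop :=
  contour_continuous gamma Phi /\ contour_integral gamma Phi = 0.

Lemma null_ext Phi Psi : (forall z, Phi z = Psi z) -> null Phi -> null Psi.
Proof.
  intros E [H1 H2]. split.
  - intros w Hw. apply (continuous_ext Phi); [exact E|apply H1, Hw].
  - rewrite <- H2. apply contour_integral_ext. intros; symmetry; apply E.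
Qed.

Lemma null_plus Phi Psi : null Phi -> null Psi -> null (fun z => Phi z + Psi z).
Proof.
  intros [H1 H2] [H3 H4]. split; [apply contour_continuous_plus; assumption|].
  rewrite contour_integral_plus, H2, H4 by assumption. ring.
Qed.

Lemma null_scal k Phi : null Phi -> null (fun z => k * Phi z).
Proof.
  intros [H1 H2]. split; [apply contour_continuous_scal; assumption|].
  rewrite contour_integral_scal, H2 by assumption. ring.
Qed.

Lemma null_0 : null (fun _ => 0).
Proof.
  assert (H0 : contour_continuous gamma (fun _ => 0)) by (intros w _; apply Ccontinuous_const).
  split; [assumption|].
  apply (contour_integral_derivative gamma Hgamma (fun _ => 0)); [assumption|].
  intros; apply Cderiv_const.
Qed.

Lemma null_csum (Phi : nat -> C -> C) n :
  (forall i, (i < n)%nat -> null (Phi i)) -> null (fun z => csum (fun i => Phi i z) n).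
Proof.
  induction n as [|n IH]; intros H; simpl; [apply null_0|].
  apply null_plus; [apply IH; intros; apply H; lia|apply H; lia].
Qed.

(** [chi] tells which cells of a row are kept and [e k], [e (S k)] are the contributions of
    the two edges of the cell [k].  After summation by parts an edge survives only if
    exactly one of its neighbours is kept. *)
Lemma null_summation_by_parts (chi : nat -> bool) (e : nat -> C -> C) (M : nat) :
  (chi 0%nat = true -> null (e 0%nat)) ->
  (forall k, (S k = M)%nat -> chi k = true -> null (e M)) ->
  (forall k, (S k < M)%nat -> chi k <> chi (S k) -> null (e (S k))) ->
  null (fun z => csum (fun k => if chi k then e k z - e (S k) z else 0) M).
Proof.
  intros H0 HM Hk.
  assert (Hpart : forall k, (k < M)%nat -> null (fun z =>
     csum (fun k => if chi k then e k z - e (S k) z else 0) k + (if chi k then e k z else 0))).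
  { induction k as [|k IH]; intros HkM.
    - simpl. destruct (chi 0%nat).
      + apply (null_ext (e 0%nat)); [intros; ring|auto].
      + apply (null_ext (fun _ => 0)); [intros; ring|apply null_0].
    - specialize (IH ltac:(lia)). specialize (Hk k HkM).
      assert (Hd : null (fun z => ((if chi (S k) then 1 else 0) - (if chi k then 1 else 0)) * e (S k) z)).
      { destruct (chi k), (chi (S k)).
        - apply (null_ext (fun _ => 0)); [intros; ring|apply null_0].
        - apply null_scal, Hk. discriminate.
        - apply null_scal, Hk. discriminate.
        - apply (null_ext (fun _ => 0)); [intros; ring|apply null_0]. }
      apply (null_ext _ _) with (2 := null_plus _ _ IH Hd).
      intros z. simpl. destruct (chi k), (chi (S k)); ring. }
  destruct M as [|M]; [apply null_0|].
  specialize (Hpart M ltac:(lia)). specialize (HM M eq_refl).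
  simpl. destruct (chi M).
  - apply (null_ext _ _) with (2 := null_plus _ _ Hpart (null_scal (- (1)) _ (HM eq_refl))).
    intros z. ring.
  - apply (null_ext _ _) with (2 := Hpart). intros z. reflexivity.
Qed.

Definition outside (w : C) : Prop :=
  ~ on_contour gamma w /\ contour_integral gamma (fun z => / (z - w)) = 0.

Lemma kernel_uniform w0 eps : outside w0 -> Ccontinuous f w0 -> (0 < eps)%R ->
  exists del, (0 < del)%R /\ forall w z, (Cmod (w - w0) < del)%R -> on_contour gamma z ->
    (Cmod (f w / (w - z) - f w0 / (w0 - z)) <= eps)%R.
Proof.
  intros [Hoff _] Hf He.
  destruct (contour_distance gamma Hgamma w0 Hoff) as [m [Hm Hdist]].
  set (F := Cmod (f w0)). assert (HF : (0 <= F)%R) by apply Cmod_ge_0.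
  destruct (proj1 (Ccontinuous_eps f w0) Hf (eps * m / 4)%R) as [d [Hd Hfd]].
  { apply Rdiv_lt_0_compat; [apply Rmult_lt_0_compat; assumption|lra]. }
  set (d2 := (eps * m * m / (4 * (F + 1)))%R).
  assert (Hd2 : (0 < d2)%R).
  { apply Rdiv_lt_0_compat; [repeat apply Rmult_lt_0_compat; assumption|lra]. }
  exists (Rmin d (Rmin (m / 2) d2)). split; [repeat apply Rmin_pos; lra|].
  intros w z Hw Hz.
  destruct (Rmin_Rgt_l _ _ _ Hw) as [W1 W2].
  destruct (Rmin_Rgt_l _ _ _ W2) as [W3 W4]. clear W2 Hw.
  specialize (Hfd w W1). specialize (Hdist z Hz).
  assert (Hwz : (m / 2 <= Cmod (w - z))%R).
  { assert (H := Cmod_minus_lower (z - w0) (w - w0)).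
    replace (z - w0 - (w - w0)) with (z - w) in H by ring.
    rewrite (Cmod_minus_sym w z). lra. }
  rewrite Cmod_minus_sym in Hdist.
  assert (N1 : w - z <> 0) by (apply Cmod_gt_0; lra).
  assert (N2 : w0 - z <> 0) by (apply Cmod_gt_0; lra).
  replace (f w / (w - z) - f w0 / (w0 - z)) with
    ((f w - f w0) / (w - z) + f w0 * (- (w - w0)) / ((w - z) * (w0 - z)))
    by (field; split; assumption).
  apply Rle_trans with (1 := Cmod_triangle _ _).
  rewrite !Cmod_div, !Cmod_mult, Cmod_opp by (try apply Cmult_neq_0; assumption).
  fold F. set (p := Cmod (w - z)) in *. set (q := Cmod (w0 - z)) in *.
  set (r := Cmod (w - w0)) in *. assert (Hr : (0 <= r)%R) by apply Cmod_ge_0.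
  set (g := Cmod (f w - f w0)) in *. assert (Hg : (0 <= g)%R) by apply Cmod_ge_0.
  assert (B1 : (g / p <= eps / 2)%R).
  { apply Rmult_le_reg_r with p; [lra|]. unfold Rdiv at 1. rewrite Rmult_assoc, Rinv_l by lra.
    rewrite Rmult_1_r. apply Rle_trans with (eps / 2 * (m / 2))%R; [lra|].
    apply Rmult_le_compat_l; lra. }
  assert (B2 : (F * r / (p * q) <= eps / 2)%R).
  { assert (Hpq : (m / 2 * m <= p * q)%R) by (apply Rmult_le_compat; lra).
    assert (Hpos : (0 < m / 2 * m)%R) by (apply Rmult_lt_0_compat; lra).
    apply Rmult_le_reg_r with (p * q)%R; [lra|].
    unfold Rdiv at 1. rewrite (Rmult_assoc (F * r)), Rinv_l, Rmult_1_r by lra.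
    apply Rle_trans with (eps / 2 * (m / 2 * m))%R; [|apply Rmult_le_compat_l; lra].
    apply Rle_trans with ((F + 1) * d2)%R.
    - apply Rmult_le_compat; lra.
    - right. unfold d2. field. lra. }
  lra.
Qed.

Section Edge.
Variables (o d : C) (a b : R).
Hypotheses (Hab : (a <= b)%R) (Hd : (Cmod d <= 1)%R).
Let e (s : R) : C := o + RtoC s * d.
Hypothesis Hf : forall s, (a <= s <= b)%R -> Ccontinuous f (e s).
Hypothesis Hout : forall s, (a <= s <= b)%R -> outside (e s).

Lemma edge_kernel_continuous z s : on_contour gamma z -> (a <= s <= b)%R ->
  Ccontinuous (fun w => f w / (w - z)) (e s).
Proof.
  intros Hz Hs. apply Ccontinuous_div; [apply Hf, Hs| |].
  - apply Ccontinuous_minus; [apply Ccontinuous_id|apply Ccontinuous_const].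
  - apply Cminus_neq_0. intros E. apply (Hout s Hs). rewrite E. exact Hz.
Qed.

Lemma edge_lipschitz s s' : (Cmod (e s' - e s) <= Rabs (s' - s))%R.
Proof.
  unfold e. replace (o + RtoC s' * d - (o + RtoC s * d)) with (RtoC (s' - s) * d)
    by (rewrite RtoC_minus; ring).
  rewrite Cmod_mult, Cmod_R. rewrite <- (Rmult_1_r (Rabs _)) at 2.
  apply Rmult_le_compat_l; [apply Rabs_pos|assumption].
Qed.

Lemma edge_path : continuous_on (fun s => (a <= s <= b)%R) e.
Proof.
  intros s _ P HP. destruct (RCderiv_continuous _ s d (line_RCderiv o d s) P HP) as [r Hr].
  exists r. intros y Hy _. exact (Hr y Hy).
Qed.

(** Both [f] and [1 / (w - z0)] are bounded for [w] on the segment, so the integrand is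
    Lipschitz in [z] near [z0], uniformly in [w]. *)
Lemma edge_transform_continuous :
  contour_continuous gamma (fun z => line_integral o d (fun w => f w / (w - z)) a b).
Proof.
  intros z0 Hz0.
  destruct (path_locally_bounded e (fun w => / Cmod (w - z0))%R a b Hab edge_path) as [Q [HQ0 HQ]].
  { intros s Hs. apply inverse_distance_locally_bounded. intros E. apply (Hout s Hs). rewrite E. exact Hz0. }
  destruct (path_locally_bounded e (fun w => Cmod (f w)) a b Hab edge_path) as [F [HF0 HF]].
  { intros s Hs. destruct (proj1 (Ccontinuous_eps f (e s)) (Hf s Hs) 1%R Rlt_0_1) as [r [Hr Hr']].
    exists r, (Cmod (f (e s)) + 1)%R. split; [assumption|]. intros z Hz.
    specialize (Hr' z Hz). assert (H := Cmod_minus_lower (f z) (f (e s))). lra. }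
  apply Ccontinuous_eps. intros eps He.
  set (K := ((b - a) * (F * (2 * Q * Q)) + 1)%R).
  assert (HK : (0 < K)%R).
  { unfold K. assert (0 <= (b - a) * (F * (2 * Q * Q)))%R; [|lra].
    repeat apply Rmult_le_pos; lra. }
  exists (Rmin (/ (2 * Q)) (eps / K)). split.
  { apply Rmin_pos; [apply Rinv_0_lt_compat; lra|apply Rdiv_lt_0_compat; assumption]. }
  intros z Hz.
  destruct (Rmin_Rgt_l _ _ _ Hz) as [Z1 Z2]. clear Hz.
  set (r := Cmod (z - z0)) in *. assert (Hr : (0 <= r)%R) by apply Cmod_ge_0.
  assert (Hpos0 : forall s, (a <= s <= b)%R -> (0 < Cmod (e s - z0))%R).
  { intros s Hs. apply Cmod_gt_0, Cminus_neq_0. intros E. apply (Hout s Hs). rewrite E. exact Hz0. }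
  assert (Hlow0 : forall s, (a <= s <= b)%R -> (/ Q <= Cmod (e s - z0))%R).
  { intros s Hs. rewrite <- (Rinv_inv (Cmod (e s - z0))).
    apply Rinv_le_contravar; [apply Rinv_0_lt_compat, Hpos0, Hs|apply HQ, Hs]. }
  assert (HQ2 : (/ (2 * Q) = / Q / 2)%R) by (field; lra). rewrite HQ2 in Z1.
  assert (HQi : (0 < / Q)%R) by (apply Rinv_0_lt_compat; assumption).
  assert (Hlow : forall s, (a <= s <= b)%R -> (/ Q / 2 <= Cmod (e s - z))%R).
  { intros s Hs. specialize (Hlow0 s Hs).
    assert (H := Cmod_minus_lower (e s - z0) (z - z0)).
    replace (e s - z0 - (z - z0)) with (e s - z) in H by ring. fold r in H. lra. }
  assert (Hne : forall s, (a <= s <= b)%R -> e s - z <> 0).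
  { intros s Hs. apply Cmod_gt_0. specialize (Hlow s Hs). lra. }
  assert (Hne0 : forall s, (a <= s <= b)%R -> e s - z0 <> 0).
  { intros s Hs. apply Cmod_gt_0, Hpos0, Hs. }
  assert (C0 : forall s, (a <= s <= b)%R -> Ccontinuous (fun w => f w / (w - z0)) (e s)).
  { intros s Hs. apply edge_kernel_continuous; assumption. }
  assert (C1 : forall s, (a <= s <= b)%R -> Ccontinuous (fun w => f w / (w - z)) (e s)).
  { intros s Hs. apply Ccontinuous_div; [apply Hf, Hs| |apply Hne, Hs].
    apply Ccontinuous_minus; [apply Ccontinuous_id|apply Ccontinuous_const]. }
  assert (C2 : forall s, (a <= s <= b)%R -> Ccontinuous (fun w => - (1) * (f w / (w - z0))) (e s)).
  { intros s Hs. apply Ccontinuous_mult; [apply Ccontinuous_const|apply C0, Hs]. }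
  replace (line_integral o d (fun w => f w / (w - z)) a b -
           line_integral o d (fun w => f w / (w - z0)) a b)
    with (line_integral o d (fun w => f w / (w - z) + - (1) * (f w / (w - z0))) a b).
  2:{ rewrite line_integral_plus, line_integral_scal; try assumption. ring. }
  apply Rle_lt_trans with ((b - a) * (F * (2 * Q * Q) * r))%R.
  - apply line_integral_bound; try assumption.
    + intros s Hs. apply Ccontinuous_plus; [apply C1, Hs|apply C2, Hs].
    + intros s Hs. fold (e s).
      replace (f (e s) / (e s - z) + - (1) * (f (e s) / (e s - z0)))
        with (f (e s) * (z - z0) / ((e s - z) * (e s - z0)))
        by (field; split; [apply Hne0, Hs|apply Hne, Hs]).
      rewrite Cmod_div by (apply Cmult_neq_0; [apply Hne, Hs|apply Hne0, Hs]).
      rewrite !Cmod_mult. fold r.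
      specialize (Hlow s Hs). specialize (HQ s Hs). specialize (HF s Hs). specialize (Hpos0 s Hs).
      set (p := Cmod (e s - z)) in *. set (p0 := Cmod (e s - z0)) in *.
      assert (Hp : (/ p <= 2 * Q)%R).
      { replace (2 * Q)%R with (/ (/ Q / 2))%R by (field; lra). apply Rinv_le_contravar; lra. }
      assert (Hip : (0 < / p)%R) by (apply Rinv_0_lt_compat; lra).
      assert (Hip0 : (0 < / p0)%R) by (apply Rinv_0_lt_compat; lra).
      replace (Cmod (f (e s)) * r / (p * p0))%R with (Cmod (f (e s)) * (/ p * / p0) * r)%R
        by (field; split; lra).
      apply Rmult_le_compat_r; [assumption|].
      apply Rmult_le_compat; [apply Cmod_ge_0| |assumption|].
      * apply Rmult_le_pos; lra.
      * apply Rmult_le_compat; lra.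
  - apply Rle_lt_trans with (K * r)%R.
    + unfold K. nra.
    + apply Rmult_lt_compat_l with (r := K) in Z2; [|assumption].
      replace (K * (eps / K))%R with eps in Z2 by (field; lra). exact Z2.
Qed.
End Edge.

(** Instead of exchanging two integrals: over a short piece of the segment near [w0], the
    Cauchy integral is a multiple of [1 / (w0 - z)], which integrates to zero along the
    contour, up to [eps] times the length.  Bisection adds up these estimates. *)
Lemma edge_transform_null o d a b : (a <= b)%R -> (Cmod d <= 1)%R ->
  (forall s, (a <= s <= b)%R -> Ccontinuous f (o + RtoC s * d)) ->
  (forall s, (a <= s <= b)%R -> outside (o + RtoC s * d)) ->
  null (fun z => line_integral o d (fun w => f w / (w - z)) a b).
Proof.
  intros Hab Hd Hf Hout. split; [apply edge_transform_continuous; assumption|].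
  set (T := fun x y z => line_integral o d (fun w => f w / (w - z)) x y).
  assert (HT : forall x y, (a <= x)%R -> (x <= y)%R -> (y <= b)%R -> contour_continuous gamma (T x y)).
  { intros x y Hx Hxy Hy. apply edge_transform_continuous; try assumption;
    intros s Hs; [apply Hf|apply Hout]; lra. }
  destruct (contour_integral_bound gamma Hgamma) as [L [HL HLb]].
  apply Cmod_eq_0. apply Rle_antisym; [|apply Cmod_ge_0].
  apply le_epsilon. intros eps0 Heps0. rewrite Rplus_0_l.
  set (eps := (eps0 / (b - a + 1))%R).
  assert (Heps : (0 < eps)%R) by (apply Rdiv_lt_0_compat; lra).
  assert (Hmain : (a <= a)%R -> (0 <= b - a)%R -> (a + (b - a) <= b)%R ->
     (Cmod (contour_integral gamma (T a (a + (b - a))%R)) <= eps * (b - a))%R).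
  { apply (bisection_principle_1d (fun x h => (a <= x)%R -> (0 <= h)%R -> (x + h <= b)%R ->
     (Cmod (contour_integral gamma (T x (x + h)%R)) <= eps * h)%R)); [lra| |].
    - intros x h Hh P1 P2 Hx _ Hxh.
      specialize (P1 ltac:(lra) ltac:(lra) ltac:(lra)).
      specialize (P2 ltac:(lra) ltac:(lra) ltac:(lra)).
      replace (x + h / 2 + h / 2)%R with (x + h)%R in P2 by field.
      rewrite (contour_integral_ext gamma (T x (x + h)%R)
        (fun z => T x (x + h / 2)%R z + T (x + h / 2)%R (x + h)%R z)).
      2:{ intros z Hz. apply line_integral_Chasles; try lra.
          intros s Hs. apply edge_kernel_continuous with (a := a) (b := b); try assumption. lra. }
      rewrite contour_integral_plus by (try assumption; apply HT; lra).
      apply Rle_trans with (1 := Cmod_triangle _ _). lra.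
    - intros u Hu. set (w0 := o + RtoC u * d).
      assert (Hw0 : outside w0) by (apply Hout; lra).
      assert (He' : (0 < eps / (L + 1))%R) by (apply Rdiv_lt_0_compat; lra).
      destruct (kernel_uniform w0 (eps / (L + 1)) Hw0 (Hf u ltac:(lra)) He') as [del [Hdel Hk]].
      exists del. split; [assumption|]. intros x h Hxu Hh Hx Hh0 Hxh.
      set (q := line_integral o d (fun _ => 1) x (x + h)).
      set (c := fun z => (- (f w0 * q)) * / (z - w0)).
      assert (Hc : null c).
      { apply null_scal. split; [apply kernel_continuous; try assumption; apply Hw0|apply Hw0]. }
      destruct Hc as [Hcc Hc0].
      replace (contour_integral gamma (T x (x + h)%R))
        with (contour_integral gamma (fun z => T x (x + h)%R z - c z)).
      2:{ rewrite contour_integral_minus, Hc0 by (try assumption; apply HT; lra). ring. }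
      apply Rle_trans with (L * (h * (eps / (L + 1))))%R.
      + apply HLb.
        * intros z Hz. apply Ccontinuous_minus; [apply HT; try lra; exact Hz|apply Hcc, Hz].
        * intros z Hz.
          assert (C1 : forall s, (x <= s <= x + h)%R ->
             Ccontinuous (fun w => f w / (w - z)) (o + RtoC s * d)).
          { intros s Hs. apply edge_kernel_continuous with (a := a) (b := b); try assumption. lra. }
          assert (Hzw : z - w0 <> 0) by (apply Cminus_neq_0; intros ->; apply Hw0; exact Hz).
          assert (Hwz : w0 - z <> 0) by (apply Cminus_neq_0; intros E; apply Hw0; rewrite E; exact Hz).
          replace (T x (x + h)%R z - c z) with
            (line_integral o d (fun w => f w / (w - z) + (- (f w0 / (w0 - z))) * 1) x (x + h)).
          2:{ rewrite line_integral_plus, line_integral_scal; try lra; try exact C1.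
              - unfold T, c. fold q. field. split; assumption.
              - intros s _. apply Ccontinuous_const.
              - intros s _. apply Ccontinuous_const. }
          replace (h * (eps / (L + 1)))%R with ((x + h - x) * (eps / (L + 1)))%R by ring.
          apply line_integral_bound; try lra.
          -- intros s Hs. apply Ccontinuous_plus; [apply C1, Hs|apply Ccontinuous_const].
          -- intros s Hs. rewrite Cmult_1_r. apply Hk; [|assumption].
             apply Rle_lt_trans with (1 := edge_lipschitz o d Hd u s).
             apply Rabs_def1; lra.
      + assert (HLe : (L * (eps / (L + 1)) <= eps)%R).
        { apply Rmult_le_reg_r with (L + 1)%R; [lra|].
          replace (L * (eps / (L + 1)) * (L + 1))%R with (L * eps)%R by (field; lra). nra. }
        replace (L * (h * (eps / (L + 1))))%R with (L * (eps / (L + 1)) * h)%R by ring.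
        apply Rmult_le_compat_r; lra. }
  specialize (Hmain ltac:(lra) ltac:(lra) ltac:(lra)).
  replace (a + (b - a))%R with b in Hmain by ring.
  apply Rle_trans with (1 := Hmain).
  apply Rle_trans with (eps * (b - a + 1))%R; [apply Rmult_le_compat_l; lra|].
  right. unfold eps. field. lra.
Qed.

End Cauchy.

Local Notation disc_in w r P := (forall z : C, (Cmod (z - w) < r)%R -> P z).

(** * Cauchy's theorem *)
Lemma lebesgue_number (P Q : C -> Prop) x0 x1 y0 y1 : (x0 <= x1)%R -> (y0 <= y1)%R ->
  (forall w, exists r, (0 < r)%R /\
     ((disc_in w r P) \/ (disc_in w r Q))) ->
  exists r, (0 < r)%R /\ forall w, in_rectangle x0 x1 y0 y1 w ->
     (disc_in w r P) \/ (disc_in w r Q).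
Proof.
  intros Hx Hy H.
  assert (Hmain : exists r, (0 < r)%R /\ forall w,
     in_rectangle x0 (x0 + (x1 - x0)) y0 (y0 + (y1 - y0)) w ->
     (disc_in w r P) \/ (disc_in w r Q)).
  { apply (bisection_principle (fun x a y b => exists r, (0 < r)%R /\ forall w,
     in_rectangle x (x + a) y (y + b) w ->
     (disc_in w r P) \/ (disc_in w r Q)));
     [lra|lra| |].
    - intros x a y b Ha Hb [r1 [P1 H1]] [r2 [P2 H2]] [r3 [P3 H3]] [r4 [P4 H4]].
      set (r := Rmin (Rmin r1 r2) (Rmin r3 r4)).
      assert (Hr : (0 < r)%R) by (repeat apply Rmin_pos; assumption).
      assert (R12 : (r <= Rmin r1 r2)%R) by apply Rmin_l.
      assert (R34 : (r <= Rmin r3 r4)%R) by apply Rmin_r.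
      assert (R1 := Rle_trans _ _ _ R12 (Rmin_l _ _)). assert (R2 := Rle_trans _ _ _ R12 (Rmin_r _ _)).
      assert (R3 := Rle_trans _ _ _ R34 (Rmin_l _ _)). assert (R4 := Rle_trans _ _ _ R34 (Rmin_r _ _)).
      assert (Hweak : forall r' w, (r <= r')%R ->
        (disc_in w r' P) \/ (disc_in w r' Q) ->
        (disc_in w r P) \/ (disc_in w r Q)).
      { intros r' w Hr' [A|A]; [left|right]; intros z Hz; apply A; lra. }
      exists r. split; [assumption|]. intros w [Hw1 Hw2].
      destruct (Rle_dec (Re w) (x + a / 2)); destruct (Rle_dec (Im w) (y + b / 2)).
      + apply (Hweak r1 w R1), H1. split; lra.
      + apply (Hweak r3 w R3), H3. split; lra.
      + apply (Hweak r2 w R2), H2. split; lra.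
      + apply (Hweak r4 w R4), H4. split; lra.
    - intros u v _ _. destruct (H (u, v)) as [r [Hr Hpq]].
      exists (r / 4)%R. split; [lra|]. intros x a y b Hu Hv Ha Hb.
      exists (r / 4)%R. split; [lra|]. intros w [Hw1 Hw2].
      assert (Hd : (Cmod (w - (u, v)) < r / 2)%R).
      { apply Rle_lt_trans with (1 := Cmod_le_abs_sum _).
        destruct w as [w1 w2]. simpl in Hw1, Hw2 |- *.
        assert (Rabs (w1 + - u) < r / 4)%R by (apply Rabs_def1; lra).
        assert (Rabs (w2 + - v) < r / 4)%R by (apply Rabs_def1; lra). lra. }
      assert (Hz : forall z, (Cmod (z - w) < r / 4)%R -> (Cmod (z - (u, v)) < r)%R).
      { intros z Hz. replace (z - (u, v)) with ((z - w) + (w - (u, v))) by ring.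
        apply Rle_lt_trans with (1 := Cmod_triangle _ _). lra. }
      destruct Hpq as [A|A]; [left|right]; intros z Hz'; apply A, Hz, Hz'. }
  replace (x0 + (x1 - x0))%R with x1 in Hmain by ring.
  replace (y0 + (y1 - y0))%R with y1 in Hmain by ring. exact Hmain.
Qed.

(** Points of the contour may lie on the grid lines; moving them along the diagonal
    brings them into the interior of a cell. *)
Lemma Ccontinuous_eq_limit (g h : C -> C) (z : C) (r : R) :
  (0 < r)%R -> Ccontinuous g z -> Ccontinuous h z ->
  (forall s, (0 < s < r)%R -> g (z + (s, s)) = h (z + (s, s))) -> g z = h z.
Proof.
  intros Hr Hg Hh H.
  assert (H0 : g z - h z = 0).
  { apply Cmod_eq_0. apply Rle_antisym; [|apply Cmod_ge_0].
    apply le_epsilon. intros eps He. rewrite Rplus_0_l.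
    destruct (proj1 (Ccontinuous_eps g z) Hg (eps / 2)%R) as [d1 [D1 G]]; [lra|].
    destruct (proj1 (Ccontinuous_eps h z) Hh (eps / 2)%R) as [d2 [D2 G']]; [lra|].
    set (s := (Rmin r (Rmin d1 d2) / 3)%R).
    assert (Hm : (0 < Rmin r (Rmin d1 d2))%R) by (repeat apply Rmin_pos; assumption).
    assert (M1 := Rmin_l r (Rmin d1 d2)). assert (M2 := Rmin_r r (Rmin d1 d2)).
    assert (M3 := Rle_trans _ _ _ M2 (Rmin_l _ _)). assert (M4 := Rle_trans _ _ _ M2 (Rmin_r _ _)).
    assert (Hs : (0 < s)%R) by (unfold s; lra).
    assert (Hd : (Cmod (z + (s, s) - z) <= 2 * s)%R).
    { assert (E : forall u v : C, u + v - u = v) by (intros; ring). rewrite E.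
      apply Rle_trans with (1 := Cmod_le_abs_sum _). simpl. rewrite Rabs_pos_eq by lra. lra. }
    specialize (G (z + (s, s)) ltac:(unfold s in *; lra)).
    specialize (G' (z + (s, s)) ltac:(unfold s in *; lra)).
    rewrite (H s) in G by (unfold s in *; lra).
    replace (g z - h z) with (- (h (z + (s, s)) - g z) + (h (z + (s, s)) - h z)) by ring.
    apply Rle_trans with (1 := Cmod_triangle _ _). rewrite Cmod_opp. lra. }
  replace (g z) with (g z - h z + h z) by ring. rewrite H0. ring.
Qed.

Lemma outside_open (gamma : R -> C) : closed_contour gamma -> forall w, outside gamma w ->
  exists r, (0 < r)%R /\ disc_in w r (outside gamma).
Proof.
  intros Hg w [H1 H2]. destruct (winding_locally_constant gamma Hg w H1) as [d [Hd H]].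
  exists d. split; [assumption|]. intros z Hz. destruct (H z Hz) as [A B].
  split; [assumption|]. rewrite B. exact H2.
Qed.

Lemma exterior_outside (gamma : R -> C) : closed_contour gamma -> forall w,
  exterior gamma w -> outside gamma w.
Proof.
  intros Hg w Hw. split; [|apply winding_exterior; assumption].
  destruct Hw as [p [<- [_ [Hp _]]]]. apply Hp. lra.
Qed.

Section CauchyTheorem.
Variables (gamma : R -> C) (D : C -> Prop) (f : C -> C).
Hypothesis Hgamma : closed_contour gamma.
Hypothesis HD : forall w, D w -> exists r, (0 < r)%R /\ disc_in w r D.
Hypothesis Hext : forall w, ~ D w -> outside gamma w.
Hypothesis Hf : holomorphic_on D f.

(** The square [-B, B]^2 is cut into [M]^2 cells of side [delta], small compared with the
    Lebesgue number [r] of the cover by [D] and the outside points. *)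
Section Grid.
Variables (B : R) (M : nat) (r : R).
Hypothesis HB : (0 < B)%R.
Hypothesis HM : (0 < M)%nat.
Let delta : R := (2 * B / INR M)%R.
Let x (i : nat) : R := (- B + INR i * delta)%R.
Let cell (i j : nat) : C -> Prop := in_rectangle (x i) (x (S i)) (x j) (x (S j)).
Hypothesis Hfar : forall w, (B <= Cmod w)%R -> outside gamma w.
Hypothesis Hr : (2 * delta < r)%R.
Hypothesis Hleb : forall w, in_rectangle (- B) B (- B) B w ->
     (disc_in w r D) \/
     (disc_in w r (outside gamma)).

Let met (i j : nat) : bool :=
  if excluded_middle_informative (exists w, cell i j w /\ ~ outside gamma w)
  then true else false.

Lemma delta_pos : (0 < delta)%R.
Proof. apply Rdiv_lt_0_compat; [lra|]. apply lt_0_INR, HM. Qed.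

Lemma grid_S i : x (S i) = (x i + delta)%R.
Proof. unfold x. rewrite S_INR. ring. Qed.

Lemma grid_le i j : (i <= j)%nat -> (x i <= x j)%R.
Proof.
  intros H. apply le_INR in H. unfold x.
  assert (Hd := delta_pos). apply Rplus_le_compat_l, Rmult_le_compat_r; lra.
Qed.

Lemma grid_0 : x 0 = (- B)%R.
Proof. unfold x. simpl. ring. Qed.

Lemma grid_M : x M = B.
Proof. unfold x, delta. field. apply not_0_INR. lia. Qed.

Lemma cell_in_box i j w : (i < M)%nat -> (j < M)%nat -> cell i j w -> in_rectangle (- B) B (- B) B w.
Proof.
  intros Hi Hj [[H1 H2] [H3 H4]].
  assert (A1 := grid_le 0 i ltac:(lia)). assert (A2 := grid_le 0 j ltac:(lia)).
  assert (A3 := grid_le (S i) M ltac:(lia)). assert (A4 := grid_le (S j) M ltac:(lia)).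
  rewrite grid_0 in A1, A2. rewrite grid_M in A3, A4. split; lra.
Qed.

Lemma met_in_D i j : (i < M)%nat -> (j < M)%nat -> met i j = true -> forall w, cell i j w -> D w.
Proof.
  intros Hi Hj Hm. unfold met in Hm.
  destruct excluded_middle_informative as [[w0 [Hw0 Ho]]|]; [|discriminate].
  intros w Hw. destruct (Hleb w0) as [H|H].
  - apply (cell_in_box i j); assumption.
  - apply H. destruct w as [w1 w2], w0 as [v1 v2].
    destruct Hw as [Hw1 Hw2], Hw0 as [Hv1 Hv2]. simpl in *.
    rewrite grid_S in Hw1, Hw2, Hv1, Hv2.
    apply Rle_lt_trans with (1 := Cmod_le_abs_sum _). simpl.
    assert (Rabs (w1 + - v1) <= delta)%R by (apply Rabs_le; lra).
    assert (Rabs (w2 + - v2) <= delta)%R by (apply Rabs_le; lra). lra.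
  - exfalso. apply Ho, H. rewrite Cmod_minus_diag.
    assert (Hd := delta_pos). lra.
Qed.

Lemma not_met_outside i j : met i j = false -> forall w, cell i j w -> outside gamma w.
Proof.
  intros Hm w Hw. unfold met in Hm.
  destruct excluded_middle_informative as [|H]; [discriminate|].
  apply NNPP. intros Hn. apply H. exists w. tauto.
Qed.

Lemma boundary_outside w : Re w = (- B)%R \/ Re w = B \/ Im w = (- B)%R \/ Im w = B -> outside gamma w.
Proof.
  intros H. apply Hfar. 
  assert (A1 := re_le_Cmod w). assert (A2 := im_le_Cmod w).
  destruct H as [E|[E|[E|E]]]; rewrite E in *; rewrite ?Rabs_Ropp, ?(Rabs_pos_eq B) in * by lra; lra.
Qed.

Let h (i j : nat) (z : C) : C := line_integral (0%R, x j) 1 (fun w => f w / (w - z)) (x i) (x (S i)).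
Let v (i j : nat) (z : C) : C := line_integral (x i, 0%R) Ci (fun w => f w / (w - z)) (x j) (x (S j)).

Lemma h_null i j : (forall w, (x i <= Re w <= x (S i))%R -> Im w = x j -> D w /\ outside gamma w) ->
  null gamma (h i j).
Proof.
  intros H. apply edge_transform_null; try assumption.
  - apply grid_le; lia.
  - rewrite Cmod_1; lra.
  - intros s Hs. rewrite hline_point. apply ex_Cderiv_continuous, Hf, H; simpl; auto.
  - intros s Hs. rewrite hline_point. apply H; simpl; auto.
Qed.

Lemma v_null i j : (forall w, (x j <= Im w <= x (S j))%R -> Re w = x i -> D w /\ outside gamma w) ->
  null gamma (v i j).
Proof.
  intros H. apply edge_transform_null; try assumption.
  - apply grid_le; lia.
  - rewrite Cmod_Ci; lra.
  - intros s Hs. rewrite vline_point. apply ex_Cderiv_continuous, Hf, H; simpl; auto.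
  - intros s Hs. rewrite vline_point. apply H; simpl; auto.
Qed.

Lemma boundary_edge i j w : (i < M)%nat -> (j < M)%nat -> met i j = true -> cell i j w ->
  Re w = (- B)%R \/ Re w = B \/ Im w = (- B)%R \/ Im w = B -> D w /\ outside gamma w.
Proof.
  intros Hi Hj Hm Hw Hb. split; [apply (met_in_D i j); assumption|apply boundary_outside, Hb].
Qed.

Lemma shared_edge i j k l w : (i < M)%nat -> (j < M)%nat -> (k < M)%nat -> (l < M)%nat ->
  cell i j w -> cell k l w -> met i j <> met k l -> D w /\ outside gamma w.
Proof.
  intros Hi Hj Hk Hl H1 H2 Hm.
  destruct (met i j) eqn:E1, (met k l) eqn:E2; try (exfalso; apply Hm; reflexivity).
  - split; [apply (met_in_D i j)|apply (not_met_outside k l)]; assumption.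
  - split; [apply (met_in_D k l)|apply (not_met_outside i j)]; assumption.
Qed.

Lemma h_sum_null i : (i < M)%nat ->
  null gamma (fun z => csum (fun j => if met i j then h i j z - h i (S j) z else 0) M).
Proof.
  intros Hi. assert (Hd := delta_pos). apply null_summation_by_parts; [assumption| | |].
  - intros Hm. apply h_null. intros w H1 H2. apply (boundary_edge i 0); try assumption.
    + split; [assumption|]. rewrite H2, grid_S. lra.
    + rewrite H2, grid_0. auto.
  - intros j HjM Hm. apply h_null. intros w H1 H2. apply (boundary_edge i j); try assumption; [lia| |].
    + split; [assumption|]. rewrite H2, <- HjM, grid_S. lra.
    + rewrite H2, grid_M. auto.
  - intros j HjM Hm. apply h_null. intros w H1 H2.
    apply (shared_edge i j i (S j)); try assumption; try lia; (split; [assumption|]);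
      rewrite H2, ?(grid_S (S j)), grid_S; lra.
Qed.

Lemma v_sum_null j : (j < M)%nat ->
  null gamma (fun z => csum (fun i => if met i j then v i j z - v (S i) j z else 0) M).
Proof.
  intros Hj. assert (Hd := delta_pos).
  apply (null_summation_by_parts gamma Hgamma (fun i => met i j) (fun i => v i j)).
  - intros Hm. apply v_null. intros w H1 H2. apply (boundary_edge 0 j); try assumption.
    + split; [|assumption]. rewrite H2, grid_S. lra.
    + rewrite H2, grid_0. auto.
  - intros i HiM Hm. apply v_null. intros w H1 H2. apply (boundary_edge i j); try assumption; [lia| |].
    + split; [|assumption]. rewrite H2, <- HiM, grid_S. lra.
    + rewrite H2, grid_M. auto.
  - intros i HiM Hm. apply v_null. intros w H1 H2.
    apply (shared_edge i j (S i) j); try assumption; try lia; (split; [|assumption]);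
      rewrite H2, ?(grid_S (S i)), grid_S; lra.
Qed.

Let total (z : C) : C :=
  csum (fun i => csum (fun j => if met i j then
    rectangle_integral (fun w => f w / (w - z)) (x i) (x (S i)) (x j) (x (S j)) else 0) M) M.

Lemma total_null : null gamma total.
Proof.
  apply (null_ext gamma (fun z =>
    csum (fun i => csum (fun j => if met i j then h i j z - h i (S j) z else 0) M) M +
    - (1) * csum (fun j => csum (fun i => if met i j then v i j z - v (S i) j z else 0) M) M)).
  2:{ apply null_plus; try assumption; [|apply null_scal; try assumption].
      - apply (null_csum gamma Hgamma (fun i z => csum (fun j => if met i j then h i j z - h i (S j) z else 0) M)).
        intros; apply h_sum_null; assumption.
      - apply (null_csum gamma Hgamma (fun j z => csum (fun i => if met i j then v i j z - v (S i) j z else 0) M)).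
        intros; apply v_sum_null; assumption. }
  intros z.
  assert (Hscal : forall u n, - (1) * csum u n = csum (fun i => - (1) * u i) n).
  { intros u n; induction n as [|n IH]; simpl; [ring|]. rewrite <- IH. ring. }
  rewrite csum_swap with (u := fun j i => if met i j then v i j z - v (S i) j z else 0).
  rewrite Hscal, <- csum_plus. apply csum_ext. intros i Hi.
  rewrite Hscal, <- csum_plus. apply csum_ext. intros j Hj.
  destruct (met i j); [|ring]. unfold rectangle_integral, h, v. ring.
Qed.

Lemma total_value i j z : (i < M)%nat -> (j < M)%nat -> met i j = true ->
  (x i < Re z < x (S i))%R -> (x j < Im z < x (S j))%R -> total z = 2 * PI * Ci * f z.
Proof.
  intros Hi Hj Hm H1 H2. unfold total.
  assert (Hoff : forall k l, (k < M)%nat -> (l < M)%nat -> (k <> i \/ l <> j) ->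
     (if met k l then
    rectangle_integral (fun w => f w / (w - z)) (x k) (x (S k)) (x l) (x (S l)) else 0) = 0).
  { intros k l Hk Hl Hne. destruct (met k l) eqn:E; [|reflexivity].
    apply goursat; [apply grid_le; lia|apply grid_le; lia|].
    intros w Hw. apply Cdiff_kernel; [apply Hf, (met_in_D k l); assumption|].
    intros ->. destruct Hw as [Hw1 Hw2].
    assert (Hcol : forall a b (t : R), (x a < t < x (S a))%R -> (x b <= t <= x (S b))%R -> b = a).
    { intros a b t Ha Hb. destruct (Nat.lt_trichotomy a b) as [Hab|[->|Hab]]; [|reflexivity|].
      - assert (A := grid_le (S a) b Hab). lra.
      - assert (A := grid_le (S b) a Hab). lra. }
    destruct Hne as [Hne|Hne]; apply Hne; eapply Hcol; eassumption. }
  rewrite (csum_single _ M i Hi).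
  - rewrite (csum_single _ M j Hj).
    + rewrite Hm. apply cauchy_formula_rectangle; try assumption.
      intros w Hw. apply Hf, (met_in_D i j); assumption.
    + intros l Hl Hne. apply Hoff; auto.
  - intros k Hk Hne. apply csum_0. intros l Hl. apply Hoff; auto.
Qed.

(** Both sides are continuous at [z] and agree at the points [z + (s, s)] for small
    positive [s], which lie inside the cell that has [z] in it or on its lower or left
    side. *)
Lemma total_on_contour z : on_contour gamma z -> total z = 2 * PI * Ci * f z.
Proof.
  intros Hz.
  assert (Hn : ~ outside gamma z) by (intros [H _]; contradiction).
  assert (HDz : D z) by (apply NNPP; intros H; apply Hn, Hext, H).
  assert (Hlt : (Cmod z < B)%R) by (apply Rnot_le_lt; intros H; apply Hn, Hfar, H).
  assert (A1 := Rle_lt_trans _ _ _ (re_le_Cmod z) Hlt).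
  assert (A2 := Rle_lt_trans _ _ _ (im_le_Cmod z) Hlt).
  apply Rabs_def2 in A1. apply Rabs_def2 in A2.
  assert (HMB : (- B + INR M * delta = B)%R) by exact grid_M.
  destruct (grid_cell delta (- B) (Re z) M) as [i [Hi Ii]]; [lra|].
  destruct (grid_cell delta (- B) (Im z) M) as [j [Hj Ij]]; [lra|].
  fold (x i) (x (S i)) in Ii. fold (x j) (x (S j)) in Ij.
  assert (Hm : met i j = true).
  { unfold met. destruct excluded_middle_informative as [|H]; [reflexivity|].
    exfalso. apply H. exists z. split; [split; lra|assumption]. }
  apply (Ccontinuous_eq_limit total (fun z => 2 * PI * Ci * f z) z
    (Rmin (x (S i) - Re z) (x (S j) - Im z))).
  - apply Rmin_pos; lra.
  - apply total_null, Hz.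
  - apply Ccontinuous_mult; [apply Ccontinuous_const|]. apply ex_Cderiv_continuous, Hf, HDz.
  - intros s [Hs Hs'].
    assert (S1 := Rlt_le_trans _ _ _ Hs' (Rmin_l _ _)).
    assert (S2 := Rlt_le_trans _ _ _ Hs' (Rmin_r _ _)).
    apply (total_value i j); try assumption; destruct z as [z1 z2]; simpl in *; lra.
Qed.

Lemma grid_conclusion : contour_integral gamma f = 0.
Proof.
  destruct total_null as [_ H0].
  assert (Hc : contour_continuous gamma f).
  { intros w Hw. apply ex_Cderiv_continuous, Hf. apply NNPP. intros H.
    destruct (Hext w H). contradiction. }
  rewrite (contour_integral_ext gamma total (fun z => 2 * PI * Ci * f z)) in H0
    by (intros; apply total_on_contour; assumption).
  rewrite contour_integral_scal in H0 by assumption.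
  transitivity (2 * PI * Ci * contour_integral gamma f * / (2 * PI * Ci)).
  - rewrite Cmult_comm, Cmult_assoc, Cinv_l, Cmult_1_l by exact two_pi_i_neq_0. reflexivity.
  - rewrite H0. ring.
Qed.
End Grid.

(** [total] is both null and equal to [2 pi i f] on the contour. *)
Theorem cauchy_theorem : contour_integral gamma f = 0.
Proof.
  destruct (far_off_contour gamma Hgamma) as [B0 [HB0 Hfar0]].
  set (B := (B0 + 1)%R).
  destruct (lebesgue_number D (outside gamma) (- B) B (- B) B) as [r [Hr Hleb]];
    [unfold B; lra|unfold B; lra| |].
  { intros w. destruct (excluded_middle_informative (D w)) as [Hw|Hw].
    - destruct (HD w Hw) as [r [Hr H]]. exists r. auto.
    - destruct (outside_open gamma Hgamma w (Hext w Hw)) as [r [Hr H]]. exists r. auto. }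
  destruct (INR_unbounded (4 * B / r)) as [M HM].
  assert (HB : (0 < B)%R) by (unfold B; lra).
  assert (Hq : (0 < 4 * B / r)%R) by (apply Rdiv_lt_0_compat; lra).
  assert (HM0 : (0 < INR M)%R) by lra.
  apply (grid_conclusion B M r); try assumption.
  - apply INR_lt. simpl. lra.
  - intros w Hw. apply Hfar0. unfold B in Hw. lra.
  - apply Rmult_lt_compat_r with (r := r) in HM; [|assumption].
    replace (4 * B / r * r)%R with (4 * B)%R in HM by (field; lra).
    apply Rmult_lt_reg_r with (INR M); [lra|].
    replace (2 * (2 * B / INR M) * INR M)%R with (4 * B)%R by (field; lra). lra.
Qed.
End CauchyTheorem.

(** * Exponential, logarithm and powers *)
Lemma Cexp_plus z w : Cexp (z + w) = Cexp z * Cexp w.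
Proof.
  destruct z as [a b], w as [c d]. unfold Cexp, Cplus, Cmult; simpl.
  rewrite exp_plus, cos_plus, sin_plus. f_equal; ring.
Qed.

Lemma Cexp_0 : Cexp 0 = 1.
Proof. unfold Cexp, RtoC; simpl. rewrite exp_0, cos_0, sin_0. f_equal; ring. Qed.

Lemma Cexp_opp z : Cexp z * Cexp (- z) = 1.
Proof. rewrite <- Cexp_plus, <- Cexp_0. f_equal. ring. Qed.

Lemma Cexp_neq_0 z : Cexp z <> 0.
Proof.
  intros E. assert (H := Cexp_opp z). rewrite E, Cmult_0_l in H.
  symmetry in H. apply RtoC_inj in H. lra.
Qed.

Lemma derivable_pt_lim_bound f x l : derivable_pt_lim f x l ->
  forall eps, (0 < eps)%R -> exists del, (0 < del)%R /\ forall h, (Rabs h < del)%R ->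
    (Rabs (f (x + h) - f x - l * h) <= eps * Rabs h)%R.
Proof.
  intros H eps He. destruct (H eps He) as [del Hd].
  exists del. split; [apply cond_pos|]. intros h Hh.
  destruct (Req_dec h 0) as [->|Hne].
  - rewrite Rplus_0_r, Rmult_0_r, !Rminus_diag, Rabs_R0. lra.
  - specialize (Hd h Hne Hh).
    replace (f (x + h) - f x - l * h)%R with (((f (x + h) - f x) / h - l) * h)%R by (field; assumption).
    rewrite Rabs_mult. apply Rmult_le_compat_r; [apply Rabs_pos|lra].
Qed.

Lemma Cexp_Cderiv_0 : Cderiv Cexp (RtoC 0) (RtoC 1).
Proof.
  apply Cderiv_eps. intros eps0 He0.
  set (eps := Rmin 1 (eps0 / 9)).
  assert (He : (0 < eps)%R) by (apply Rmin_pos; lra).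
  assert (He1 : (eps <= 1)%R) by apply Rmin_l.
  assert (He9 : (9 * eps <= eps0)%R) by (assert (H := Rmin_r 1 (eps0 / 9)); unfold eps; lra).
  destruct (derivable_pt_lim_bound exp 0 _ (derivable_pt_lim_exp 0) eps He) as [d1 [D1 H1]].
  destruct (derivable_pt_lim_bound cos 0 _ (derivable_pt_lim_cos 0) eps He) as [d2 [D2 H2]].
  destruct (derivable_pt_lim_bound sin 0 _ (derivable_pt_lim_sin 0) eps He) as [d3 [D3 H3]].
  exists (Rmin eps (Rmin d1 (Rmin d2 d3))). split; [repeat first [assumption|apply Rmin_pos]|].
  intros z Hz. replace (z - 0) with z in * by ring.
  destruct (Rmin_Rgt_l _ _ _ Hz) as [M0 M1].
  assert (M2 := Rlt_le_trans _ _ _ M1 (Rmin_r _ _)).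
  assert (B1 := Rlt_le_trans _ _ _ M1 (Rmin_l _ _)).
  destruct (Rmin_Rgt_l _ _ _ M2) as [B2 B3].
  rewrite Cexp_0.
  assert (Rz := re_le_Cmod z). assert (Iz := im_le_Cmod z).
  destruct z as [x y]. simpl in Rz, Iz. set (r := Cmod (x, y)) in *.
  specialize (H1 x ltac:(lra)). specialize (H2 y ltac:(lra)). specialize (H3 y ltac:(lra)).
  rewrite !Rplus_0_l, exp_0 in H1. rewrite !Rplus_0_l, cos_0, sin_0 in H2.
  rewrite !Rplus_0_l, sin_0, cos_0 in H3.
  replace (cos y - 1 - - 0 * y)%R with (cos y - 1)%R in H2 by ring.
  replace (sin y - 0 - 1 * y)%R with (sin y - y)%R in H3 by ring.
  rewrite Rmult_1_l in H1.
  assert (X0 := Rabs_pos x). assert (Y0 := Rabs_pos y).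
  assert (Hexp : (Rabs (exp x - 1) <= 2 * Rabs x)%R).
  { replace (exp x - 1)%R with ((exp x - 1 - x) + x)%R by ring.
    apply Rle_trans with (1 := Rabs_triang _ _). nra. }
  assert (Hexp3 : (0 <= exp x <= 3)%R).
  { split; [left; apply exp_pos|]. assert (A := Rle_abs (exp x - 1)). lra. }
  apply Rle_trans with (1 := Cmod_le_abs_sum _).
  unfold Cexp, Cminus, Cplus, Copp, Cmult, RtoC; simpl.
  match goal with |- (Rabs ?A + Rabs ?B <= _)%R =>
    replace A with ((exp x - 1 - x) + exp x * (cos y - 1))%R by ring;
    replace B with (exp x * (sin y - y) + (exp x - 1) * y)%R by ring end.
  assert (E1 := Rabs_triang (exp x - 1 - x) (exp x * (cos y - 1))).
  assert (E2 := Rabs_triang (exp x * (sin y - y)) ((exp x - 1) * y)).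
  rewrite Rabs_mult, (Rabs_pos_eq (exp x)) in E1 by lra.
  rewrite !Rabs_mult, (Rabs_pos_eq (exp x)) in E2 by lra.
  assert (F1 : (exp x * Rabs (cos y - 1) <= 3 * (eps * r))%R).
  { apply Rmult_le_compat; [lra|apply Rabs_pos|lra|]. nra. }
  assert (F2 : (exp x * Rabs (sin y - y) <= 3 * (eps * r))%R).
  { apply Rmult_le_compat; [lra|apply Rabs_pos|lra|]. nra. }
  assert (F3 : (Rabs (exp x - 1) * Rabs y <= 2 * (eps * r))%R).
  { apply Rle_trans with (2 * Rabs x * Rabs y)%R; [apply Rmult_le_compat_r; lra|]. nra. }
  assert (F4 : (Rabs (exp x - 1 - x) <= eps * r)%R) by nra.
  assert (F5 : (9 * (eps * r) <= eps0 * r)%R) by nra.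
  lra.
Qed.

Lemma Cexp_Cderiv (w : C) : Cderiv Cexp w (Cexp w).
Proof.
  apply (@is_derive_ext C_AbsRing C_NormedModule (fun z => Cexp w * Cexp (z - w))).
  - intros z. change (Cexp w * Cexp (z - w) = Cexp z). rewrite <- Cexp_plus. f_equal. ring.
  - assert (H : Cderiv (fun z => Cexp w * Cexp (z - w)) w
      (0 * Cexp (w - w) + Cexp w * ((1 - 0) * 1))).
    { apply (Cderiv_mult (fun _ => Cexp w) (fun z => Cexp (z - w))); [apply Cderiv_const|].
      apply (Cderiv_comp Cexp (fun z => z - w)).
      - replace (w - w) with (RtoC 0) by ring. apply Cexp_Cderiv_0.
      - apply Cderiv_minus; [apply Cderiv_id|apply Cderiv_const]. }
    replace (0 * Cexp (w - w) + Cexp w * ((1 - 0) * 1)) with (Cexp w) in H by ring.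
    exact H.
Qed.

(** A continuous determination of the logarithm is automatically differentiable, as a
    continuous right inverse of the exponential, whose derivative does not vanish. *)
Lemma log_Cderiv (L : C -> C) (w : C) (r : R) :
  (0 < r)%R -> (forall z, (Cmod (z - w) < r)%R -> Cexp (L z) = z) ->
  Ccontinuous L w -> Cderiv L w (/ w).
Proof.
  intros Hr HL Hc.
  assert (Ew : Cexp (L w) = w).
  { apply HL. rewrite Cmod_minus_diag. assumption. }
  assert (Hw : w <> 0) by (rewrite <- Ew; apply Cexp_neq_0).
  assert (Hm := proj1 (Cmod_gt_0 w) Hw). set (m := Cmod w) in *.
  apply Cderiv_eps. intros eps He.
  set (eta := Rmin (m / 2) (eps * (m * m) / 2)).
  assert (Hmm : (0 < m * m)%R) by (apply Rmult_lt_0_compat; assumption).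
  assert (Heta : (0 < eta)%R).
  { apply Rmin_pos; [lra|]. apply Rdiv_lt_0_compat; [apply Rmult_lt_0_compat; lra|lra]. }
  assert (Heta1 : (eta <= m / 2)%R) by apply Rmin_l.
  assert (Heta2 : (eta <= eps * (m * m) / 2)%R) by apply Rmin_r.
  destruct (proj1 (Cderiv_eps Cexp (L w) _) (Cexp_Cderiv (L w)) eta Heta) as [d [Hd H]].
  destruct (proj1 (Ccontinuous_eps L w) Hc d Hd) as [d' [Hd' H']].
  exists (Rmin r d'). split; [apply Rmin_pos; assumption|]. intros z Hz.
  destruct (Rmin_Rgt_l _ _ _ Hz) as [Z1 Z2].
  specialize (H (L z) (H' z Z2)). rewrite (HL z Z1), Ew in H.
  set (k := L z - L w) in *. set (h := z - w) in *.
  assert (Hk : (Cmod k * m <= Cmod h + eta * Cmod k)%R).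
  { assert (A := Cmod_triangle h (- (h - k * w))).
    replace (h + - (h - k * w)) with (k * w) in A by ring.
    rewrite Cmod_mult, Cmod_opp in A. fold m in A. lra. }
  assert (Hk0 := Cmod_ge_0 k). assert (Hh0 := Cmod_ge_0 h).
  assert (Hk2 : (Cmod k * m <= 2 * Cmod h)%R) by nra.
  replace (k - h * / w) with (- (h - k * w) / w) by (field; assumption).
  rewrite Cmod_div, Cmod_opp by assumption. fold m.
  apply Rmult_le_reg_r with (m * m)%R; [assumption|].
  replace (Cmod (h - k * w) / m * (m * m))%R with (Cmod (h - k * w) * m)%R by (field; lra).
  apply Rle_trans with (eta * Cmod k * m)%R; [apply Rmult_le_compat_r; lra|].
  apply Rle_trans with (eta * (2 * Cmod h))%R.
  - rewrite Rmult_assoc. apply Rmult_le_compat_l; lra.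
  - apply Rle_trans with (eps * (m * m) / 2 * (2 * Cmod h))%R.
    + apply Rmult_le_compat_r; lra.
    + right. field.
Qed.

Definition principal_log (z : C) : C :=
  ((ln (Re z * Re z + Im z * Im z) / 2)%R, atan (Im z / Re z)).

Lemma Cexp_principal_log z : (0 < Re z)%R -> Cexp (principal_log z) = z.
Proof.
  destruct z as [x y]. simpl. intros Hx. unfold principal_log, Cexp. simpl.
  set (q := (y / x)%R).
  assert (Hq : (0 < 1 + Rsqr q)%R) by (assert (A := Rle_0_sqr q); lra).
  assert (Hs : (0 < sqrt (1 + Rsqr q))%R) by (apply sqrt_lt_R0, Hq).
  assert (E : exp (ln (x * x + y * y) / 2) = (x * sqrt (1 + Rsqr q))%R).
  { replace (x * x + y * y)%R with (x * x * (1 + Rsqr q))%R by (unfold q, Rsqr; field; lra).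
    assert (Hxx : (0 < x * x)%R) by (apply Rmult_lt_0_compat; assumption).
    rewrite <- (sqrt_sqrt (1 + Rsqr q)) at 1 by lra.
    replace (x * x * (sqrt (1 + Rsqr q) * sqrt (1 + Rsqr q)))%R
      with ((x * sqrt (1 + Rsqr q)) * (x * sqrt (1 + Rsqr q)))%R by ring.
    assert (Hp : (0 < x * sqrt (1 + Rsqr q))%R) by (apply Rmult_lt_0_compat; assumption).
    rewrite ln_mult by assumption.
    replace ((ln (x * sqrt (1 + Rsqr q)) + ln (x * sqrt (1 + Rsqr q))) / 2)%R
      with (ln (x * sqrt (1 + Rsqr q))) by field.
    apply exp_ln, Hp. }
  rewrite E, cos_atan, sin_atan. f_equal; field_simplify; try lra; unfold q; field; lra.
Qed.

Lemma principal_log_continuous (z : C) : (0 < Re z)%R -> Ccontinuous principal_log z.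
Proof.
  intros Hz.
  assert (Hfst : continuous (fun z : C => Re z) z) by apply continuous_fst.
  assert (Hsnd : continuous (fun z : C => Im z) z) by apply continuous_snd.
  assert (Hpos : (0 < Re z * Re z + Im z * Im z)%R).
  { assert (A := Rmult_lt_0_compat _ _ Hz Hz). assert (B := Rle_0_sqr (Im z)). unfold Rsqr in B. lra. }
  apply (continuous_comp_2 (fun z : C => (ln (Re z * Re z + Im z * Im z) / 2)%R)
    (fun z : C => atan (Im z / Re z)) (fun a b => (a, b))).
  - apply (continuous_mult (K := R_AbsRing)); [|apply continuous_const].
    apply (continuous_comp (fun z : C => (Re z * Re z + Im z * Im z)%R) ln).
    + apply (@continuous_plus C_UniformSpace R_AbsRing R_NormedModule);
      apply (continuous_mult (K := R_AbsRing)); assumption.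
    + apply (@ex_derive_continuous R_AbsRing R_NormedModule). auto_derive. exact Hpos.
  - apply (continuous_comp (fun z : C => (Im z / Re z)%R) atan).
    + apply (continuous_mult (K := R_AbsRing)); [assumption|].
      apply (continuous_comp (fun z : C => Re z) Rinv); [assumption|].
      apply (@ex_derive_continuous R_AbsRing R_NormedModule). auto_derive. lra.
    + apply (@ex_derive_continuous R_AbsRing R_NormedModule). auto_derive. trivial.
  - apply (continuous_ext (fun x : R * R => x)); [intros [a b]; reflexivity|apply continuous_id].
Qed.

Lemma local_log_exists (w0 : C) : w0 <> 0 -> exists L, is_local_log w0 L.
Proof.
  intros Hw0.
  (* multiplication by [u] brings [w0] into the right half plane *)
  assert (Hrot : exists u c : C, (0 < Re (w0 * u))%R /\ Cexp c * u = 1).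
  { destruct w0 as [x y].
    destruct (Rtotal_order x 0) as [Hx|[Hx|Hx]].
    - exists (- (1)), (0%R, PI). split; [simpl; lra|].
      unfold Cexp, Cmult, Copp, RtoC; simpl. rewrite exp_0, cos_PI, sin_PI. f_equal; ring.
    - destruct (Rtotal_order y 0) as [Hy|[Hy|Hy]].
      + exists Ci, (0%R, (- (PI / 2))%R). split; [simpl; lra|].
        unfold Cexp, Cmult, Ci, RtoC; simpl. rewrite exp_0, cos_neg, sin_neg, cos_PI2, sin_PI2. f_equal; ring.
      + exfalso. apply Hw0. rewrite Hx, Hy. reflexivity.
      + exists (- Ci), (0%R, (PI / 2)%R). split; [simpl; lra|].
        unfold Cexp, Cmult, Ci, Copp, RtoC; simpl. rewrite exp_0, cos_PI2, sin_PI2. f_equal; ring.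
    - exists 1, 0. split; [simpl; lra|]. rewrite Cexp_0. ring. }
  destruct Hrot as [u [c [Hre Hc]]].
  set (L := fun z => c + principal_log (z * u)).
  assert (HL : forall z, (0 < Re (z * u))%R -> Cexp (L z) = z).
  { intros z Hz. unfold L. rewrite Cexp_plus, Cexp_principal_log by assumption.
    replace (Cexp c * (z * u)) with (z * (Cexp c * u)) by ring. rewrite Hc. ring. }
  assert (Hu : forall z, Ccontinuous (fun z => z * u) z).
  { intros z. apply Ccontinuous_mult; [apply Ccontinuous_id|apply Ccontinuous_const]. }
  assert (Hopen : forall z, (0 < Re (z * u))%R -> exists r, (0 < r)%R /\
     forall z', (Cmod (z' - z) < r)%R -> (0 < Re (z' * u))%R).
  { intros z Hz. destruct (proj1 (Ccontinuous_eps _ z) (Hu z) _ Hz) as [r [Hr H]].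
    exists r. split; [assumption|]. intros z' Hz'. specialize (H z' Hz').
    assert (A := re_le_Cmod (z' * u - z * u)).
    change (Re (z' * u - z * u)) with (Re (z' * u) - Re (z * u))%R in A.
    assert (B := Rabs_def2 _ _ (Rle_lt_trans _ _ _ A H)). lra. }
  exists L. apply Clocally_eps. destruct (Hopen w0 Hre) as [r [Hr H]].
  exists r. split; [assumption|]. intros z Hz. specialize (H z Hz).
  split; [apply HL, H|]. exists (/ z).
  destruct (Hopen z H) as [r' [Hr' H']].
  apply (log_Cderiv L z r'); [assumption|intros z' Hz'; apply HL, H', Hz'|].
  apply Ccontinuous_plus; [apply Ccontinuous_const|].
  apply (Ccontinuous_comp principal_log (fun z => z * u)); [apply Hu|].
  apply principal_log_continuous, H.
Qed.

Lemma local_log_spec (w0 : C) : w0 <> 0 ->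
  Cexp (local_log w0 w0) = w0 /\ Cderiv (local_log w0) w0 (/ w0).
Proof.
  intros Hw0.
  assert (H : is_local_log w0 (local_log w0)).
  { unfold local_log. apply epsilon_spec. apply local_log_exists, Hw0. }
  apply Clocally_eps in H. destruct H as [r [Hr H]].
  assert (H0 : (Cmod (w0 - w0) < r)%R).
  { rewrite Cmod_minus_diag. assumption. }
  split; [apply H, H0|].
  apply (log_Cderiv _ _ r); [assumption|intros z Hz; apply H, Hz|].
  apply ex_Cderiv_continuous, H, H0.
Qed.

Lemma power_near_neq_0 (w0 p w : C) : power_near w0 p w <> 0.
Proof. apply Cexp_neq_0. Qed.

Lemma power_near_plus (w0 p q : C) : w0 <> 0 -> p + q = 1 ->
  power_near w0 p w0 * power_near w0 q w0 = w0.
Proof.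
  intros Hw0 E. unfold power_near. rewrite <- Cexp_plus, <- Cmult_plus_distr_r, E, Cmult_1_l.
  apply local_log_spec, Hw0.
Qed.

Lemma power_near_Cderiv (w0 p : C) : w0 <> 0 ->
  Cderiv (power_near w0 p) w0 (p / w0 * power_near w0 p w0).
Proof.
  intros Hw0. unfold power_near.
  replace (p / w0 * Cexp (p * local_log w0 w0)) with
    ((0 * local_log w0 w0 + p * / w0) * Cexp (p * local_log w0 w0)) by (unfold Cdiv; ring).
  apply (Cderiv_comp Cexp (fun w => p * local_log w0 w)); [apply Cexp_Cderiv|].
  apply (Cderiv_mult (fun _ => p) (local_log w0)); [apply Cderiv_const|].
  apply local_log_spec, Hw0.
Qed.

Lemma C_derive_unique (f : C -> C) (z l : C) : Cderiv f z l -> C_derive f z = l.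
Proof. exact (is_C_derive_unique f z l). Qed.

(** The weights in both recursions are quotients of powers, whose derivatives are
    multiples of themselves. *)
Lemma C_derive_weighted (X Y f : C -> C) (tau x y f' : C) :
  X tau <> 0 -> Y tau <> 0 ->
  Cderiv X tau (x * X tau) -> Cderiv Y tau (y * Y tau) -> Cderiv f tau f' ->
  C_derive (fun u => X u / Y u * f u) tau = X tau / Y tau * (f' + (x - y) * f tau).
Proof.
  intros HX0 HY0 HX HY Hf. apply C_derive_unique.
  replace (X tau / Y tau * (f' + (x - y) * f tau)) with
    ((x * X tau * / Y tau + X tau * (y * Y tau * - / (Y tau * Y tau))) * f tau + X tau / Y tau * f')
    by (field; repeat split; assumption).
  apply (Cderiv_mult (fun u => X u / Y u) f); [|exact Hf].
  apply (Cderiv_mult X (fun u => / Y u)); [exact HX|].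
  apply (Cderiv_comp Cinv Y); [apply Cderiv_inv, HY0|exact HY].
Qed.

Lemma power_near_shift_Cderiv (tau h p : C) : tau - h <> 0 ->
  Cderiv (fun u => power_near (tau - h) p (u - h)) tau
    (p / (tau - h) * power_near (tau - h) p (tau - h)).
Proof.
  intros Hh. rewrite <- (Cmult_1_l (p / _ * _)).
  apply (Cderiv_comp (power_near (tau - h) p) (fun u => u - h));
    [exact (power_near_Cderiv _ p Hh)|].
  replace (RtoC 1) with (1 - 0) by ring.
  apply Cderiv_minus; [apply Cderiv_id|apply Cderiv_const].
Qed.

Lemma A_step_formula (b c sigma : C) (f : C -> C) (tau f' : C) :
  ~ exceptional sigma tau -> Cderiv f tau f' ->
  A_step b c sigma f tau =
    (tau * (tau - 2 * zeta sigma) * f' + (b * tau - (b - c) * (tau - 2 * zeta sigma)) * f tau)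
    / quad sigma tau.
Proof.
  intros Hex Hf.
  assert (H0 : tau <> 0) by (intros E; apply Hex; left; exact E).
  assert (H1 : tau - 2 * zeta sigma <> 0).
  { apply Cminus_neq_0. intros E; apply Hex; right; exact E. }
  unfold A_step.
  rewrite (C_derive_weighted (fun u => power_near (tau - 2 * zeta sigma) b (u - 2 * zeta sigma))
    (power_near tau (b - c)) f _ _ _ f' (power_near_neq_0 _ _ _) (power_near_neq_0 _ _ _)
    (power_near_shift_Cderiv tau (2 * zeta sigma) b H1) (power_near_Cderiv tau (b - c) H0) Hf).
  set (z2 := tau - 2 * zeta sigma) in *.
  assert (Hp := power_near_neq_0 tau (b - c) tau). assert (Hq := power_near_neq_0 z2 b z2).
  assert (Ep : power_near tau (b - c + 1) tau = tau * power_near tau (b - c) tau).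
  { rewrite <- (power_near_plus tau 1 0 H0) at 3 by ring.
    unfold power_near. rewrite <- !Cexp_plus. f_equal. ring. }
  assert (Eq : power_near z2 (1 - b) z2 = z2 / power_near z2 b z2).
  { transitivity (power_near z2 (1 - b) z2 * power_near z2 b z2 / power_near z2 b z2);
      [field; assumption|].
    rewrite power_near_plus; [reflexivity|assumption|ring]. }
  rewrite Ep, Eq. unfold Cdiv. set (k := / quad sigma tau). field. repeat split; assumption.
Qed.

Lemma G_step_formula (b c sigma : C) (f : C -> C) (tau f' : C) :
  ~ exceptional sigma tau -> Cderiv f tau f' ->
  - (power_near (tau - 2 * zeta sigma) b (tau - 2 * zeta sigma) / power_near tau (b - c) tau)
  * C_derive (fun u : C => power_near tau (b - c) u /
       power_near (tau - 2 * zeta sigma) b (u - 2 * zeta sigma) * f u) tau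
  = - (f' + ((b - c) / tau - b / (tau - 2 * zeta sigma)) * f tau).
Proof.
  intros Hex Hf.
  assert (H0 : tau <> 0) by (intros E; apply Hex; left; exact E).
  assert (H1 : tau - 2 * zeta sigma <> 0).
  { apply Cminus_neq_0. intros E; apply Hex; right; exact E. }
  rewrite (C_derive_weighted (power_near tau (b - c))
    (fun u => power_near (tau - 2 * zeta sigma) b (u - 2 * zeta sigma))
    f _ _ _ f' (power_near_neq_0 _ _ _) (power_near_neq_0 _ _ _)
    (power_near_Cderiv tau (b - c) H0) (power_near_shift_Cderiv tau (2 * zeta sigma) b H1) Hf).
  set (z2 := tau - 2 * zeta sigma) in *.
  assert (Hp := power_near_neq_0 tau (b - c) tau). assert (Hq := power_near_neq_0 z2 b z2).
  field. repeat split; assumption.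
Qed.

(** * Isolated exceptional points *)
Lemma is_RCInt_change_point (f g : R -> C) a b c l : (a <= b)%R ->
  (forall x, (a < x < b)%R -> x <> c -> f x = g x) -> is_RCInt f a b l -> is_RCInt g a b l.
Proof.
  intros Hab H Hf. destruct (excluded_middle_informative (a < c < b)%R) as [Hc|Hc].
  - destruct (@ex_RInt_Chasles_1 C_R_CompleteNormedModule f a c b ltac:(lra) (ex_intro _ l Hf)) as [l1 H1].
    destruct (@ex_RInt_Chasles_2 C_R_CompleteNormedModule f a c b ltac:(lra) (ex_intro _ l Hf)) as [l2 H2].
    assert (H3 := is_RCInt_Chasles f a c b l1 l2 H1 H2).
    assert (E : l = (l1 : C) + l2).
    { rewrite <- (is_RCInt_unique _ _ _ _ Hf). apply is_RCInt_unique. exact H3. }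
    rewrite E. apply is_RCInt_Chasles with c.
    + apply is_RCInt_ext with (f := f); [lra| |exact H1]. intros x Hx. apply H; lra.
    + apply is_RCInt_ext with (f := f); [lra| |exact H2]. intros x Hx. apply H; lra.
  - apply is_RCInt_ext with (f := f); [lra| |exact Hf]. intros x Hx. apply H; [assumption|].
    intros ->. contradiction.
Qed.

Lemma contour_integral_ext_two_points (gamma : R -> C) (f g : C -> C) (e1 e2 : C) :
  simple_closed_contour gamma -> contour_continuous gamma g ->
  (forall w, on_contour gamma w -> w <> e1 -> w <> e2 -> f w = g w) ->
  contour_integral gamma f = contour_integral gamma g.
Proof.
  intros [H1 [H2 [H3 Hinj]]] Hg H.
  assert (Hcl : closed_contour gamma) by (repeat split; assumption).
  assert (Hpar : forall e, exists c, forall x, (0 < x < 1)%R -> x <> c -> gamma x <> e).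
  { intros e. destruct (excluded_middle_informative (exists c, (0 < c < 1)%R /\ gamma c = e))
      as [[c [Hc E]]|Hn].
    - exists c. intros x Hx Hne E'. apply Hne, Hinj; [lra|lra|congruence].
    - exists 0%R. intros x Hx _ E. apply Hn. exists x. tauto. }
  destruct (Hpar e1) as [c1 Hc1]. destruct (Hpar e2) as [c2 Hc2].
  apply contour_integral_unique.
  apply is_RCInt_change_point with (c := c2)
    (f := fun x => (if Req_dec_T x c1 then f (gamma x) else g (gamma x)) * velocity gamma x).
  { lra. }
  { intros x Hx Hx2. destruct Req_dec_T as [E|E]; [reflexivity|].
    rewrite H; auto. exists x; split; [lra|reflexivity]. }
  apply is_RCInt_change_point with (c := c1) (f := fun x => g (gamma x) * velocity gamma x).
  { lra. }
  { intros x Hx Hx1. destruct Req_dec_T as [E|E]; [contradiction|reflexivity]. }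
  apply contour_integrable; assumption.
Qed.

(** On the segment from [w] to [z], the function [F y - phi w * y] has derivative
    [phi y - phi w], which is small, except possibly at the endpoint [w]; continuity
    there is all that the mean value inequality asks for. *)
Lemma Cderiv_removable (F phi : C -> C) (w : C) (r : R) : (0 < r)%R ->
  Ccontinuous F w -> Ccontinuous phi w ->
  (forall z, (Cmod (z - w) < r)%R -> z <> w -> Cderiv F z (phi z)) -> Cderiv F w (phi w).
Proof.
  intros Hr HF Hphi Hd. apply Cderiv_eps. intros eps He.
  destruct (proj1 (Ccontinuous_eps phi w) Hphi (eps / 2)%R) as [d [Hd0 Hd1]]; [lra|].
  exists (Rmin r d). split; [apply Rmin_pos; assumption|]. intros z Hz.
  destruct (Rmin_Rgt_l _ _ _ Hz) as [Z1 Z2].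
  destruct (excluded_middle_informative (z = w)) as [->|Hne].
  { replace (F w - F w - (w - w) * phi w) with (RtoC 0) by ring.
    rewrite Cmod_0. apply Rmult_le_pos; [lra|apply Cmod_ge_0]. }
  set (d0 := z - w) in *. assert (Hd0' : d0 <> 0) by (apply Cminus_neq_0, Hne).
  set (g := fun s : R => F (w + RtoC s * d0) - phi w * (w + RtoC s * d0)).
  assert (Hdist : forall s, (0 <= s <= 1)%R -> (Cmod (w + RtoC s * d0 - w) <= Cmod d0)%R).
  { intros s Hs. replace (w + RtoC s * d0 - w) with (RtoC s * d0) by ring.
    rewrite Cmod_mult, Cmod_R, Rabs_pos_eq by lra.
    assert (A := Cmod_ge_0 d0). nra. }
  assert (Hline : forall s : R, (0 < s)%R -> w + RtoC s * d0 <> w).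
  { intros s Hs E. assert (E' : RtoC s * d0 = 0).
    { replace (RtoC s * d0) with (w + RtoC s * d0 - w) by ring. rewrite E. ring. }
    revert E'. apply Cmult_neq_0; [|assumption]. intros E'. apply RtoC_inj in E'. lra. }
  assert (Hlin : forall y, Cderiv (fun y => phi w * y) y (phi w)).
  { intros y. assert (A := Cderiv_scal (phi w) (fun y => y) y _ (Cderiv_id y)).
    rewrite Cmult_1_r in A. exact A. }
  assert (Hpt : forall s, (0 < s <= 1)%R ->
    Cderiv (fun y => F y - phi w * y) (w + RtoC s * d0) (phi (w + RtoC s * d0) - phi w)).
  { intros s Hs. apply Cderiv_minus; [|apply Hlin]. apply Hd; [|apply Hline; lra].
    apply Rle_lt_trans with (2 := Z1). apply Hdist. lra. }
  assert (Hmv : (Cmod (g 1%R - g 0%R) <= 2 * (eps / 2 * Cmod d0) * (1 - 0))%R).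
  { apply (mean_value_ineq g (fun s => (phi (w + RtoC s * d0) - phi w) * d0)); [lra| |].
    - intros s Hs.
      apply (RCcontinuous_comp (fun s : R => w + RtoC s * d0) (fun y => F y - phi w * y)).
      + exact (RCderiv_continuous _ _ _ (line_RCderiv w d0 s)).
      + destruct (Rle_lt_or_eq_dec 0 s) as [Hs0|<-]; [lra| |].
        * apply (Cderiv_continuous _ _ _ (Hpt s ltac:(lra))).
        * replace (w + RtoC 0 * d0) with w by ring. apply Ccontinuous_minus; [assumption|].
          apply (Cderiv_continuous _ _ _ (Hlin w)).
    - intros s Hs. split.
      + apply (RCderiv_comp (fun y => F y - phi w * y) (fun s : R => w + RtoC s * d0));
          [apply Hpt; lra|apply line_RCderiv].
      + rewrite Cmod_mult. apply Rmult_le_compat_r; [apply Cmod_ge_0|].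
        left. apply Hd1. apply Rle_lt_trans with (2 := Z2). apply Hdist; lra. }
  replace (F z - F w - d0 * phi w) with (g 1%R - g 0%R).
  - lra.
  - unfold g. replace (w + 1 * d0) with z by (unfold d0; ring).
    replace (w + 0 * d0) with w by ring. unfold d0. ring.
Qed.

(** * Rational functions with two poles *)

Section Decay.
Variables p m : C.
Hypothesis Hpm : p <> m.
Local Notation u z := (/ (z - p)).
Local Notation v z := (/ (z - m)).

(** Rational functions that are regular except at [p] and [m] and vanish to order [d] at
    infinity, as sums of products of powers of [1 / (z - p)] and [1 / (z - m)].  Values at
    the poles are ignored. *)
Inductive decays : nat -> (C -> C) -> Prop :=
| decays_monomial d i j k : (d <= i + j)%nat -> decays d (fun z => k * (u z ^ i * v z ^ j))
| decays_plus d f g : decays d f -> decays d g -> decays d (fun z => f z + g z)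
| decays_ext d f g : decays d f -> (forall z, z <> p -> z <> m -> f z = g z) -> decays d g.

Lemma decays_weaken d e f : (e <= d)%nat -> decays d f -> decays e f.
Proof.
  intros He H. revert e He. induction H as [d i j k Hd|d f g H1 IH1 H2 IH2|d f g H1 IH1 E]; intros e He.
  - apply decays_monomial. lia.
  - apply decays_plus; auto.
  - apply decays_ext with f; auto.
Qed.

Lemma decays_mult d e f g : decays d f -> decays e g -> decays (d + e) (fun z => f z * g z).
Proof.
  intros Hf. revert e g. induction Hf as [d i j k Hd|d f1 f2 H1 IH1 H2 IH2|d f1 f2 H1 IH1 E];
    intros e g Hg.
  - induction Hg as [e i' j' k' He|e g1 g2 G1 IG1 G2 IG2|e g1 g2 G1 IG1 E].
    + apply decays_ext with (fun z => (k * k') * (u z ^ (i + i') * v z ^ (j + j'))).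
      * apply decays_monomial. lia.
      * intros z _ _. rewrite !Cpow_add_r. ring.
    + apply (decays_ext _ _ _ (decays_plus _ _ _ IG1 IG2)). intros z _ _. ring.
    + apply (decays_ext _ _ _ IG1). intros z Hz1 Hz2. rewrite E by assumption. ring.
  - apply (decays_ext _ _ _ (decays_plus _ _ _ (IH1 _ _ Hg) (IH2 _ _ Hg))). intros z _ _. ring.
  - apply (decays_ext _ _ _ (IH1 _ _ Hg)). intros z Hz1 Hz2. rewrite E by assumption. ring.
Qed.

Lemma decays_const k : decays 0 (fun _ => k).
Proof.
  apply decays_ext with (fun z => k * (u z ^ 0 * v z ^ 0)).
  - apply decays_monomial. lia.
  - intros z _ _. simpl. ring.
Qed.

Lemma decays_scal k d f : decays d f -> decays d (fun z => k * f z).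
Proof. intros H. exact (decays_mult 0 d _ _ (decays_const k) H). Qed.

Lemma decays_u : decays 1 (fun z => u z).
Proof.
  apply decays_ext with (fun z => 1 * (u z ^ 1 * v z ^ 0)).
  - apply decays_monomial. lia.
  - intros z _ _. simpl. ring.
Qed.

Lemma decays_v : decays 1 (fun z => v z).
Proof.
  apply decays_ext with (fun z => 1 * (u z ^ 0 * v z ^ 1)).
  - apply decays_monomial. lia.
  - intros z _ _. simpl. ring.
Qed.

Lemma decays_uv : decays 2 (fun z => u z * v z).
Proof. exact (decays_mult 1 1 _ _ decays_u decays_v). Qed.

Lemma decays_mult_id d f : decays (S d) f -> decays d (fun z => z * f z).
Proof.
  intros H. remember (S d) as e eqn:He. revert d He.
  induction H as [e i j k Hd|e f g H1 IH1 H2 IH2|e f g H1 IH1 E]; intros d ->.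
  - destruct i as [|i].
    + destruct j as [|j]; [lia|].
      apply decays_ext with (fun z => k * (u z ^ 0 * v z ^ j) + m * (k * (u z ^ 0 * v z ^ S j))).
      * apply decays_plus; [apply decays_monomial; lia|].
        apply decays_scal, decays_monomial. lia.
      * intros z _ Hz. simpl. field. apply Cminus_neq_0, Hz.
    + apply decays_ext with (fun z => k * (u z ^ i * v z ^ j) + p * (k * (u z ^ S i * v z ^ j))).
      * apply decays_plus; [apply decays_monomial; lia|].
        apply decays_scal, decays_monomial. lia.
      * intros z Hz _. rewrite (Cpow_S (u z)). generalize (u z ^ i) (v z ^ j). intros s t.
        field. apply Cminus_neq_0, Hz.
  - apply (decays_ext _ _ _ (decays_plus _ _ _ (IH1 d eq_refl) (IH2 d eq_refl))). intros z _ _. ring.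
  - apply (decays_ext _ _ _ (IH1 d eq_refl)). intros z Hz1 Hz2. rewrite E by assumption. ring.
Qed.

Lemma kernel_pow_Cderiv (q z : C) n : z <> q ->
  Cderiv (fun z => (/ (z - q)) ^ n) z (- INR n * (/ (z - q)) ^ S n).
Proof.
  intros Hz. induction n as [|n IH].
  - replace (- INR 0 * (/ (z - q)) ^ 1) with (RtoC 0) by (simpl; ring).
    exact (Cderiv_const 1 z).
  - rewrite S_INR, RtoC_plus.
    replace (- (RtoC (INR n) + 1) * (/ (z - q)) ^ S (S n)) with
      (- / ((z - q) * (z - q)) * (/ (z - q)) ^ n + / (z - q) * (- INR n * (/ (z - q)) ^ S n)).
    + apply (Cderiv_mult (fun z => / (z - q)) (fun z => (/ (z - q)) ^ n)); [|exact IH].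
      apply kernel_Cderiv, Hz.
    + rewrite !Cpow_S. generalize ((/ (z - q)) ^ n). intros s. field. apply Cminus_neq_0, Hz.
Qed.

Lemma decays_derive d f : decays d f -> exists f', decays (S d) f' /\
  forall z, z <> p -> z <> m -> Cderiv f z (f' z).
Proof.
  induction 1 as [d i j k Hd|d f g H1 [f1 [F1 F2]] H2 [g1 [G1 G2]]|d f g H1 [f1 [F1 F2]] E].
  - exists (fun z => (- INR i * k) * (u z ^ S i * v z ^ j) + (- INR j * k) * (u z ^ i * v z ^ S j)).
    split; [apply decays_plus; apply decays_monomial; lia|].
    intros z Hz1 Hz2.
    replace (- INR i * k * (u z ^ S i * v z ^ j) + - INR j * k * (u z ^ i * v z ^ S j)) with
      (k * ((- INR i * u z ^ S i) * v z ^ j + u z ^ i * (- INR j * v z ^ S j))) by ring.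
    apply Cderiv_scal.
    apply (Cderiv_mult (fun z => u z ^ i) (fun z => v z ^ j)); apply kernel_pow_Cderiv; assumption.
  - exists (fun z => f1 z + g1 z). split; [apply decays_plus; assumption|].
    intros z Hz1 Hz2. apply Cderiv_plus; auto.
  - exists f1. split; [assumption|]. intros z Hz1 Hz2.
    assert (A : (0 < Cmod (z - p))%R) by apply Cmod_gt_0, Cminus_neq_0, Hz1.
    assert (B : (0 < Cmod (z - m))%R) by apply Cmod_gt_0, Cminus_neq_0, Hz2.
    apply (Cderiv_ext_loc f g z (f1 z) _ (Rmin_pos _ _ A B)); [|apply F2; assumption].
    intros y Hy. rewrite Cmod_minus_sym in Hy.
    destruct (Rmin_Rgt_l _ _ _ Hy) as [Y1 Y2].
    apply E; intros ->; lra.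
Qed.

Lemma decays_continuous d f z : decays d f -> z <> p -> z <> m -> Ccontinuous f z.
Proof.
  intros H Hz1 Hz2. destruct (decays_derive d f H) as [f' [_ Hf']].
  exact (Cderiv_continuous _ _ _ (Hf' z Hz1 Hz2)).
Qed.

Section Integral.
Variable gamma : R -> C.
Hypothesis Hgamma : closed_contour gamma.
Hypothesis Hp : ~ on_contour gamma p.
Hypothesis Hm : ~ on_contour gamma m.
Hypothesis Hwind : contour_integral gamma (fun z => u z) = contour_integral gamma (fun z => v z).

Lemma off_poles w : on_contour gamma w -> w <> p /\ w <> m.
Proof. intros Hw; split; intros ->; contradiction. Qed.

Lemma decays_contour_continuous d f : decays d f -> contour_continuous gamma f.
Proof. intros H w Hw. destruct (off_poles w Hw). apply (decays_continuous d); assumption. Qed.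

Lemma kernel_pow_integral q n : ~ on_contour gamma q -> 
  contour_integral gamma (fun z => (/ (z - q)) ^ S (S n)) = 0.
Proof.
  intros Hq.
  assert (Hn : RtoC (INR (S n)) <> 0).
  { intros E. apply RtoC_inj in E. revert E. apply not_0_INR. lia. }
  assert (Hne : forall w, on_contour gamma w -> w <> q) by (intros w Hw ->; contradiction).
  apply (contour_integral_derivative gamma Hgamma
    (fun z => (- / INR (S n)) * (/ (z - q)) ^ S n)).
  - intros w Hw. exact (Cderiv_continuous _ _ _ (kernel_pow_Cderiv q w _ (Hne w Hw))).
  - intros w Hw.
    replace ((/ (w - q)) ^ S (S n)) with (- / INR (S n) * (- INR (S n) * (/ (w - q)) ^ S (S n)))
      by (generalize ((/ (w - q)) ^ S (S n)); intros s; field; exact Hn).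
    apply Cderiv_scal, kernel_pow_Cderiv, Hne, Hw.
Qed.

(** If both exponents are positive, the identity [u v = (u - v) / (p - m)] lowers the
    degree.  Higher powers of [u] or [v] alone are derivatives, and in degree two there
    remains the difference of the integrals of [u] and [v], which is zero by [Hwind]. *)
Lemma monomial_integral n i j : (i + j = S (S n))%nat ->
  contour_integral gamma (fun z => u z ^ i * v z ^ j) = 0.
Proof.
  revert i j. induction n as [|n IH]; intros i j Hij.
  all: destruct i as [|i]; [rewrite (contour_integral_ext gamma _ (fun z => v z ^ j));
      [simpl in Hij; subst j; apply kernel_pow_integral, Hm|intros; simpl; ring]|].
  all: destruct j as [|j]; [rewrite (contour_integral_ext gamma _ (fun z => u z ^ S i));
      [rewrite Nat.add_0_r in Hij; rewrite Hij; apply kernel_pow_integral, Hp|intros; simpl; ring]|].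
  all: assert (Hd : p - m <> 0) by (apply Cminus_neq_0; exact Hpm).
  all: rewrite (contour_integral_ext gamma _
      (fun z => / (p - m) * (u z ^ S i * v z ^ j) + - / (p - m) * (u z ^ i * v z ^ S j)));
    [|intros w Hw; destruct (off_poles w Hw) as [N1 N2]; rewrite !Cpow_S;
      generalize (u w ^ i) (v w ^ j); intros s t; field;
      repeat split; try exact Hd; apply Cminus_neq_0; assumption].
  all: assert (Hmono : forall i j, contour_continuous gamma (fun z => u z ^ i * v z ^ j));
    [intros i' j'; apply (decays_contour_continuous 0);
     apply decays_ext with (fun z => 1 * (u z ^ i' * v z ^ j'));
       [apply decays_monomial; lia|intros; ring]|].
  all: rewrite (contour_integral_plus gamma Hgamma _ _
      (contour_continuous_scal gamma _ _ (Hmono (S i) j))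
      (contour_continuous_scal gamma _ _ (Hmono i (S j)))),
    (contour_integral_scal gamma Hgamma _ _ (Hmono (S i) j)),
    (contour_integral_scal gamma Hgamma _ _ (Hmono i (S j))).
  - assert (i = 0%nat) by lia. assert (j = 0%nat) by lia. subst i j.
    rewrite (contour_integral_ext gamma (fun z => u z ^ 1 * v z ^ 0) (fun z => u z)) by (intros; simpl; ring).
    rewrite (contour_integral_ext gamma (fun z => u z ^ 0 * v z ^ 1) (fun z => v z)) by (intros; simpl; ring).
    rewrite Hwind. ring.
  - rewrite !IH by lia. ring.
Qed.

Lemma decays_integral d f : (2 <= d)%nat -> decays d f -> contour_integral gamma f = 0.
Proof.
  intros Hd H. induction H as [d i j k Hij|d f g H1 IH1 H2 IH2|d f g H1 IH1 E].
  - rewrite contour_integral_scal.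
    + rewrite (monomial_integral (i + j - 2)) by lia. ring.
    + exact Hgamma.
    + apply (decays_contour_continuous 0).
      apply decays_ext with (fun z => 1 * (u z ^ i * v z ^ j)); [apply decays_monomial; lia|intros; ring].
  - rewrite contour_integral_plus, IH1, IH2; try assumption; [ring| |];
      eapply decays_contour_continuous; eassumption.
  - rewrite <- (contour_integral_ext gamma f g); [auto|].
    intros w Hw. destruct (off_poles w Hw). apply E; assumption.
Qed.
End Integral.
End Decay.

(** * The coefficients of the expansion *)
Lemma tau_sum sigma : tau_p sigma + tau_m sigma = 2 * zeta sigma.
Proof. unfold tau_p, tau_m, zeta, Ccos. field. Qed.

Lemma tau_prod sigma : tau_p sigma * tau_m sigma = 2 * zeta sigma.
Proof.
  unfold tau_p, tau_m, zeta, Ccos. assert (H := Cexp_opp (Ci * sigma)).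
  transitivity (1 - Cexp (Ci * sigma) - Cexp (- (Ci * sigma)) + Cexp (Ci * sigma) * Cexp (- (Ci * sigma)));
    [ring|]. rewrite H. field.
Qed.

Lemma quad_factor sigma z : quad sigma z = (z - tau_p sigma) * (z - tau_m sigma).
Proof.
  unfold quad. replace (2 * zeta sigma * z) with ((tau_p sigma + tau_m sigma) * z)
    by (rewrite tau_sum; reflexivity).
  rewrite <- tau_prod. ring.
Qed.

Lemma point_isolated (w e : C) : exists r, (0 < r)%R /\ forall z, (Cmod (z - w) < r)%R -> z <> w -> z <> e.
Proof.
  destruct (excluded_middle_informative (w = e)) as [->|Hne].
  - exists 1%R. split; [lra|auto].
  - exists (Cmod (e - w)). split; [apply Cmod_gt_0, Cminus_neq_0; auto|].
    intros z Hz _ ->. lra.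
Qed.

Lemma four_points_isolated (w e1 e2 e3 e4 : C) : exists r, (0 < r)%R /\
  forall z, (Cmod (z - w) < r)%R -> z <> w -> z <> e1 /\ z <> e2 /\ z <> e3 /\ z <> e4.
Proof.
  destruct (point_isolated w e1) as [r1 [R1 H1]]. destruct (point_isolated w e2) as [r2 [R2 H2]].
  destruct (point_isolated w e3) as [r3 [R3 H3]]. destruct (point_isolated w e4) as [r4 [R4 H4]].
  exists (Rmin (Rmin r1 r2) (Rmin r3 r4)). split; [repeat apply Rmin_pos; assumption|].
  intros z Hz Hne.
  destruct (Rmin_Rgt_l _ _ _ Hz) as [Z1 Z2].
  destruct (Rmin_Rgt_l _ _ _ Z1) as [Y1 Y2].
  destruct (Rmin_Rgt_l _ _ _ Z2) as [Y3 Y4].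
  auto.
Qed.

Section Expansion.
Variables (b c sigma : C).
Let p := tau_p sigma.
Let m := tau_m sigma.
Let Z := 2 * zeta sigma.
Hypothesis Hpm : p <> m.

Let sum_pm : p + m = Z. Proof. exact (tau_sum sigma). Qed.
Let prod_pm : p * m = Z. Proof. exact (tau_prod sigma). Qed.

Lemma tau_not_exceptional : ~ exceptional sigma p /\ ~ exceptional sigma m.
Proof.
  assert (H0 : p <> 0 /\ m <> 0).
  { split; intros E; apply Hpm.
    - assert (A : m = p + m - p) by ring. rewrite A, sum_pm, <- prod_pm, E. ring.
    - assert (A : p = p + m - m) by ring. rewrite A, sum_pm, <- prod_pm, E. ring. }
  destruct H0 as [Hp0 Hm0].
  split; intros [E|E]; try contradiction.
  - apply Hm0. replace m with (p + m - p) by ring. rewrite sum_pm. unfold Z. rewrite <- E. ring.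
  - apply Hp0. replace p with (p + m - m) by ring. rewrite sum_pm. unfold Z. rewrite <- E. ring.
Qed.

Lemma not_exceptional_neq z : ~ exceptional sigma z -> z <> 0 /\ z - Z <> 0.
Proof.
  intros H. split; [intros E; apply H; left; exact E|].
  apply Cminus_neq_0. intros E; apply H; right; exact E.
Qed.

Local Notation u z := (/ (z - p)).
Local Notation v z := (/ (z - m)).

(** The recursively defined [A_{s,n}] and their rational expressions agree away from
    their singularities and from the points where the powers have no determination. *)
Definition agrees (f0 f : C -> C) : Prop :=
  forall z, ~ exceptional sigma z -> z <> p -> z <> m -> f0 z = f z.

(** The step from [A_{s,n}] to [A_{s+1,n}] without powers.  It is a relation because the
    derivative of [f] is part of the data. *)
Definition is_step (f g : C -> C) : Prop :=
  exists f', (forall z, z <> p -> z <> m -> Cderiv f z (f' z)) /\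
  forall z, z <> p -> z <> m ->
    g z = u z * v z * (z * (z - Z) * f' z + (b * z - (b - c) * (z - Z)) * f z).

(** With [q = (z - p) (z - m)] and [p m = p + m = Z], the coefficient [z (z - Z) / q] of the
    derivative is [1 - Z u v], and the coefficient of [f] is
    [c v + (c p + Z (b - c)) u v].  So a step does not leave the polynomials in [u] and
    [v], and it gains one order. *)
Lemma is_step_decays d f : decays p m d f -> exists g, decays p m (S d) g /\ is_step f g.
Proof.
  intros Hf. destruct (decays_derive p m d f Hf) as [f' [Hf' Hder]].
  exists (fun z => (f' z + - Z * (u z * v z * f' z)) +
     (c * (v z * f z) + (c * p + Z * (b - c)) * (u z * v z * f z))).
  split.
  - apply decays_plus; apply decays_plus.
    + exact Hf'.
    + apply decays_scal. apply (decays_weaken p m (2 + S d)); [lia|].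
      apply decays_mult; [apply decays_uv|exact Hf'].
    + apply decays_scal. apply (decays_mult p m 1 d); [apply decays_v|exact Hf].
    + apply decays_scal. apply (decays_weaken p m (2 + d)); [lia|].
      apply decays_mult; [apply decays_uv|exact Hf].
  - exists f'. split; [exact Hder|]. intros z H1 H2.
    rewrite <- sum_pm. replace (f' z) with (u z * v z * (z * (z - (p + m)) + p * m) * f' z) at 1
      by (field_off_poles).
    rewrite prod_pm, sum_pm. generalize (f' z) (f z). intros s t. 
    field_off_poles.
Qed.

Lemma is_step_plus f1 f2 g1 g2 : is_step f1 g1 -> is_step f2 g2 ->
  is_step (fun z => f1 z + f2 z) (fun z => g1 z + g2 z).
Proof.
  intros [f1' [D1 E1]] [f2' [D2 E2]]. exists (fun z => f1' z + f2' z). split.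
  - intros z H1 H2. apply Cderiv_plus; auto.
  - intros z H1 H2. rewrite E1, E2 by assumption. ring.
Qed.

Lemma agrees_near f0 f z : agrees f0 f -> ~ exceptional sigma z -> z <> p -> z <> m ->
  exists r, (0 < r)%R /\ forall y, (Cmod (y - z) < r)%R -> f0 y = f y.
Proof.
  intros H Hz Hzp Hzm.
  destruct (four_points_isolated z 0 Z p m) as [r [Hr Hiso]].
  exists r. split; [assumption|]. intros y Hy.
  destruct (excluded_middle_informative (y = z)) as [->|Hne]; [apply H; assumption|].
  destruct (Hiso y Hy Hne) as [N1 [N2 [N3 N4]]].
  apply H; try assumption. intros [E|E]; contradiction.
Qed.

Lemma A_step_agrees f0 f g : agrees f0 f -> is_step f g -> agrees (A_step b c sigma f0) g.
Proof.
  intros Hf [f' [Hd E]] z Hz Hzp Hzm.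
  destruct (agrees_near f0 f z Hf Hz Hzp Hzm) as [r [Hr Hnear]].
  rewrite (A_step_formula b c sigma f0 z (f' z)).
  - rewrite E, quad_factor by assumption. rewrite (Hf z) by assumption.
    fold p m Z. generalize (f' z) (f z). intros s t. field.
    split; apply Cminus_neq_0; assumption.
  - assumption.
  - apply (Cderiv_ext_loc f f0 z (f' z) r Hr); [|apply Hd; assumption].
    intros y Hy. symmetry. apply Hnear, Hy.
Qed.

Variables (D : C -> Prop) (G H : nat -> C -> C) (gamma : R -> C).
Hypothesis HD : forall w, D w -> exists r, (0 < r)%R /\ disc_in w r D.
Hypothesis HGH : GH_recursion b c sigma D G H.
Hypothesis Hgamma : closed_contour gamma.
Hypothesis Hext : forall w, ~ D w -> outside gamma w.
Hypothesis Hp : ~ on_contour gamma p.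
Hypothesis Hm : ~ on_contour gamma m.
Hypothesis Wp : contour_integral gamma (fun z => u z) = 2 * PI * Ci.
Hypothesis Wm : contour_integral gamma (fun z => v z) = 2 * PI * Ci.

Let I (f : C -> C) : C := contour_integral gamma f.
Let a0 (k : nat) : C := coef0 sigma (G k).
Let a1 (k : nat) : C := coef1 sigma (G k).

Lemma on_contour_D w : on_contour gamma w -> D w.
Proof. intros Hw. apply NNPP. intros Hn. apply (Hext w Hn). exact Hw. Qed.

Lemma G_contour k : contour_continuous gamma (G k).
Proof. intros w Hw. apply ex_Cderiv_continuous. apply (HGH k), on_contour_D, Hw. Qed.

Lemma contour_continuous_mult f g : contour_continuous gamma f -> contour_continuous gamma g ->
  contour_continuous gamma (fun z => f z * g z).
Proof. intros Hf Hg w Hw. apply Ccontinuous_mult; auto. Qed.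

Lemma off_tau w : on_contour gamma w -> w <> p /\ w <> m.
Proof. intros Hw; split; intros ->; contradiction. Qed.

Lemma decays_contour_continuous_tau d f : decays p m d f -> contour_continuous gamma f.
Proof. apply decays_contour_continuous; assumption. Qed.

Lemma decays_integral_tau d f : (2 <= d)%nat -> decays p m d f -> I f = 0.
Proof.
  intros Hd Hf. apply (decays_integral p m Hpm gamma Hgamma Hp Hm) with (d := d); try assumption.
  congruence.
Qed.

Lemma H_formula k z : D z -> ~ exceptional sigma z -> z <> p -> z <> m ->
  H k z = z * (z - Z) * (u z * v z) * (G k z - a0 k - a1 k * z).
Proof.
  intros HDz Hz Hzp Hzm. destruct (HGH k) as [_ [_ [HG _]]].
  rewrite (HG z HDz Hz). rewrite quad_factor. fold p m Z (a0 k) (a1 k).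
  destruct (not_exceptional_neq z Hz) as [N1 N2].
  field_off_poles.
Qed.

(** The function [phi] in the proof is the derivative of [f * H k]: away from the
    exceptional points by the formula for [G (S k)], at these points by continuity. *)
Lemma step_transfer f g d e k : decays p m d f -> decays p m e g -> is_step f g ->
  I (fun z => g z * G k z) =
  I (fun z => f z * G (S k) z) + a0 k * I g + a1 k * I (fun z => z * g z).
Proof.
  intros Hf Hg [f' [Hf' Eg]].
  destruct (HGH k) as [DG [DH [HG HGS]]]. destruct (HGH (S k)) as [DGS _].
  set (phi := fun z => g z * (G k z - a0 k - a1 k * z) - f z * G (S k) z).
  assert (Hphi : forall z, D z -> z <> p -> z <> m -> Ccontinuous phi z).
  { intros z HDz H1 H2. apply Ccontinuous_minus; apply Ccontinuous_mult.
    - apply (decays_continuous p m e); assumption.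
    - apply Ccontinuous_minus; [apply Ccontinuous_minus|apply Ccontinuous_mult];
        try apply Ccontinuous_const; [apply ex_Cderiv_continuous, DG, HDz|apply Ccontinuous_id].
    - apply (decays_continuous p m d); assumption.
    - apply ex_Cderiv_continuous, DGS, HDz. }
  assert (Hreg : forall z, D z -> ~ exceptional sigma z -> z <> p -> z <> m ->
     Cderiv (fun z => f z * H k z) z (phi z)).
  { intros z HDz Hz H1 H2. destruct (DH z HDz) as [h Hh].
    assert (Hprod := Cderiv_mult f (H k) z _ _ (Hf' z H1 H2) Hh).
    assert (HS := HGS z HDz Hz). cbv zeta in HS.
    rewrite (G_step_formula b c sigma (H k) z h Hz Hh) in HS.
    replace (phi z) with (f' z * H k z + f z * h); [exact Hprod|].
    unfold phi. rewrite HS, Eg, (H_formula k z HDz Hz H1 H2) by assumption.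
    fold Z. destruct (not_exceptional_neq z Hz) as [N1 N2].
    generalize (f' z) (f z) (G k z - a0 k - a1 k * z). intros s t x.
    field_off_poles. }
  assert (Hall : forall z, D z -> z <> p -> z <> m -> Cderiv (fun z => f z * H k z) z (phi z)).
  { intros z HDz H1 H2. destruct (four_points_isolated z 0 Z p m) as [r [Hr Hiso]].
    destruct (HD z HDz) as [r' [Hr' HD']].
    apply (Cderiv_removable _ phi z (Rmin r r')); [apply Rmin_pos; assumption| |apply Hphi; assumption|].
    - apply Ccontinuous_mult; [apply (decays_continuous p m d); assumption|].
      apply ex_Cderiv_continuous, DH, HDz.
    - intros y Hy Hne.
      destruct (Rmin_Rgt_l _ _ _ Hy) as [Y1 Y2].
      destruct (Hiso y Y1 Hne) as [N1 [N2 [N3 N4]]].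
      apply Hreg; try assumption; [apply HD', Y2|]. intros [E|E]; contradiction. }
  assert (H0 : I phi = 0).
  { apply (contour_integral_derivative gamma Hgamma (fun z => f z * H k z)).
    - intros w Hw. destruct (off_tau w Hw). apply Hphi; try assumption. apply on_contour_D, Hw.
    - intros w Hw. destruct (off_tau w Hw). apply Hall; try assumption. apply on_contour_D, Hw. }
  assert (Cg := decays_contour_continuous_tau e g Hg). assert (Cf := decays_contour_continuous_tau d f Hf).
  assert (CG := G_contour k). assert (CGS := G_contour (S k)).
  assert (Cz : contour_continuous gamma (fun z => z)) by (intros w _; apply Ccontinuous_id).
  assert (C1 := contour_continuous_mult _ _ Cg CG).
  assert (C2 := contour_continuous_mult _ _ Cf CGS).
  assert (C3 := contour_continuous_mult _ _ Cz Cg).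
  unfold I in *.
  rewrite (contour_integral_ext gamma phi (fun z =>
    (g z * G k z - a0 k * g z) - (a1 k * (z * g z) + f z * G (S k) z))) in H0
    by (intros; unfold phi; ring).
  rewrite !contour_integral_minus, contour_integral_plus, !contour_integral_scal in H0;
    try assumption; auto using contour_continuous_plus, contour_continuous_scal.
  2:{ intros w Hw. apply Ccontinuous_minus; [apply C1, Hw|].
      apply Ccontinuous_mult; [apply Ccontinuous_const|apply Cg, Hw]. }
  assert (Hsolve : forall A B X Y : C, A - B - (X + Y) = 0 -> A = Y + B + X).
  { intros A B X Y E. replace A with (A - B - (X + Y) + (Y + B + X)) by ring. rewrite E. ring. }
  exact (Hsolve _ _ _ _ H0).
Qed.

(* [(G_k - a_{k,0} - a_{k,1} z) / q], with its value at [tau_p] and [tau_m] taken from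
   [H_k = z (z - Z) K_k] *)
Let K (k : nat) (z : C) : C :=
  if excluded_middle_informative (z = p \/ z = m) then H k z / (z * (z - Z))
  else u z * v z * (G k z - a0 k - a1 k * z).

Lemma remainder_holomorphic k : holomorphic_on D (K k).
Proof.
  intros z HDz. destruct (HGH k) as [DG [DH _]].
  destruct (four_points_isolated z 0 Z p m) as [r [Hr Hiso]].
  destruct (HD z HDz) as [r' [Hr' HD']].
  destruct (excluded_middle_informative (z = p \/ z = m)) as [Hz|Hz].
  - assert (Hex : ~ exceptional sigma z).
    { destruct tau_not_exceptional as [A B]. destruct Hz as [->| ->]; assumption. }
    destruct (not_exceptional_neq z Hex) as [N1 N2].
    destruct (DH z HDz) as [h Hh].
    eexists. apply (Cderiv_ext_loc (fun z => H k z * / (z * (z - Z))) (K k) z _ (Rmin r r')).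
    + apply Rmin_pos; assumption.
    + intros y Hy. unfold K. destruct excluded_middle_informative as [Hy'|Hy']; [reflexivity|].
      destruct (Rmin_Rgt_l _ _ _ Hy) as [Y1 Y2].
      destruct (Hiso y Y1) as [M1 [M2 [M3 M4]]]; [intros ->; contradiction|].
      assert (Hexy : ~ exceptional sigma y) by (intros [E|E]; contradiction).
      rewrite (H_formula k y (HD' y Y2) Hexy M3 M4).
      destruct (not_exceptional_neq y Hexy) as [N3 N4].
      field_off_poles.
    + apply (Cderiv_mult (H k) (fun z => / (z * (z - Z)))); [exact Hh|].
      apply (Cderiv_comp Cinv (fun z => z * (z - Z))).
      * apply Cderiv_inv. apply Cmult_neq_0; assumption.
      * apply (Cderiv_mult (fun z => z) (fun z => z - Z)); [apply Cderiv_id|].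
        apply Cderiv_minus; [apply Cderiv_id|apply Cderiv_const].
  - assert (Hzp : z <> p) by tauto. assert (Hzm : z <> m) by tauto.
    destruct (DG z HDz) as [g Hg].
    eexists. apply (Cderiv_ext_loc (fun z => u z * v z * (G k z - a0 k - a1 k * z)) (K k) z _ r Hr).
    + intros y Hy. unfold K. destruct excluded_middle_informative as [Hy'|Hy']; [|reflexivity].
      destruct (excluded_middle_informative (y = z)) as [->|Hne]; [contradiction|].
      destruct (Hiso y Hy Hne) as [M1 [M2 [M3 M4]]]. tauto.
    + apply (Cderiv_mult (fun z => u z * v z) (fun z => G k z - a0 k - a1 k * z)).
      * apply (Cderiv_mult (fun z => u z) (fun z => v z)); apply kernel_Cderiv; assumption.
      * apply Cderiv_minus; [apply Cderiv_minus; [exact Hg|apply Cderiv_const]|].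
        apply Cderiv_scal, Cderiv_id.
Qed.

Lemma remainder_integral k w : holomorphic_on D w ->
  I (fun z => u z * v z * (w z * (G k z - a0 k - a1 k * z))) = 0.
Proof.
  intros Hw. unfold I.
  rewrite (contour_integral_ext gamma _ (fun z => w z * K k z)).
  - apply (cauchy_theorem gamma D); try assumption.
    intros z Hz. destruct (Hw z Hz) as [l Hl]. destruct (remainder_holomorphic k z Hz) as [l' Hl'].
    eexists. apply (Cderiv_mult w (K k)); eassumption.
  - intros z Hz. destruct (off_tau z Hz). unfold K.
    destruct excluded_middle_informative as [E|E]; [tauto|]. ring.
Qed.

Lemma integral_one : I (fun _ => 1) = 0.
Proof.
  apply (contour_integral_derivative gamma Hgamma (fun z => z)).
  - intros w _. apply Ccontinuous_const.
  - intros w _. apply Cderiv_id.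
Qed.

Lemma integral_split k w : contour_continuous gamma w ->
  I (fun z => w z * G k z) =
  I (fun z => w z * (G k z - a0 k - a1 k * z)) + a0 k * I w + a1 k * I (fun z => z * w z).
Proof.
  intros Cw. unfold I.
  assert (Cz : contour_continuous gamma (fun z => z)) by (intros x _; apply Ccontinuous_id).
  assert (C3 := contour_continuous_mult _ _ Cz Cw).
  assert (C4 : contour_continuous gamma (fun z => w z * (G k z - a0 k - a1 k * z))).
  { apply contour_continuous_mult; [exact Cw|]. intros x Hx.
    apply Ccontinuous_minus; [apply Ccontinuous_minus; [apply G_contour, Hx|apply Ccontinuous_const]|].
    apply Ccontinuous_mult; [apply Ccontinuous_const|apply Ccontinuous_id]. }
  rewrite (contour_integral_ext gamma _ (fun z =>
    (w z * (G k z - a0 k - a1 k * z) + a0 k * w z) + a1 k * (z * w z))) by (intros; ring).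
  rewrite !contour_integral_plus, !contour_integral_scal;
    try assumption; auto using contour_continuous_plus, contour_continuous_scal.
Qed.

(** [z u v = v + p u v], and products such as [u v] integrate to zero. *)
Lemma A_one_residue k : I (fun z => u z * v z * G k z) = 2 * PI * Ci * a1 k.
Proof.
  assert (Cuv := decays_contour_continuous_tau 2 _ (decays_uv p m)).
  rewrite (integral_split k (fun z => u z * v z) Cuv).
  assert (E0 : I (fun z => u z * v z * (G k z - a0 k - a1 k * z)) = 0).
  { rewrite <- (remainder_integral k (fun _ => 1)) by (intros z _; apply Cdiff_const).
    apply contour_integral_ext. intros z _. ring. }
  rewrite E0, (decays_integral_tau 2 _ (Nat.le_refl 2) (decays_uv p m)).
  assert (E1 : I (fun z => z * (u z * v z)) = 2 * PI * Ci).
  { rewrite <- Wm, <- (Cplus_0_r (contour_integral gamma (fun z => v z))).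
    rewrite <- (decays_integral_tau 2 _ (Nat.le_refl 2) (decays_scal p m p 2 _ (decays_uv p m))).
    unfold I. rewrite <- contour_integral_plus; try assumption.
    - apply contour_integral_ext. intros z Hz. destruct (off_tau z Hz).
      field_off_poles.
    - apply (decays_contour_continuous_tau 1), decays_v.
    - apply contour_continuous_scal, Cuv. }
  rewrite E1. ring.
Qed.

(** This is [A_{0,0}]: [(z - Z) u v = v - m u v], as [Z = p + m]. *)
Lemma A_zero_residue k : I (fun z => (v z + - m * (u z * v z)) * G k z) = 2 * PI * Ci * a0 k.
Proof.
  assert (Cuv := decays_contour_continuous_tau 2 _ (decays_uv p m)). assert (Cv := decays_contour_continuous_tau 1 _ (decays_v p m)).
  assert (Cmuv := contour_continuous_scal gamma (- m) _ Cuv).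
  rewrite (integral_split k _ (contour_continuous_plus gamma _ _ Cv Cmuv)).
  assert (E0 : I (fun z => (v z + - m * (u z * v z)) * (G k z - a0 k - a1 k * z)) = 0).
  { rewrite <- (remainder_integral k (fun z => z - Z)).
    - apply contour_integral_ext. intros z Hz. destruct (off_tau z Hz). rewrite <- sum_pm.
      field_off_poles.
    - intros z _. exists (1 - 0). apply Cderiv_minus; [apply Cderiv_id|apply Cderiv_const]. }
  assert (E1 : I (fun z => v z + - m * (u z * v z)) = 2 * PI * Ci).
  { unfold I. rewrite contour_integral_plus, contour_integral_scal; try assumption.
    rewrite Wm. fold (I (fun z => u z * v z)).
    rewrite (decays_integral_tau 2 _ (Nat.le_refl 2) (decays_uv p m)). ring. }
  assert (E2 : I (fun z => z * (v z + - m * (u z * v z))) = 0).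
  { transitivity (I (fun z => 1 + - Z * (u z * v z))).
    - apply contour_integral_ext. intros z Hz. destruct (off_tau z Hz).
      rewrite <- prod_pm. field_off_poles.
    - unfold I. rewrite contour_integral_plus, contour_integral_scal; try assumption.
      + fold (I (fun z => u z * v z)) (I (fun _ => 1)).
        rewrite (decays_integral_tau 2 _ (Nat.le_refl 2) (decays_uv p m)), integral_one. ring.
      + intros w _; apply Ccontinuous_const.
      + apply contour_continuous_scal, Cuv. }
  rewrite E0, E1, E2. ring.
Qed.

Lemma A_one_integral s : exists f, decays p m (s + 2) f /\ agrees (A_one b c sigma s) f /\
  forall k, I (fun z => f z * G k z) = 2 * PI * Ci * a1 (s + k).
Proof.
  induction s as [|s [f [Hf [Ha Hi]]]].
  - exists (fun z => u z * v z). split; [apply decays_uv|]. split; [|exact A_one_residue].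
    intros z _ H1 H2. simpl. rewrite quad_factor. fold p m.
    field_off_poles.
  - destruct (is_step_decays _ f Hf) as [g [Hg Hs]].
    exists g. split; [exact Hg|]. split; [exact (A_step_agrees _ f g Ha Hs)|].
    intros k. rewrite (step_transfer f g _ _ k Hf Hg Hs), Hi.
    rewrite (decays_integral_tau _ g) with (2 := Hg) by lia.
    rewrite (decays_integral_tau (s + 2)) with (2 := decays_mult_id p m _ _ Hg) by lia.
    replace (s + S k)%nat with (S s + k)%nat by lia. ring.
Qed.

(** The first step is special: [A_{0,0} = v - m u v] vanishes only to first order, and the
    step of [v] is [(c - 1) v^2] up to order three, where [c v^2] comes from the
    coefficient of the function and [- v^2] from that of its derivative.  Multiplied by
    [z] this leaves the residue [c - 1].  Later steps have order at least three and
    contribute nothing. *)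
Lemma A_zero_integral s : exists f, decays p m (s + 2) f /\ agrees (A_zero b c sigma (S s)) f /\
  forall k, I (fun z => f z * G k z) =
    2 * PI * Ci * (a0 (S s + k) + (c - 1) * a1 (s + k)).
Proof.
  induction s as [|s [f [Hf [Ha Hi]]]].
  - set (f := fun z => v z + - m * (u z * v z)).
    assert (Hme : decays p m 2 (fun z => - m * (u z * v z))) by apply decays_scal, decays_uv.
    assert (Hf : decays p m 1 f).
    { apply decays_plus; [apply decays_v|]. apply (decays_weaken p m 2); [lia|exact Hme]. }
    destruct (is_step_decays 2 _ Hme) as [g2 [Hg2 Hs2]].
    set (g1 := fun z => (c - 1) * (v z * v z) +
       (Z * (u z * v z * (v z * v z)) + (c * p + Z * (b - c)) * (u z * v z * v z))).
    assert (Hs1 : is_step (fun z => v z) g1).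
    { exists (fun z => - / ((z - m) * (z - m))). split.
      - intros z _ H2. apply kernel_Cderiv, H2.
      - intros z H1 H2. unfold g1.
        assert (N1 : z - p <> 0) by (apply Cminus_neq_0; assumption).
        assert (N2 : z - m <> 0) by (apply Cminus_neq_0; assumption).
        assert (E : v z * v z = u z * v z * (z * (z - Z) + Z) * (v z * v z)).
        { rewrite <- sum_pm at 1. rewrite <- prod_pm. field. split; assumption. }
        replace ((c - 1) * (v z * v z)) with (c * (v z * v z) - v z * v z) by ring.
        rewrite E at 2. field. split; assumption. }
    assert (Hrest : decays p m 3 (fun z => (Z * (u z * v z * (v z * v z)) +
       (c * p + Z * (b - c)) * (u z * v z * v z)) + g2 z)).
    { apply decays_plus; [apply decays_plus|exact Hg2]; apply decays_scal.
      - apply (decays_weaken p m 4); [lia|].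
        apply (decays_mult p m 2 2); [apply decays_uv|].
        apply (decays_mult p m 1 1); apply decays_v.
      - apply (decays_mult p m 2 1); [apply decays_uv|apply decays_v]. }
    assert (Hvv : decays p m 2 (fun z => (c - 1) * (v z * v z))).
    { apply decays_scal, (decays_mult p m 1 1); apply decays_v. }
    assert (Hg : decays p m 2 (fun z => g1 z + g2 z)).
    { apply (decays_ext p m 2 (fun z => (c - 1) * (v z * v z) + ((Z * (u z * v z * (v z * v z)) +
       (c * p + Z * (b - c)) * (u z * v z * v z)) + g2 z))).
      - apply decays_plus; [exact Hvv|]. apply (decays_weaken p m 3); [lia|exact Hrest].
      - intros z _ _. unfold g1. ring. }
    assert (Hs := is_step_plus _ _ _ _ Hs1 Hs2).
    exists (fun z => g1 z + g2 z). split; [exact Hg|]. split.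
    + apply (A_step_agrees _ f); [|exact Hs].
      intros z _ H1 H2. simpl. rewrite quad_factor. fold p m. fold Z. unfold f.
      rewrite <- sum_pm. field_off_poles.
    + intros k. rewrite (step_transfer f _ _ _ k Hf Hg Hs).
      unfold f at 1. rewrite A_zero_residue.
      rewrite (decays_integral_tau 2 _ (Nat.le_refl 2) Hg).
      assert (E : I (fun z => z * (g1 z + g2 z)) = (c - 1) * (2 * PI * Ci)).
      { set (rest := fun z => (c - 1) * m * (v z * v z) + z * ((Z * (u z * v z * (v z * v z)) +
          (c * p + Z * (b - c)) * (u z * v z * v z)) + g2 z)).
        assert (Hr : decays p m 2 rest).
        { apply decays_plus; [|apply (decays_mult_id p m 2), Hrest].
          apply decays_scal, (decays_mult p m 1 1); apply decays_v. }
        transitivity (I (fun z => (c - 1) * v z + rest z)).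
        - apply contour_integral_ext. intros z Hz. destruct (off_tau z Hz).
          unfold rest, g1. generalize (g2 z). intros t.
          field_off_poles.
        - assert (Cv := decays_contour_continuous_tau 1 _ (decays_v p m)).
          unfold I. rewrite contour_integral_plus, contour_integral_scal; try assumption.
          + rewrite Wm. fold (I rest). rewrite (decays_integral_tau 2 _ (Nat.le_refl 2) Hr). ring.
          + apply contour_continuous_scal, Cv.
          + exact (decays_contour_continuous_tau 2 _ Hr). }
      rewrite E. simpl. ring.
  - destruct (is_step_decays _ f Hf) as [g [Hg Hs]].
    exists g. split; [exact Hg|]. split; [exact (A_step_agrees _ f g Ha Hs)|].
    intros k. rewrite (step_transfer f g _ _ k Hf Hg Hs), Hi.
    rewrite (decays_integral_tau _ g) with (2 := Hg) by lia.
    rewrite (decays_integral_tau (s + 2)) with (2 := decays_mult_id p m _ _ Hg) by lia.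
    replace (S s + S k)%nat with (S (S s) + k)%nat by lia.
    replace (s + S k)%nat with (S s + k)%nat by lia. ring.
Qed.
End Expansion.

(* The sign in front of (c - 1) A_{s-1,1} is minus. The source prints plus, which
   is incompatible with its own definitions: for G_0 = tau they give a_{1,0} = 0,
   while the integral of tau A_{1,0} is c - 1 and that of tau A_{0,1} is 1 (both
   divided by 2 pi i). *)
Theorem corollary1 (a b c sigma : C) (U D : C -> Prop) (t : C -> C)
    (G H : nat -> C -> C) (gamma : R -> C) :
  tau_p sigma <> tau_m sigma ->
  change_of_variables sigma U t ->
  is_G0 a b c sigma U D t (G 0%nat) ->
  GH_recursion b c sigma D G H ->
  simple_closed_contour gamma ->
  encircles_once gamma (tau_p sigma) ->
  encircles_once gamma (tau_m sigma) ->
  (forall w : C, ~ D w -> exterior gamma w) ->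
  forall s : nat,
    coef1 sigma (G s) =
      1 / (2 * PI * Ci)
      * contour_integral gamma (fun tau : C => A_one b c sigma s tau * G 0%nat tau)
    /\
    coef0 sigma (G s) =
      1 / (2 * PI * Ci)
      * contour_integral gamma
          (fun tau : C =>
             G 0%nat tau
             * (A_zero b c sigma s tau
                - match s with
                  | O => 0
                  | S s' => (c - 1) * A_one b c sigma s' tau
                  end)).
Proof.
  intros Hpm _ [[Hopen _] _] HGH Hsimple [Hp Wp] [Hm Wm] Hext s.
  assert (Hgamma : closed_contour gamma) by (destruct Hsimple as [? [? [? _]]]; repeat split; assumption).
  assert (Hdiv : forall x, 1 / (2 * PI * Ci) * (2 * PI * Ci * x) = x).
  { intros x. unfold Cdiv. rewrite Cmult_assoc, Cmult_1_l, Cinv_l by exact two_pi_i_neq_0. ring. }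
  assert (HD : forall w, D w -> exists r, (0 < r)%R /\ disc_in w r D).
  { intros w Hw. apply Clocally_eps, Hopen, Hw. }
  assert (Hout : forall w, ~ D w -> outside gamma w).
  { intros w Hw. apply exterior_outside; auto. }
  assert (Hwind : forall w, winding_number gamma w = 1 ->
     contour_integral gamma (fun z => / (z - w)) = 2 * PI * Ci).
  { intros w Hw. unfold winding_number in Hw.
    rewrite (contour_integral_ext gamma _ (fun z => / (z - w))) in Hw
      by (intros; unfold Cdiv; ring).
    transitivity (contour_integral gamma (fun z => / (z - w)) / (2 * PI * Ci) * (2 * PI * Ci)).
    - unfold Cdiv. rewrite <- Cmult_assoc, Cinv_l by exact two_pi_i_neq_0. ring.
    - rewrite Hw. ring. }
  apply Hwind in Wp. apply Hwind in Wm.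
  assert (HonD : forall w, on_contour gamma w -> D w).
  { intros w Hw. apply NNPP. intros Hn. destruct (Hout w Hn). contradiction. }
  assert (Hone := A_one_integral b c sigma Hpm D G H gamma HD HGH Hgamma Hout Hp Hm Wp Wm).
  assert (Hzero := A_zero_integral b c sigma Hpm D G H gamma HD HGH Hgamma Hout Hp Hm Wp Wm).
  assert (CG : contour_continuous gamma (G 0%nat)).
  { intros w Hw. apply ex_Cderiv_continuous, (HGH 0%nat), HonD, Hw. }
  assert (Hcc : forall d f, decays (tau_p sigma) (tau_m sigma) d f -> contour_continuous gamma f).
  { intros d f. apply decays_contour_continuous; assumption. }
  assert (Hne : forall w, on_contour gamma w -> w <> tau_p sigma /\ w <> tau_m sigma).
  { intros w Hw. split; intros ->; contradiction. }
  split.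
  - destruct (Hone s) as [f [Hf [Ha Hi]]]. specialize (Hi 0%nat). rewrite Nat.add_0_r in Hi.
    rewrite (contour_integral_ext_two_points gamma _ (fun z => f z * G 0%nat z) 0 (2 * zeta sigma));
      [|assumption| |].
    + rewrite Hi, Hdiv. reflexivity.
    + apply contour_continuous_mult; [exact (Hcc _ _ Hf)|exact CG].
    + intros w Hw N1 N2. destruct (Hne w Hw). rewrite Ha; try assumption; [reflexivity|].
      intros [E|E]; contradiction.
  - destruct s as [|s].
    + assert (Hi := A_zero_residue b c sigma Hpm D G H gamma HD HGH Hgamma Hout Hp Hm Wp Wm 0).
      assert (E : contour_integral gamma (fun tau => G 0%nat tau * (A_zero b c sigma 0 tau - 0))
        = 2 * PI * Ci * coef0 sigma (G 0%nat)).
      { etransitivity; [|exact Hi]. apply contour_integral_ext.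
        intros z Hz. destruct (Hne z Hz). simpl. rewrite quad_factor, <- tau_sum.
        field_off_poles. }
      rewrite E, Hdiv. reflexivity.
    + destruct (Hzero s) as [f [Hf [Ha Hi]]]. specialize (Hi 0%nat). rewrite !Nat.add_0_r in Hi.
      destruct (Hone s) as [g [Hg [Hb Hj]]]. specialize (Hj 0%nat). rewrite Nat.add_0_r in Hj.
      assert (Cf := contour_continuous_mult gamma _ _ (Hcc _ _ Hf) CG).
      assert (Cg := contour_continuous_mult gamma _ _ (Hcc _ _ Hg) CG).
      rewrite (contour_integral_ext_two_points gamma _
        (fun z => f z * G 0%nat z + - (c - 1) * (g z * G 0%nat z)) 0 (2 * zeta sigma)); [|assumption| |].
      * rewrite contour_integral_plus, contour_integral_scal, Hi, Hj; try assumption.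
        -- rewrite <- (Hdiv (coef0 sigma (G (S s)))) at 1. ring.
        -- apply contour_continuous_scal, Cg.
      * apply contour_continuous_plus; [exact Cf|apply contour_continuous_scal, Cg].
      * intros w Hw N1 N2. destruct (Hne w Hw).
        assert (Hex : ~ exceptional sigma w) by (intros [E|E]; contradiction).
        rewrite Ha, Hb by assumption. ring.
Qed.
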